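(* Let $\mathsf G=(\mathsf V,\mathsf E)$ be a countable, locally finite, oriented, symmetric, connected graph equipped with independent random resistances $r(e)\sim\mu_e$, $e\in\mathsf E_{1/2}$, which are uniformly elliptic (i.e. there is a finite $\Lambda\ge1$ with $r(e)\in[1,\Lambda]$ for all $e$), or more generally which are such that $K(\mu)$ is finite. Then point-to-point effective resistances are uniformly stable to noise: $$\inf_{u,v\in\mathsf V}\ \operatorname{Corr}\left(\mathcal R^{u,v}(r),\mathcal R^{u,v}(r^\varepsilon)\right)\longrightarrow 1\qquad\text{as }\varepsilon\to0.$$
   Context: Graphs: symmetric means that each edge $e=(e_-,e_+)\in\mathsf E\subset\mathsf V^2$ occurs together with $-e=(e_+,e_-)$. $\mathsf E_{1/2}\subset\mathsf E$ contains exactly one of $e,-e$ for every edge. For $r\in(0,\infty)^{\mathsf E_{1/2}}$, $\ell^2_-(\mathsf E,r)$ is the Hilbert space of functions $\theta:\mathsf E\to\mathbb R$ with $\theta(-e)=-\theta(e)$ and $\sum_{e\in\mathsf E_{1/2}}r(e)\theta(e)^2<\infty$. With $d^*\theta(x)=\sum_{e_-=x}\theta(e)$, a unit flow from $u$ to $v$ ($u,v$ two distinct vertices) is $\theta\in\ell^2_-(\mathsf E,r)$ with $d^*\theta=\mathbf 1_u-\mathbf 1_v$, and the effective resistance between $u$ and $v$ is $$\mathcal R^{u,v}(r)=\inf\Big\{\sum_{e\in\mathsf E_{1/2}}r(e)\theta(e)^2:\ \theta\in \ell^2_-(\mathsf E,r)\text{ a unit flow from }u\text{ to }v\Big\}.$$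 Randomness: $r=(r(e))_{e\in\mathsf E_{1/2}}$ has law $\mathbb P=\bigotimes_{e\in\mathsf E_{1/2}}\mu_e$, each $\mu_e$ being a probability measure on $(0,\infty)$ with finite second moment; $r'$ is an independent copy of $r$. For $\varepsilon\in(0,1)$ the noisy version $r^\varepsilon$ is obtained from $r$ by replacing, at random and independently for each edge $e\in\mathsf E_{1/2}$, with probability $\varepsilon$, the value $r(e)$ by $r'(e)$. $\operatorname{Corr}$ denotes correlation. The quantity $K(\mu)\in[0,+\infty]$ is $$K(\mu)=C\,\sup_{e}\left(\mathbb E[r^8(e)]+\mathbb E[r^{-8}(e)]\right)^6\ \sup_e\frac{\mathbb E\left[(r(e)-r'(e))^2\left(\frac1{r^6(e)}+r^6(e)\right)\right]}{\mathbb E\left[(r(e)-r'(e))_+^2\min\left\{1,\frac1{r^4(e)}\right\}\right]},$$ where $C\in(0,+\infty)$ is a universal constant and $x_+=\max\{x,0\}$. *)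

(* Defs.v *)
From HB Require Import structures.
From mathcomp Require Import all_boot all_order all_algebra finmap.
From mathcomp Require Import all_classical all_reals all_analysis.

Set Implicit Arguments.
Unset Strict Implicit.
Unset Printing Implicit Defensive.

Import Order.TTheory GRing.Theory Num.Theory.
Import numFieldNormedType.Exports.

Local Open Scope classical_set_scope.
Local Open Scope ring_scope.

(* A graph on V is its edge relation [E : rel V]; the pair (x, y) with [E x y]
   is the oriented edge e with e_- = x and e_+ = y, and -e is (y, x). *)
Section Graph.
Context {V : countType}.
Implicit Types (E : rel V) (H : set (V * V)).

Definition locally_finite E := forall x, finite_set [set y | E x y].

Definition connected_graph E :=
  forall x y, exists p : seq V, path E x p /\ last x p = y.

(* The last clause is an equality rather than [False] since a loop (x, x) is
   its own reversal. *)
Definition half_edges E H :=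
  [/\ forall x y, H (x, y) -> E x y,
      forall x y, E x y -> H (x, y) \/ H (y, x) &
      forall x y, H (x, y) -> H (y, x) -> x = y].

End Graph.

Section Resistance.
Context {R : realType} {V : countType}.
Implicit Types (E : rel V) (H : set (V * V)) (r theta : V * V -> R).

Definition energy H r theta : \bar R :=
  \esum_(e in H) (r e * theta e ^+ 2)%:E.

(* Only the values of [theta] on edges matter: those on pairs of vertices which
   are not edges are unconstrained and enter none of the sums below. *)
Definition antisymmetric_on E theta :=
  forall x y, E x y -> theta (y, x) = - theta (x, y).

Definition ell2_anti E H r : set (V * V -> R) :=
  [set theta | antisymmetric_on E theta /\ (energy H r theta < +oo)%E].

Definition dstar E theta (x : V) : R :=
  \sum_(y \in [set y | E x y]) theta (x, y).

Definition unit_flow E H r (u v : V) : set (V * V -> R) :=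
  [set theta | ell2_anti E H r theta /\
     forall x, dstar E theta x = (x == u)%:R - (x == v)%:R].

(* [fine] discards nothing here: in a connected graph unit flows exist, so for
   positive [r] the infimum is a nonnegative real number. *)
Definition effective_resistance E H r (u v : V) : R :=
  fine (ereal_inf [set energy H r theta | theta in unit_flow E H r u v]).

End Resistance.

Section Randomness.
Context {R : realType}.

Definition mutually_independent d (T : measurableType d)
    (P : probability T R) (I : choiceType) (D : set I)
    (G : I -> set (set T)) :=
  forall (J : {fset I}) (A : I -> set T),
    [set` J] `<=` D -> (forall i, i \in J -> G i (A i)) ->
    P (\bigcap_(i in [set` J]) A i) = (\prod_(i <- J) P (A i))%E.

Definition generated_events d d' (T : measurableType d)
    (T' : measurableType d') (X : T -> T') : set (set T) :=
  preimage_set_system setT X measurable.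

(* When a variance vanishes the quotient is 0/0; the correlation is then taken
   to be 1. *)
Definition correlation d (T : measurableType d) (P : probability T R)
    (X Y : T -> R) : R :=
  if ('V_P[X] == 0%E) || ('V_P[Y] == 0%E) then 1
  else fine (covariance P X Y) /
       (Num.sqrt (fine 'V_P[X]) * Num.sqrt (fine 'V_P[Y])).

Context {V : countType} (H : set (V * V)).
Context d (T : measurableType d) (P : probability T R).

(* The three families of sources of randomness, indexed by a tagged edge: the
   resistances, their independent copies and the resampling marks. *)
Definition source_index : set ((V * V) + (V * V) + (V * V)) :=
  [set i | match i with inl (inl e) | inl (inr e) | inr e => H e end].

Definition source_events (r r' : V * V -> T -> R) (b : V * V -> T -> bool)
    (i : (V * V) + (V * V) + (V * V)) : set (set T) :=
  match i with
  | inl (inl e) => generated_events (r e)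
  | inl (inr e) => generated_events (r' e)
  | inr e => generated_events (b e)
  end.

Definition noisy (r r' : V * V -> T -> R) (b : V * V -> T -> bool)
    (e : V * V) (w : T) : R := if b e w then r' e w else r e w.

Definition random_resistance (E : rel V) (r : V * V -> T -> R) (u v : V)
    (w : T) : R := effective_resistance E H (fun e => r e w) u v.

End Randomness.

Section Ellipticity.
Context {R : realType} {V : countType} (H : set (V * V)).
Variable mu : V * V -> probability (measurableTypeR R) R.

Definition uniformly_elliptic :=
  exists Lambda : R, 1 <= Lambda /\
    forall e, H e -> mu e `[1, Lambda]%classic = 1%E.

Local Open Scope ereal_scope.

Definition moment_sup : \bar R :=
  ereal_sup [set \int[mu e]_x (x ^+ 8)%:E + \int[mu e]_x (x ^- 8)%:E
            | e in H].

(* In \bar R one has 0 / 0 = 0 * +oo = 0, so a constant resistance contributes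
   0 to the supremum; the denominator is at most 1, hence never +oo. *)
Definition ratio_sup : \bar R :=
  ereal_sup [set
    \int[mu e \x mu e]_z ((z.1 - z.2) ^+ 2 * (z.1 ^- 6 + z.1 ^+ 6))%:E /
    \int[mu e \x mu e]_z
       (Num.max (z.1 - z.2) 0 ^+ 2 * Num.min 1 (z.1 ^- 4))%:E
    | e in H].

Definition Kmu (C : R) : \bar R := C%:E * moment_sup ^+ 6 * ratio_sup.

End Ellipticity.

(* Main.v *)
(* The effective resistance is the increasing limit of the energies of the wired
   finite subnetworks, so it suffices to bound E (f(r) - f(r^eps))^2 by
   eps K Var f for such a finite energy f, with K independent of the network:
   the correlation of two variables X, Y of equal mean and variance is
   1 - E (X - Y)^2 / (2 Var X).

   Writing f^A for f with the weights in A resampled, E f f^A decreases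
   subadditively in A, hence E (f(r) - f(r^eps))^2 is at most eps times the total
   influence sum_i E (f - f^i)^2.  The total influence is at most (4 + c) Var f
   as soon as the squared second differences sum to at most c times the total
   influence.

   For such a c, second differences of the energy are explicit: for two edges
   e, e' they are controlled by G(e,e')^2 (t(e)^4 + t(e')^4), where t is the
   minimizing flow and G the Green matrix on divergence-free flows.  Since
   sum_e' r(e') G(e,e')^2 = G(e,e) <= 1 / r(e), summing over e' leaves t(e)^4, and
   the influence of e is in turn bounded below by t(e)^4 up to a factor depending
   on the law of r(e) only. *)
Require Import Defs.
From HB Require Import structures.
From mathcomp Require Import all_boot all_order all_algebra finmap.
From mathcomp Require Import ring lra.
From mathcomp Require Import all_classical all_reals all_analysis measurable_realfun.
Set Implicit Arguments.
Unset Strict Implicit.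
Unset Printing Implicit Defensive.
Import Order.TTheory GRing.Theory Num.Theory.
Import numFieldNormedType.Exports.
Local Open Scope classical_set_scope.
Local Open Scope ring_scope.

(** * Quadratic minimization with varying weights *)

(** Two tools compete: the Green identity holds for the actual weights, while independence asks for
    functions of the other weights only, and the weights need not be bounded away from 0 and
    infinity. Each pair of edges is therefore studied with its weights reset to 1: the second
    difference is then bounded by a factor for each of the two pairs (r, r') times a factor free of
    both edges. Reset weights are replaced by the actual ones only on the event that both lie in
    [1/L, L]. This event is independent of the reset quantities, so inserting it costs a factor 4
    when each weight has probability at least 1/2 to lie there. Resetting costs sixth powers of the
    weights against (r - r')^2, hence eighth moments, and r^-4 in the lower bound on influences:
    this is the shape of K. Wired subnetworks suit an infimum over all square-summable flows: a flow
    on the whole graph is admissible at every level, and the optimal flows converge edge by edge to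
    a unit flow. The energy of one fixed path dominates all levels, which is where finite second
    moments enter. *)

Definition weights {R : realFieldType} {m : nat} (r : 'I_m -> R) : 'M[R]_m :=
  diag_mx (\row_i r i).

HB.lock Definition kernel_basis {R : realFieldType} {m k : nat}
  (C : 'M[R]_(m, k)) : 'M[R]_(\rank (kermx C), m) := row_base (kermx C).

Definition gram {R : realFieldType} {m k : nat} (C : 'M[R]_(m, k)) r :=
  kernel_basis C *m weights r *m (kernel_basis C)^T.

(* [green C r] inverts the quadratic form of [weights r] on the row kernel of
   [C], so that [min_flow C th0 r] minimizes [energy_at r] among the [t] with
   [t *m C = th0 *m C]. *)
HB.lock Definition green {R : realFieldType} {m k : nat} (C : 'M[R]_(m, k))
    (r : 'I_m -> R) : 'M[R]_m :=
  (kernel_basis C)^T *m invmx (gram C r) *m kernel_basis C.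

HB.lock Definition min_flow {R : realFieldType} {m k : nat}
    (C : 'M[R]_(m, k)) (th0 : 'rV[R]_m) (r : 'I_m -> R) : 'rV[R]_m :=
  th0 - th0 *m weights r *m green C r.

Section QuadraticMinimum.
Context {R : realFieldType} {m k : nat}.
Variables (C : 'M[R]_(m, k)) (th0 : 'rV[R]_m).
Implicit Types (r q : 'I_m -> R) (t eta : 'rV[R]_m).
Local Notation kernel_basis := (kernel_basis C).
Local Notation gram := (gram C).
Local Notation green := (green C).
Local Notation min_flow := (min_flow C th0).

Definition energy_at r t : R := \sum_i r i * t 0 i ^+ 2.
Definition min_energy r : R := energy_at r (min_flow r).

Lemma weights_mulE r t i : (t *m weights r) 0 i = r i * t 0 i.
Proof. by rewrite mul_mx_diag !mxE mulrC. Qed.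

Lemma weights_tr r : (weights r)^T = weights r.
Proof. by rewrite /weights tr_diag_mx. Qed.

Lemma weights_formE r t eta :
  (t *m weights r *m eta^T) 0 0 = \sum_i r i * t 0 i * eta 0 i.
Proof. by rewrite mxE; apply: eq_bigr => i _; rewrite weights_mulE !mxE. Qed.

Lemma energy_atE r t : energy_at r t = (t *m weights r *m t^T) 0 0.
Proof. by rewrite weights_formE; apply: eq_bigr => i _; rewrite expr2 mulrA. Qed.

Lemma energy_at_ge0 r t : (forall i, 0 < r i) -> 0 <= energy_at r t.
Proof. by move=> r0; apply: sumr_ge0 => i _; rewrite mulr_ge0 ?sqr_ge0 ?ltW. Qed.

Lemma energy_at_eq0 r t : (forall i, 0 < r i) -> energy_at r t = 0 -> t = 0.
Proof.
move=> r0 /eqP; rewrite psumr_eq0 => [|i _]; last by rewrite mulr_ge0 ?sqr_ge0 ?ltW.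
move=> /allP h; apply/rowP => i; rewrite mxE.
have := h i; rewrite mem_index_enum => /(_ isT) /=.
by rewrite mulf_eq0 gt_eqF//= sqrf_eq0 => /eqP.
Qed.

Lemma kernel_basisC : kernel_basis *m C = 0.
Proof.
by apply/eqP; rewrite -sub_kermx kernel_basis.unlock eq_row_base.
Qed.

Lemma kernel_basisP eta : eta *m C = 0 -> exists u, eta = u *m kernel_basis.
Proof.
move=> /eqP; rewrite -sub_kermx -(eq_row_base (kermx C)) => /submxP[u ->].
by exists u; rewrite kernel_basis.unlock.
Qed.

Lemma greenC r : green r *m C = 0.
Proof. by rewrite green.unlock -mulmxA kernel_basisC mulmx0. Qed.

Lemma gram_tr r : (gram r)^T = gram r.
Proof. by rewrite /gram !trmx_mul trmxK weights_tr mulmxA. Qed.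

Lemma green_tr r : (green r)^T = green r.
Proof. by rewrite green.unlock !trmx_mul trmxK trmx_inv gram_tr mulmxA. Qed.

Lemma green_sym r i j : green r i j = green r j i.
Proof. by rewrite -{1}(green_tr r) mxE. Qed.

Lemma min_flowC r : min_flow r *m C = th0 *m C.
Proof. by rewrite min_flow.unlock mulmxBl -(mulmxA (th0 *m _)) greenC mulmx0 subr0. Qed.

Section Positive.
Variable r : 'I_m -> R.
Hypothesis r0 : forall i, 0 < r i.

(** A row vector killed by [gram r] yields an element of the row kernel of [C] with zero energy,
    hence zero by positivity; the basis is row free, so the vector is zero. *)
Lemma gram_unit : gram r \in unitmx.
Proof.
rewrite -row_free_unit -kermx_eq0; apply/eqP/row_matrixP => i.
set u := row i _; rewrite row0.
have uG : u *m gram r = 0 by rewrite /u -row_mul mulmx_ker row0.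
have uB : u *m kernel_basis = 0.
  apply: (energy_at_eq0 r0); rewrite energy_atE trmx_mul.
  have -> : u *m kernel_basis *m weights r *m (kernel_basis^T *m u^T) =
    u *m gram r *m u^T by rewrite /gram !mulmxA.
  by rewrite uG mul0mx mxE.
have /row_freeP[Bi BBi] : row_free kernel_basis by rewrite kernel_basis.unlock row_base_free.
by rewrite -[u]mulmx1 -BBi mulmxA uB mul0mx.
Qed.

(** Right multiplication by [weights r *m green r] is the projection onto the row kernel of [C],
    orthogonal for the form of [weights r]; it fixes that kernel. *)
Lemma weights_green eta : eta *m C = 0 -> eta *m weights r *m green r = eta.
Proof.
move=> /kernel_basisP[u ->].
have -> : u *m kernel_basis *m weights r *m green r =
   u *m (gram r *m invmx (gram r)) *m kernel_basis by rewrite green.unlock /gram !mulmxA.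
by rewrite mulmxV ?gram_unit// mulmx1.
Qed.

Lemma weights_green_mx n (X : 'M[R]_(n, m)) :
  X *m C = 0 -> X *m weights r *m green r = X.
Proof.
move=> XC; apply/row_matrixP => i; rewrite !row_mul weights_green//.
by rewrite -row_mul XC row0.
Qed.

Lemma min_flow_basis : min_flow r *m weights r *m kernel_basis^T = 0.
Proof.
rewrite min_flow.unlock !mulmxBl; apply/eqP; rewrite subr_eq0; apply/eqP.
have -> : th0 *m weights r *m green r *m weights r *m kernel_basis^T =
  th0 *m weights r *m kernel_basis^T *m (invmx (gram r) *m gram r).
  by rewrite green.unlock /gram !mulmxA.
by rewrite mulVmx ?gram_unit// mulmx1.
Qed.

Lemma min_flow_orth eta : eta *m C = 0 ->
  \sum_i r i * min_flow r 0 i * eta 0 i = 0.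
Proof.
move=> /kernel_basisP[u ->]; rewrite -weights_formE trmx_mul mulmxA.
by rewrite min_flow_basis mul0mx mxE.
Qed.

(** Pythagoras: [t] and the minimizer differ by an element of the kernel, to which the minimizer is
    orthogonal for the weights [r]. Minimality is the nonnegativity of the last sum. *)
Lemma energy_min_flow t : t *m C = th0 *m C ->
  energy_at r t = min_energy r + \sum_i r i * (t 0 i - min_flow r 0 i) ^+ 2.
Proof.
move=> tC; have dC : (t - min_flow r) *m C = 0 by rewrite mulmxBl min_flowC tC subrr.
have := min_flow_orth dC.
rewrite /min_energy /energy_at -big_split/= => orth.
transitivity (\sum_i r i * t 0 i ^+ 2
   - 2 * \sum_i r i * min_flow r 0 i * (t - min_flow r) 0 i).
  by rewrite orth mulr0 subr0.
by rewrite mulr_sumr -sumrB; apply: eq_bigr => i _; rewrite !mxE; ring.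
Qed.

End Positive.

Section TwoWeights.
Variables r q : 'I_m -> R.
Hypotheses (r0 : forall i, 0 < r i) (q0 : forall i, 0 < q i).

(** The difference of the two minimizers lies in the kernel and is orthogonal to each of them for
    its own weights. Either energy is thus a bilinear form at the pair of minimizers, and the
    formula has no remainder. *)
Lemma min_energyB : min_energy r - min_energy q =
  \sum_i (r i - q i) * min_flow r 0 i * min_flow q 0 i.
Proof.
have dC : (min_flow r - min_flow q) *m C = 0 by rewrite mulmxBl !min_flowC subrr.
have o1 := min_flow_orth r0 dC.
have o2 := min_flow_orth q0 dC.
transitivity (\sum_i r i * min_flow r 0 i ^+ 2 - \sum_i q i * min_flow q 0 i ^+ 2 -
  \sum_i r i * min_flow r 0 i * (min_flow r - min_flow q) 0 i -
  \sum_i q i * min_flow q 0 i * (min_flow r - min_flow q) 0 i).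
  by rewrite o1 o2 !subr0.
by rewrite -!sumrB; apply: eq_bigr => i _; rewrite !mxE; ring.
Qed.

(** A resolvent identity: the projection of [weights_green] fixes the difference of the minimizers
    and kills [min_flow r]; on [min_flow q] the weights [q] may be subtracted for free. *)
Lemma min_flowB i : min_flow r 0 i - min_flow q 0 i =
  \sum_j (q j - r j) * min_flow q 0 j * green r j i.
Proof.
have dC : (min_flow r - min_flow q) *m C = 0 by rewrite mulmxBl !min_flowC subrr.
have ortho p : (forall i, 0 < p i) -> min_flow p *m weights p *m green r = 0.
  by move=> p0; rewrite green.unlock !mulmxA min_flow_basis// !mul0mx.
have := weights_green r0 dC; rewrite !mulmxBl ortho// sub0r => e.
have -> : min_flow r 0 i - min_flow q 0 i = (min_flow r - min_flow q) 0 i.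
  by rewrite !mxE.
rewrite -e.
transitivity (- (min_flow q *m weights r *m green r) 0 i +
   (min_flow q *m weights q *m green r) 0 i).
  by rewrite ortho// [(0 : 'rV_m) _ _]mxE addr0 mxE.
rewrite !(mxE mulmx_key) -sumrN -big_split/=; apply: eq_bigr => j _.
by rewrite !weights_mulE; ring.
Qed.

Lemma greenB i j : green r i j - green q i j =
  \sum_l green r i l * (q l - r l) * green q l j.
Proof.
have e1 : green r *m weights q *m green q = green r.
  by rewrite weights_green_mx// greenC.
have e2 : green r *m weights r *m green q = green q.
  have /(congr1 trmx) : green q *m weights r *m green r = green q.
    by rewrite weights_green_mx// greenC.
  by rewrite !trmx_mul !green_tr weights_tr mulmxA.
rewrite -{1}e1 -{2}e2 !(mxE mulmx_key) -sumrB; apply: eq_bigr => l _.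
by rewrite /weights !mul_mx_diag !mxE; ring.
Qed.

End TwoWeights.

(** Rests on [green r *m weights r *m green r] being [green r]. *)
Lemma green_form r (w : 'rV[R]_m) : (forall i, 0 < r i) ->
  \sum_l r l * (w *m green r) 0 l ^+ 2 = (w *m green r *m w^T) 0 0.
Proof.
move=> r0; have -> : \sum_l r l * (w *m green r) 0 l ^+ 2 = energy_at r (w *m green r) by [].
rewrite energy_atE trmx_mul green_tr.
rewrite -!mulmxA [weights r *m _]mulmxA [green r *m (_ *m _)]mulmxA.
by rewrite [green r *m (_ *m _)]mulmxA weights_green_mx ?greenC// mulmxA.
Qed.

Lemma green_row r e : (forall i, 0 < r i) ->
  \sum_l r l * green r e l ^+ 2 = green r e e.
Proof.
move=> r0; have := green_form (delta_mx 0 e) r0.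
rewrite -rowE trmx_delta -colE !mxE => <-.
by apply: eq_bigr => l _; rewrite mxE.
Qed.

End QuadraticMinimum.

(** * Two by two blocks *)

Section TwoByTwo.
Context {R : realFieldType}.
Implicit Types s z a b c t : R.

(** Determinant of the identity plus diag(s - 1, z - 1) times [[a, c], [c, b]]. It governs the
    passage from weights 1, 1 on two coordinates to weights s, z. *)
Definition block_det a b c s z : R :=
  (1 + (s - 1) * a) * (1 + (z - 1) * b) - (s - 1) * (z - 1) * c ^+ 2.

Lemma affine_min s a : 0 < s -> 0 <= a <= 1 ->
  Num.min 1 s <= 1 + (s - 1) * a <= Num.max 1 s.
Proof. by move=> s0 a01; case: (leP 1 s) => s1; apply/andP; split; nra. Qed.

(** Expanded in the monomials 1, s, z, s z, the determinant has nonnegative coefficients of sum 1.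
    It is thus an average of these four numbers, each of which is at least the product of the
    minima. *)
Lemma block_det_ge a b c s z : 0 < s -> 0 < z -> 0 <= a <= 1 -> 0 <= b <= 1 ->
  c ^+ 2 <= a * b -> c ^+ 2 <= (1 - a) * (1 - b) ->
  Num.min 1 s * Num.min 1 z <= block_det a b c s z.
Proof.
rewrite /block_det; move: (c ^+ 2) (sqr_ge0 c) => C C0 s0 z0 a01 b01 C1 C2.
case: (leP 1 s) => s1; case: (leP 1 z) => z1.
- have : 0 <= (s - 1) * (z - 1) * (a * b - C) by rewrite !mulr_ge0//; lra.
  by nra.
- have : 0 <= (s - 1) * (1 - z) * C by rewrite !mulr_ge0//; lra.
  have : 0 <= (s - 1) * a * (1 + (z - 1) * b) by rewrite !mulr_ge0//; nra.
  by nra.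
- have : 0 <= (1 - s) * (z - 1) * C by rewrite !mulr_ge0//; lra.
  have : 0 <= (z - 1) * b * (1 + (s - 1) * a) by rewrite !mulr_ge0//; nra.
  by nra.
- have : 0 <= (1 - s) * (1 - z) * ((1 - a) * (1 - b) - C).
    by rewrite !mulr_ge0//; lra.
  have : 0 <= (1 - s) * z * (1 - a) by rewrite !mulr_ge0//; lra.
  have : 0 <= (1 - z) * s * (1 - b) by rewrite !mulr_ge0//; lra.
  by nra.
Qed.

Lemma block_det_le a b c s z L : 1 <= L -> 0 < s <= L -> 0 < z <= L ->
  0 <= a <= 1 -> 0 <= b <= 1 -> c ^+ 2 <= 1 ->
  block_det a b c s z <= 2 * L ^+ 2.
Proof.
rewrite /block_det; move: (c ^+ 2) (sqr_ge0 c) => C C0 L1 sL zL a01 b01 C1.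
have h1 : 0 <= 1 + (s - 1) * a <= L by apply/andP; split; nra.
have h2 : 0 <= 1 + (z - 1) * b <= L by apply/andP; split; nra.
have h3 : - ((s - 1) * (z - 1)) <= L ^+ 2 by nra.
have h4 : (1 + (s - 1) * a) * (1 + (z - 1) * b) <= L * L.
  by apply: ler_pM; lra.
have h5 : - ((s - 1) * (z - 1) * C) <= L ^+ 2.
  rewrite -mulNr; case: (leP 0 (- ((s - 1) * (z - 1)))) => h; last by nra.
  by rewrite -[leRHS]mulr1 ler_pM.
by rewrite expr2 in h5 *; lra.
Qed.

(* A symmetric matrix [[a, c], [c, b]] dominating its own square lies between
   0 and 1, hence so do its diagonal entries and the determinants of the matrix
   and of its complement to the identity. *)
Lemma sub_projection_block a b c :
  0 <= a -> 0 <= b -> c ^+ 2 <= a * b ->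
  (forall x y, (x * a + y * c) ^+ 2 + (x * c + y * b) ^+ 2 <=
     x ^+ 2 * a + 2 * x * y * c + y ^+ 2 * b) ->
  [/\ a <= 1, b <= 1 & c ^+ 2 <= (1 - a) * (1 - b)].
Proof.
move=> a0 b0 cab H.
have Ha : a ^+ 2 + c ^+ 2 <= a.
  by have := H 1 0; rewrite !(mul1r, mul0r, addr0, mulr0, expr1n, expr0n, mulr1)/=.
have Hb : c ^+ 2 + b ^+ 2 <= b.
  by have := H 0 1; rewrite !(mul1r, mul0r, add0r, mulr0, expr1n, expr0n, mulr1)/=.
have c0 := sqr_ge0 c.
have a1 : a <= 1 by nra.
have b1 : b <= 1 by nra.
split=> //.
(* For w = (x, y) with image A w and form value Q: 0 <= |w - A w|^2 = |w|^2 - 2 Q + |A w|^2 <= |w|^2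
   - Q. *)
have K x y : x ^+ 2 * a + 2 * x * y * c + y ^+ 2 * b <= x ^+ 2 + y ^+ 2.
  set Q := (X in X <= _); have := H x y; rewrite -/Q => HQ.
  have Qdef : Q = x * (x * a + y * c) + y * (x * c + y * b) by rewrite /Q; ring.
  set u := x * a + y * c in HQ Qdef; set v := x * c + y * b in HQ Qdef.
  have : 0 <= (x - u) ^+ 2 + (y - v) ^+ 2 by rewrite addr_ge0 ?sqr_ge0.
  have -> : (x - u) ^+ 2 + (y - v) ^+ 2 = x ^+ 2 + y ^+ 2 - 2 * Q + (u ^+ 2 + v ^+ 2).
    by rewrite Qdef; ring.
  by lra.
case: (ltP a 1) => a1'; last first.
  have -> : a = 1 by lra.
  by nra.
(* With second coordinate 1 - a, the complementary form is least at first coordinate c, where its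
   value is 1 - a times its determinant. *)
have := K c (1 - a).
move=> h; have : 0 <= (1 - a) * ((1 - a) * (1 - b) - c ^+ 2) by nra.
by rewrite pmulr_rge0 ?subr_gt0// subr_ge0.
Qed.

End TwoByTwo.

(** * Polynomial bounds for ratios of weights *)

Section Weights.
Context {R : realFieldType}.
Implicit Types s z : R.

(** The cost of moving weights to and from 1 is a square in one weight times a fourth power in
    another, up to inversion; x^2 y^4 <= x^6 + y^6 makes it sixth powers, those of the numerator in
    [ratio_sup]. *)
Definition poly_weight s z : R := s ^+ 6 + s ^- 6 + z ^+ 6 + z ^- 6.

Lemma poly_weightC s z : poly_weight s z = poly_weight z s.
Proof. by rewrite /poly_weight; ring. Qed.

Lemma poly_weight_ge0 s z : 0 <= poly_weight s z.
Proof. by rewrite /poly_weight !addr_ge0// ?invr_ge0 exprn_even_ge0. Qed.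

(** With X x the larger of x and x^-1, the left side is at most X s^2 X z^4, hence at most X s^6 + X
    z^6. *)
Lemma min_max_weight s z : 0 < s -> 0 < z ->
  Num.max 1 z ^+ 2 / (Num.min 1 s ^+ 2 * Num.min 1 z ^+ 4) <= poly_weight s z.
Proof.
move=> s0 z0.
pose X (x : R) := Num.max x x^-1.
have X1 x : 0 < x -> 1 <= X x.
  move=> x0; rewrite /X le_max; case: (leP 1 x) => //= x1.
  by rewrite -[leLHS]invr1 lef_pV2 ?posrE// ltW.
have X6 x : 0 < x -> X x ^+ 6 <= x ^+ 6 + x ^- 6.
  move=> x0; have h1 : 0 <= x ^+ 6 by rewrite exprn_ge0// ltW.
  have h2 : 0 <= x ^- 6 by rewrite invr_ge0.
  by rewrite /X; case: (leP x x^-1) => _; rewrite ?exprVn; lra.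
have hm x : 0 < x -> (Num.min 1 x)^-1 <= X x.
  move=> x0; case: (leP 1 x) => x1; first by rewrite invr1 X1.
  by rewrite /X le_max lexx orbT.
have hM x : 0 < x -> Num.max 1 x ^+ 2 / Num.min 1 x ^+ 4 <= X x ^+ 4.
  move=> x0; case: (leP 1 x) => x1.
    rewrite expr1n divr1 (le_trans (ler_weXn2l x1 (isT : (2 <= 4)%N)))//.
    by rewrite ler_pXn2r// ?nnegrE ?le_max ?lexx// ltW.
  rewrite expr1n div1r -exprVn.
  by rewrite ler_pXn2r// ?nnegrE ?le_max ?invr_ge0 ?lexx ?orbT// ltW.
have min0 (x : R) : 0 < x -> 0 < Num.min 1 x by move=> x0; rewrite lt_min ltr01.
have -> : Num.max 1 z ^+ 2 / (Num.min 1 s ^+ 2 * Num.min 1 z ^+ 4) =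
   ((Num.min 1 s)^-1) ^+ 2 * (Num.max 1 z ^+ 2 / Num.min 1 z ^+ 4).
  by rewrite exprVn; field; rewrite !gt_eqF ?min0.
apply: (@le_trans _ _ (X s ^+ 2 * X z ^+ 4)).
  have i0 : 0 <= (Num.min 1 s)^-1 by rewrite invr_ge0 ltW// min0.
  have x0 : 0 <= X s by rewrite (le_trans ler01)// X1.
  apply: ler_pM.
  - by rewrite exprn_ge0.
  - rewrite divr_ge0// exprn_ge0//; last by rewrite ltW// min0.
    by rewrite le_max ler01.
  - by rewrite ler_pXn2r ?hm// nnegrE.
  - exact: hM.
have := X6 s s0; have := X6 z z0; have := X1 s s0; have := X1 z z0.
rewrite /poly_weight; move: (X s) (X z) => x y y1 x1 hy hx.
apply: (@le_trans _ _ (x ^+ 6 + y ^+ 6)); last by lra.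
have x0 : 0 <= x by lra.
have y0 : 0 <= y by lra.
have px n : 0 <= x ^+ n by rewrite exprn_ge0.
have py n : 0 <= y ^+ n by rewrite exprn_ge0.
case: (leP x y) => xy.
  have : x ^+ 2 * y ^+ 4 <= y ^+ 2 * y ^+ 4 by rewrite ler_wpM2r ?ler_pXn2r.
  by rewrite -exprD; have := px 6; lra.
have : x ^+ 2 * y ^+ 4 <= x ^+ 2 * x ^+ 4 by rewrite ler_wpM2l ?ler_pXn2r// ltW.
by rewrite -exprD; have := py 6; lra.
Qed.

End Weights.

(** * Dependence of the energy on one and two weights *)

Section CoordinateUpdate.
Context {R : realFieldType} {m k : nat}.
Variables (C : 'M[R]_(m, k)) (th0 : 'rV[R]_m).
Implicit Types (r : 'I_m -> R) (e : 'I_m) (s z : R).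
Local Notation green := (green C).
Local Notation min_flow := (min_flow C th0).
Local Notation min_energy := (min_energy C th0).

Definition upd r e s : 'I_m -> R := fun i => if i == e then s else r i.

Lemma upd_gt0 r e s : (forall i, 0 < r i) -> 0 < s -> forall i, 0 < upd r e s i.
Proof. by move=> r0 s0 i; rewrite /upd; case: ifP. Qed.

Lemma updE r e s : upd r e s e = s.
Proof. by rewrite /upd eqxx. Qed.

Lemma sum_support1 (d F : 'I_m -> R) e :
  (forall i, i != e -> d i = 0) -> \sum_i d i * F i = d e * F e.
Proof.
move=> h; rewrite (bigD1 e)//= big1 ?addr0// => i ie.
by rewrite h// mul0r.
Qed.

Lemma sum_support2 (d F : 'I_m -> R) e e' : e != e' ->
  (forall i, i != e -> i != e' -> d i = 0) ->
  \sum_i d i * F i = d e * F e + d e' * F e'.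
Proof.
move=> ee' h; rewrite (bigD1 e)//= (bigD1 e') 1?eq_sym//= big1 ?addr0// => i.
by move=> /andP[ie ie']; rewrite h// mul0r.
Qed.

(* The reference quantities below are taken with the varying weights reset to 1,
   which makes them functions of the remaining weights alone: expectations over
   independent weights then factor. *)
Section OneCoordinate.
Variables (r : 'I_m -> R) (e : 'I_m).
Hypothesis r0 : forall i, 0 < r i.
Let p s := upd r e s.

Lemma min_energyB1 s s' : 0 < s -> 0 < s' ->
  min_energy (p s) - min_energy (p s') =
  (s - s') * min_flow (p s) 0 e * min_flow (p s') 0 e.
Proof.
move=> s0 s'0; rewrite min_energyB; try exact: upd_gt0.
under eq_bigr do rewrite -mulrA.
rewrite (@sum_support1 (fun i => p s i - p s' i) _ e) => [|i ie].
  by rewrite /p !updE mulrA.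
by rewrite /p /upd (negbTE ie) subrr.
Qed.

Lemma min_flowB1 i s s' : 0 < s -> 0 < s' ->
  min_flow (p s) 0 i - min_flow (p s') 0 i =
  (s' - s) * (min_flow (p s') 0 e * green (p s) e i).
Proof.
move=> s0 s'0; rewrite min_flowB; try exact: upd_gt0.
under eq_bigr do rewrite -mulrA.
rewrite (@sum_support1 (fun i => p s' i - p s i) _ e) => [|j je].
  by rewrite /p !updE.
by rewrite /p /upd (negbTE je) subrr.
Qed.

(** In [green_row] all terms are nonnegative; keeping the one at [e] gives s G^2 <= G for the
    diagonal entry G. *)
Lemma green_diag_le s : 0 < s -> 0 <= s * green (p s) e e <= 1.
Proof.
move=> s0; have p0 : forall i, 0 < p s i by exact: upd_gt0.
have := @green_row _ _ _ C (p s) e p0.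
rewrite (bigD1 e)//= {1}/p updE => h.
have h1 : 0 <= \sum_(i | i != e) p s i * green (p s) e i ^+ 2.
  by apply: sumr_ge0 => i _; rewrite mulr_ge0 ?sqr_ge0 ?ltW.
move: h1 h; move: (\sum_(i | _) _) (green _ e e) => S g S0 h.
have g2 := sqr_ge0 g.
have g0 : 0 <= g by rewrite -h addr_ge0// mulr_ge0// ltW.
rewrite (mulr_ge0 (ltW s0) g0)/=.
case: (eqVneq g 0) => [->|gn0]; first by rewrite mulr0.
have gp : 0 < g by rewrite lt_def gn0.
by rewrite -(ler_pM2r gp) mul1r; nra.
Qed.

Let t := min_flow (p 1) 0 e.
Let a := green (p 1) e e.

Lemma green_base_le : 0 <= a <= 1.
Proof. by have := green_diag_le ltr01; rewrite mul1r. Qed.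

(** By [affine_min] the factor lies between min 1 s and max 1 s, so the flows through [e] at weights
    1 and s are comparable in both directions. *)
Lemma min_flow_base s : 0 < s -> t = (1 + (s - 1) * a) * min_flow (p s) 0 e.
Proof.
by move=> s0; rewrite /t /a; have := min_flowB1 e ltr01 s0; lra.
Qed.

Lemma min_flow_base_le s : 0 < s -> t ^+ 2 <= Num.max 1 s ^+ 2 * min_flow (p s) 0 e ^+ 2.
Proof.
move=> s0; rewrite {1}(min_flow_base s0) exprMn ler_wpM2r ?sqr_ge0//.
have /andP[h1 h2] := affine_min s0 green_base_le.
have h3 : 0 <= Num.min 1 s by rewrite le_min ler01 ltW.
by rewrite ler_pXn2r// nnegrE; lra.
Qed.

Lemma min_flow_base_ge L s : 1 <= L -> L^-1 <= s ->
  min_flow (p s) 0 e ^+ 4 <= L ^+ 4 * t ^+ 4.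
Proof.
move=> L1 sL; have L0 : 0 < L by lra.
have Li0 : 0 < L^-1 by rewrite invr_gt0.
have Li1 : L^-1 <= 1 by rewrite invf_le1.
have s0 : 0 < s by lra.
rewrite (min_flow_base s0) -exprMn mulrA exprMn ler_peMl//.
  by rewrite (_ : 4%N = (2 * 2)%N)// exprM sqr_ge0.
apply: exprn_ege1; rewrite -[leLHS](mulfV (lt0r_neq0 L0)) ?ler_pM2l//.
have /andP[h1 _] := affine_min s0 green_base_le.
by apply: le_trans h1; rewrite le_min Li1.
Qed.

(** The energy difference is s - s' times the product of the flows at s and s', and resetting to
    weight 1 costs max 1 s and max 1 s'. Keeping only s' < s bounds both costs by max 1 s: hence the
    positive part and the factor min 1 (s^-4), the denominator in [ratio_sup]. *)
Lemma min_energy_diff_ge s s' : 0 < s -> 0 < s' ->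
  Num.max (s - s') 0 ^+ 2 * Num.min 1 (s ^- 4) * t ^+ 4 <=
  (min_energy (p s) - min_energy (p s')) ^+ 2.
Proof.
move=> s0 s'0; case: (leP (s - s') 0) => [_|ss'].
  by rewrite expr0n/= !mul0r sqr_ge0.
rewrite min_energyB1// -mulrA -(mulrA (s - s')) exprMn.
rewrite ler_wpM2l ?sqr_ge0//.
have M1 : 1 <= Num.max 1 s by rewrite le_max lexx.
have M0 : 0 < Num.max 1 s by lra.
have h1 := min_flow_base_le s0.
have h2 : t ^+ 2 <= Num.max 1 s ^+ 2 * min_flow (p s') 0 e ^+ 2.
  apply: le_trans (min_flow_base_le s'0) _.
  have ss : Num.max 1 s' <= Num.max 1 s.
    by rewrite ge_max !le_max lexx/= (_ : s' <= s) ?orbT//; lra.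
  have M'0 : 0 <= Num.max 1 s' by rewrite le_max ler01.
  by rewrite ler_wpM2r ?sqr_ge0// ler_pXn2r// nnegrE ltW.
have -> : Num.min 1 (s ^- 4) = Num.max 1 s ^- 4.
  case: (leP 1 s) => s1.
    by rewrite min_r// invf_le1 ?exprn_gt0// exprn_ege1.
  by rewrite expr1n invr1 min_l// invf_ge1 ?exprn_gt0// exprn_ile1// ltW.
rewrite ler_pdivrMl ?exprn_gt0// exprMn.
have sq (x : R) : x ^+ 4 = x ^+ 2 * x ^+ 2 by rewrite -exprD.
by rewrite !sq [leRHS]mulrACA ler_pM ?sqr_ge0.
Qed.

End OneCoordinate.

Section TwoCoordinates.
Variables (r : 'I_m -> R) (e e' : 'I_m).
Hypotheses (r0 : forall i, 0 < r i) (ee' : e != e').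
Let p s z := upd (upd r e s) e' z.

Let pe s z : p s z e = s.
Proof. by rewrite /p /upd eqxx (negbTE ee'). Qed.

Let pe' s z : p s z e' = z.
Proof. by rewrite /p updE. Qed.

Let p_gt0 s z : 0 < s -> 0 < z -> forall i, 0 < p s z i.
Proof. by move=> s0 z0; do 2!apply: upd_gt0 => //. Qed.

Let p_other s s' z z' i : i != e -> i != e' -> p s z i - p s' z' i = 0.
Proof. by move=> ie ie'; rewrite /p /upd (negbTE ie) (negbTE ie') subrr. Qed.

Let T1 s z := min_flow (p s z) 0 e.
Let T2 s z := min_flow (p s z) 0 e'.
Let K s z := green (p s z) e e'.
Let a := green (p 1 1) e e.
Let b := green (p 1 1) e' e'.
Let c := K 1 1.
Let t1 := T1 1 1.
Let t2 := T2 1 1.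

(** As both weights are 1, dropping the other coordinates in [green_form] shows that the two by two
    block dominates its own square. *)
Lemma base_block : [/\ 0 <= a <= 1, 0 <= b <= 1,
  c ^+ 2 <= a * b & c ^+ 2 <= (1 - a) * (1 - b)].
Proof.
have p0 := p_gt0 ltr01 ltr01.
have H (w : 'rV[R]_m) : (w *m green (p 1 1)) 0 e ^+ 2 + (w *m green (p 1 1)) 0 e' ^+ 2
    <= (w *m green (p 1 1) *m w^T) 0 0.
  rewrite -green_form// (bigD1 e)//= (bigD1 e') 1?eq_sym//= pe pe' !mul1r addrA.
  by rewrite lerDl sumr_ge0// => i _; rewrite mulr_ge0 ?sqr_ge0// ltW.
pose w x y : 'rV[R]_m := x *: delta_mx 0 e + y *: delta_mx 0 e'.
have wG x y i : (w x y *m green (p 1 1)) 0 i =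
    x * green (p 1 1) e i + y * green (p 1 1) e' i.
  by rewrite mulmxDl -!scalemxAl -!rowE !mxE.
have wGw x y : (w x y *m green (p 1 1) *m (w x y)^T) 0 0 =
    x ^+ 2 * a + 2 * x * y * c + y ^+ 2 * b.
  rewrite mxE; under eq_bigr do rewrite wG mulrC.
  have d1 i : (w x y)^T i 0 = x *+ (i == e) + y *+ (i == e').
    by rewrite !mxE !eqxx/= !mulr_natr.
  under eq_bigr do rewrite d1.
  rewrite (sum_support2 _ ee') => [|i /negbTE-> /negbTE->]; last by rewrite addr0.
  rewrite !eqxx [e' == e]eq_sym (negbTE ee') !mulr1n !mulr0n.
  by rewrite /a /b /c /K (green_sym _ _ e' e); ring.
have a0 : 0 <= a.
  have /(le_trans (addr_ge0 (sqr_ge0 _) (sqr_ge0 _))) := H (w 1 0); rewrite wGw.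
  by rewrite expr1n expr0n/= !mul0r mulr0 mul0r !addr0 mul1r.
have b0 : 0 <= b.
  have /(le_trans (addr_ge0 (sqr_ge0 _) (sqr_ge0 _))) := H (w 0 1); rewrite wGw.
  by rewrite expr1n expr0n/= mulr0 !mul0r !add0r mul1r.
have HK x y : (x * a + y * c) ^+ 2 + (x * c + y * b) ^+ 2 <=
     x ^+ 2 * a + 2 * x * y * c + y ^+ 2 * b.
  by have := H (w x y); rewrite wGw !wG (green_sym _ _ e' e).
have cab : c ^+ 2 <= a * b.
  (* At (b, -c) the form equals b (a b - c^2), which settles b > 0; if b = 0, the vector (0, 1)
     gives c = 0. *)
  have := HK b (- c); have := HK 0 1.
  rewrite !(mul1r, mul0r, add0r, mulr0, expr1n, expr0n, mulr1)/= => h1 h2.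
  have : 0 <= b ^+ 2 * a + 2 * b * - c * c + (- c) ^+ 2 * b.
    by apply: le_trans h2; rewrite addr_ge0 ?sqr_ge0.
  have -> : b ^+ 2 * a + 2 * b * - c * c + (- c) ^+ 2 * b = b * (a * b - c ^+ 2) by ring.
  case: (eqVneq b 0) => [be _|bn0 h].
    by move: h1; rewrite be expr0n/= addr0 mulr0.
  by rewrite -subr_ge0 -(pmulr_rge0 _ (_ : 0 < b))// lt_def bn0.
have [a1 b1 cc] := sub_projection_block a0 b0 cab HK.
by split; rewrite ?a0 ?b0.
Qed.

Let D s z := block_det a b c s z.

(** Cramer's rule: [greenB] gives two linear equations for the entries (e, e') and (e', e') at
    weights s, z, with determinant [D s z]. *)
Lemma green_block s z : 0 < s -> 0 < z -> K s z * D s z = c.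
Proof.
move=> s0 z0.
have h i j : green (p 1 1) i j - green (p s z) i j =
    (s - 1) * (green (p 1 1) i e * green (p s z) e j) +
    (z - 1) * (green (p 1 1) i e' * green (p s z) e' j).
  rewrite (greenB C (p_gt0 ltr01 ltr01) (p_gt0 s0 z0)).
  under eq_bigr do rewrite -mulrA mulrCA.
  rewrite (sum_support2 _ ee') => [|l]; last exact: p_other.
  by rewrite !pe !pe'; ring.
have := h e' e'; have := h e e'.
rewrite /D /block_det -/a -/b /K /c (green_sym _ _ e' e) /K.
move: (green (p 1 1) e e') (green (p s z) e e') (green (p s z) e' e').
move=> x X Y h1 h2.
have e1 : X * (1 + (s - 1) * a) = x - (z - 1) * (x * Y) by lra.
have e2 : Y * (1 + (z - 1) * b) = b - (s - 1) * (x * X) by lra.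
transitivity (X * (1 + (s - 1) * a) * (1 + (z - 1) * b)
   - (s - 1) * (z - 1) * x ^+ 2 * X); first by ring.
rewrite e1 mulrBl.
have -> : (z - 1) * (x * Y) * (1 + (z - 1) * b) =
  (z - 1) * x * (b - (s - 1) * (x * X)) by rewrite -e2; ring.
by ring.
Qed.

Lemma min_flow_block s z : 0 < s -> 0 < z ->
  t1 = (1 + (s - 1) * a) * T1 s z + (z - 1) * c * T2 s z /\
  t2 = (1 + (z - 1) * b) * T2 s z + (s - 1) * c * T1 s z.
Proof.
move=> s0 z0.
have h i : min_flow (p 1 1) 0 i - min_flow (p s z) 0 i =
    (s - 1) * (min_flow (p s z) 0 e * green (p 1 1) e i) +
    (z - 1) * (min_flow (p s z) 0 e' * green (p 1 1) e' i).
  rewrite (min_flowB C th0 (p_gt0 ltr01 ltr01) (p_gt0 s0 z0)).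
  under eq_bigr do rewrite -mulrA.
  rewrite (sum_support2 _ ee') => [|l]; last exact: p_other.
  by rewrite !pe !pe'.
have := h e; have := h e'.
rewrite /t1 /t2 /T1 /T2 /c /K -/a -/b (green_sym _ _ e' e).
by move=> h1 h2; split; lra.
Qed.

Let q := t1 ^+ 2 + t2 ^+ 2.
Let lo s z : R := (Num.min 1 s * Num.min 1 z) ^+ 2.

Let lo_gt0 s z : 0 < s -> 0 < z -> 0 < lo s z.
Proof. by move=> s0 z0; rewrite exprn_gt0// mulr_gt0// lt_min ltr01. Qed.

Let lo_le s z x : 0 < s -> 0 < z -> x ^+ 2 <= (x * D s z) ^+ 2 / lo s z.
Proof.
move=> s0 z0; rewrite ler_pdivlMr ?lo_gt0// exprMn ler_wpM2l ?sqr_ge0//.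
have [a1 b1 c1 c2] := base_block.
have h := block_det_ge s0 z0 a1 b1 c1 c2.
have m0 : 0 <= Num.min 1 s * Num.min 1 z.
  by rewrite mulr_ge0// le_min ler01 ltW.
by rewrite ler_pXn2r// nnegrE// (le_trans m0).
Qed.

Let c_le1 : c ^+ 2 <= 1.
Proof.
have [/andP[a0 a1] /andP[b0 b1] cab _] := base_block.
by rewrite (le_trans cab)// mulr_ile1.
Qed.

Let comb_le (x y u v : R) : (x * u - y * v) ^+ 2 <= 2 * (x ^+ 2 * u ^+ 2 + y ^+ 2 * v ^+ 2).
Proof.
have : 0 <= (x * u + y * v) ^+ 2 by rewrite sqr_ge0.
by rewrite -!exprMn; move: (x * u) (y * v) => X Y; nra.
Qed.

Let max_bounds z x : 0 < z -> 0 <= x <= 1 ->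
  (1 + (z - 1) * x) ^+ 2 <= Num.max 1 z ^+ 2 /\
  ((z - 1) * c) ^+ 2 <= Num.max 1 z ^+ 2.
Proof.
move=> z0 x01; have M1 : 1 <= Num.max 1 z by rewrite le_max lexx.
have m0 : 0 <= Num.min 1 z by rewrite le_min ler01 ltW.
have /andP[h1 h2] := affine_min z0 x01.
split; first by rewrite ler_pXn2r// nnegrE; lra.
rewrite exprMn; have z2 : (z - 1) ^+ 2 <= Num.max 1 z ^+ 2.
  case: (leP 1 z) => z1; first by lra.
  have : 0 <= z * (2 - z) by rewrite mulr_ge0//; lra.
  by lra.
by rewrite (le_trans _ z2)// ler_piMr ?sqr_ge0.
Qed.

(** Cramer's rule again, for the system of [min_flow_block]: the same determinant appears, bounded
    below by [block_det_ge]. *)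
Lemma min_flow_block_le s z : 0 < s -> 0 < z ->
  T1 s z ^+ 2 <= 2 * Num.max 1 z ^+ 2 * q / lo s z /\
  T2 s z ^+ 2 <= 2 * Num.max 1 s ^+ 2 * q / lo s z.
Proof.
move=> s0 z0; have [h1 h2] := min_flow_block s0 z0.
have [a01 b01 _ _] := base_block.
have e1 : T1 s z * D s z = (1 + (z - 1) * b) * t1 - (z - 1) * c * t2.
  by rewrite h1 h2 /D /block_det; ring.
have e2 : T2 s z * D s z = (1 + (s - 1) * a) * t2 - (s - 1) * c * t1.
  by rewrite h1 h2 /D /block_det; ring.
have [m1 m2] := max_bounds z0 b01; have [m3 m4] := max_bounds s0 a01.
split.
  apply: (le_trans (lo_le (T1 s z) s0 z0)).
  rewrite ler_pM2r ?invr_gt0 ?lo_gt0// e1 (le_trans (comb_le _ _ _ _))// -(mulrA 2 _ q).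
  by rewrite ler_pM2l// /q [leRHS]mulrDr lerD// ler_wpM2r ?sqr_ge0.
apply: (le_trans (lo_le (T2 s z) s0 z0)).
rewrite ler_pM2r ?invr_gt0 ?lo_gt0// e2 (le_trans (comb_le _ _ _ _))// -(mulrA 2 _ q).
by rewrite ler_pM2l// /q addrC [leRHS]mulrDr lerD// ler_wpM2r ?sqr_ge0.
Qed.

Lemma green_block_le s z : 0 < s -> 0 < z -> K s z ^+ 2 <= c ^+ 2 / lo s z.
Proof.
by move=> s0 z0; rewrite (le_trans (lo_le (K s z) s0 z0))// green_block.
Qed.

Let product_le s z s' z' : 0 < s -> 0 < z -> 0 < s' -> 0 < z' ->
  (T1 s z * T2 s' z' * K s' z) ^+ 2 <=
  4 * q ^+ 2 * c ^+ 2 * (poly_weight s s' * poly_weight z z').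
Proof.
move=> s0 z0 s'0 z'0; rewrite !exprMn.
have [h1 _] := min_flow_block_le s0 z0.
have [_ h2] := min_flow_block_le s'0 z'0.
have h3 := green_block_le s'0 z0.
apply: (@le_trans _ _ ((2 * Num.max 1 z ^+ 2 * q / lo s z) *
   (2 * Num.max 1 s' ^+ 2 * q / lo s' z') * (c ^+ 2 / lo s' z))).
  apply: ler_pM => //; try exact: sqr_ge0; last by apply: ler_pM => //; exact: sqr_ge0.
  by apply: mulr_ge0; exact: sqr_ge0.
have n (x : R) : 0 < x -> Num.min 1 x != 0 :> R by move=> x0; rewrite gt_eqF// lt_min ltr01.
have -> : (2 * Num.max 1 z ^+ 2 * q / lo s z) *
   (2 * Num.max 1 s' ^+ 2 * q / lo s' z') * (c ^+ 2 / lo s' z) =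
   4 * q ^+ 2 * c ^+ 2 *
   ((Num.max 1 s' ^+ 2 / (Num.min 1 s ^+ 2 * Num.min 1 s' ^+ 4)) *
    (Num.max 1 z ^+ 2 / (Num.min 1 z' ^+ 2 * Num.min 1 z ^+ 4))).
  by rewrite /lo; field; rewrite !n.
have mw (x y : R) : 0 < x -> 0 < y -> 0 <= Num.max 1 y ^+ 2 / (Num.min 1 x ^+ 2 * Num.min 1 y ^+ 4).
  move=> x0 y0; apply: divr_ge0; first exact: sqr_ge0.
  by apply: mulr_ge0; apply: exprn_ge0; rewrite le_min ler01 ltW.
apply: ler_wpM2l; first by apply: mulr_ge0; [apply: mulr_ge0|]; rewrite ?sqr_ge0.
apply: ler_pM; rewrite ?mw ?min_max_weight//.
by rewrite poly_weightC min_max_weight.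
Qed.

Let f s z := min_energy (p s z).

(** A discrete product rule: by [min_energyB] the difference in s is (s - s') times a product of two
    flows through e, and [min_flowB] gives the difference in z of each of them. *)
Lemma second_differenceE s z s' z' : 0 < s -> 0 < z -> 0 < s' -> 0 < z' ->
  f s z - f s' z - f s z' + f s' z' = (s - s') * (z' - z) *
  (T1 s z * T2 s' z' * K s' z + T1 s' z' * T2 s z * K s z').
Proof.
move=> s0 z0 s'0 z'0.
have D1 y : 0 < y -> f s y - f s' y = (s - s') * (T1 s y * T1 s' y).
  move=> y0; rewrite /f (min_energyB C th0 (p_gt0 s0 y0) (p_gt0 s'0 y0)).
  under eq_bigr do rewrite -mulrA.
  rewrite (sum_support2 _ ee') => [|l]; last exact: p_other.
  by rewrite !pe !pe' subrr mul0r addr0.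
have D2 x y y' : 0 < x -> 0 < y -> 0 < y' ->
    T1 x y - T1 x y' = (y' - y) * (T2 x y' * K x y).
  move=> x0 y0 y'0.
  rewrite /T1 (min_flowB C th0 (p_gt0 x0 y0) (p_gt0 x0 y'0)).
  under eq_bigr do rewrite -mulrA.
  rewrite (sum_support2 _ ee') => [|l]; last exact: p_other.
  by rewrite !pe !pe' subrr mul0r add0r (green_sym _ _ e' e).
transitivity ((s - s') * (T1 s z * (T1 s' z - T1 s' z') - T1 s' z' * (T1 s z' - T1 s z))).
  have := D1 z z0; have := D1 z' z'0 => h1 h2.
  transitivity ((f s z - f s' z) - (f s z' - f s' z')); first by ring.
  by rewrite h1 h2; ring.
by rewrite (D2 s' z z')// (D2 s z' z)//; ring.
Qed.

(** The point is the separation of variables: one factor in (s, s'), one in (z, z'), and a last one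
    depending on the remaining weights only. For random weights these are independent. *)
Lemma second_difference_le s z s' z' : 0 < s -> 0 < z -> 0 < s' -> 0 < z' ->
  (f s z - f s' z - f s z' + f s' z') ^+ 2 <=
  32 * ((s - s') ^+ 2 * poly_weight s s') * ((z - z') ^+ 2 * poly_weight z z') *
  (c ^+ 2 * (t1 ^+ 4 + t2 ^+ 4)).
Proof.
move=> s0 z0 s'0 z'0; rewrite second_differenceE// !exprMn.
have h1 := product_le s0 z0 s'0 z'0.
have h2 := product_le s'0 z'0 s0 z0.
rewrite (poly_weightC s') (poly_weightC z') in h2.
have q4 : q ^+ 2 <= 2 * (t1 ^+ 4 + t2 ^+ 4).
  have -> (x : R) : x ^+ 4 = (x ^+ 2) ^+ 2 by rewrite -exprM.
  by rewrite /q; have := sqr_ge0 (t1 ^+ 2 - t2 ^+ 2); nra.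
have W0 : 0 <= poly_weight s s' * poly_weight z z' by rewrite mulr_ge0// poly_weight_ge0.
set X := T1 s z * T2 s' z' * K s' z in h1 *.
set Y := T1 s' z' * T2 s z * K s z' in h2 *.
have XY : (X + Y) ^+ 2 <= 32 * (c ^+ 2 * (t1 ^+ 4 + t2 ^+ 4)) *
     (poly_weight s s' * poly_weight z z').
  apply: (@le_trans _ _ (2 * (X ^+ 2 + Y ^+ 2))); first by have := sqr_ge0 (X - Y); nra.
  apply: (@le_trans _ _ (16 * q ^+ 2 * (c ^+ 2 * (poly_weight s s' * poly_weight z z')))).
    by rewrite -[16 * _ * _]/(16 * q ^+ 2 * _) ; lra.
  rewrite [leRHS](_ : _ = 16 * (2 * (t1 ^+ 4 + t2 ^+ 4)) *
     (c ^+ 2 * (poly_weight s s' * poly_weight z z'))); last by ring.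
  by rewrite ler_wpM2r// ?ler_pM2l// mulr_ge0// sqr_ge0.
rewrite (_ : (z' - z) ^+ 2 = (z - z') ^+ 2); last by ring.
rewrite [leRHS](_ : _ = (s - s') ^+ 2 * (z - z') ^+ 2 *
  (32 * (c ^+ 2 * (t1 ^+ 4 + t2 ^+ 4)) * (poly_weight s s' * poly_weight z z'))); last by ring.
by rewrite ler_wpM2l// mulr_ge0// sqr_ge0.
Qed.

(** The way back from reset weights to the actual ones, which is where [green_row] can be summed. No
    moment is spent, but both weights must lie in [1/L, L]. *)
Lemma base_block_le s z L : 1 <= L -> L^-1 <= s <= L -> L^-1 <= z <= L ->
  c ^+ 2 * (t1 ^+ 4 + t2 ^+ 4) <=
  64 * L ^+ 8 * (K s z ^+ 2 * (T1 s z ^+ 4 + T2 s z ^+ 4)).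
Proof.
move=> L1 /andP[sL Ls] /andP[zL Lz].
have L0 : 0 < L by lra.
have Li0 : 0 < L^-1 by rewrite invr_gt0.
have s0 : 0 < s by lra.
have z0 : 0 < z by lra.
have [a01 b01 c1 c2] := base_block.
have Dle : D s z <= 2 * L ^+ 2 by apply: block_det_le => //; apply/andP.
have Dge : 0 <= D s z.
  apply: le_trans (block_det_ge s0 z0 a01 b01 c1 c2).
  by rewrite mulr_ge0// le_min ler01 ltW.
have [h1 h2] := min_flow_block s0 z0.
have bnd x y u v : x ^+ 2 <= L ^+ 2 -> y ^+ 2 <= L ^+ 2 ->
    (x * u + y * v) ^+ 4 <= 8 * L ^+ 4 * (u ^+ 4 + v ^+ 4).
  move=> xL yL.
  have sq (w : R) : w ^+ 4 = (w ^+ 2) ^+ 2 by rewrite -exprM.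
  have le2 : (x * u + y * v) ^+ 2 <= 2 * L ^+ 2 * (u ^+ 2 + v ^+ 2).
    have := comb_le x (- y) u v; rewrite mulNr opprK sqrrN => h.
    rewrite (le_trans h)// -(mulrA 2 (L ^+ 2)) ler_pM2l// [leRHS]mulrDr.
    by rewrite lerD// ler_wpM2r ?sqr_ge0.
  rewrite [X in X <= _]sq [L ^+ 4]sq [u ^+ 4]sq [v ^+ 4]sq.
  apply: (@le_trans _ _ ((2 * L ^+ 2 * (u ^+ 2 + v ^+ 2)) ^+ 2)).
    by rewrite ler_pXn2r// nnegrE ?sqr_ge0// (le_trans _ le2)// sqr_ge0.
  rewrite !exprMn; move: (u ^+ 2) (v ^+ 2) (L ^+ 2) => U V l.
  have := sqr_ge0 (U - V); have := sqr_ge0 l.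
  by nra.
have ML y : L^-1 <= y <= L -> Num.max 1 y ^+ 2 <= L ^+ 2.
  move=> /andP[yL Ly].
  by rewrite ler_pXn2r ?nnegrE ?ge_max ?L1 ?(ltW L0)// le_max ler01.
have [m1 m2] := max_bounds z0 b01; have [m3 m4] := max_bounds s0 a01.
have Mz := ML z (introT andP (conj zL Lz)).
have Ms := ML s (introT andP (conj sL Ls)).
have B1 : t1 ^+ 4 <= 8 * L ^+ 4 * (T1 s z ^+ 4 + T2 s z ^+ 4).
  by rewrite h1; apply: bnd; [apply: le_trans m3 Ms | apply: le_trans m2 Mz].
have B2 : t2 ^+ 4 <= 8 * L ^+ 4 * (T1 s z ^+ 4 + T2 s z ^+ 4).
  rewrite h2 [T1 s z ^+ 4 + _]addrC.
  by apply: bnd; [apply: le_trans m1 Mz | apply: le_trans m4 Ms].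
have cK : c ^+ 2 <= 4 * L ^+ 4 * K s z ^+ 2.
  rewrite -(green_block s0 z0) exprMn mulrC ler_wpM2r ?sqr_ge0//.
  rewrite (_ : 4 * L ^+ 4 = (2 * L ^+ 2) ^+ 2); last by ring.
  by rewrite ler_pXn2r // nnegrE; apply: mulr_ge0 => //; exact: sqr_ge0.
have T0 : 0 <= T1 s z ^+ 4 + T2 s z ^+ 4.
  by rewrite addr_ge0// (_ : 4%N = (2 * 2)%N)// exprM sqr_ge0.
rewrite [leRHS](_ : _ = (4 * L ^+ 4 * K s z ^+ 2) *
  (16 * L ^+ 4 * (T1 s z ^+ 4 + T2 s z ^+ 4))); last by ring.
apply: ler_pM => //; first exact: sqr_ge0; last by lra.
by rewrite addr_ge0// (_ : 4%N = (2 * 2)%N)// exprM sqr_ge0.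
Qed.

End TwoCoordinates.
End CoordinateUpdate.

(** * Independent coordinates *)

Section CoordinateSpace.
Context {R : realType} {J : finType}.

Definition boxes : set (set (J -> R)) :=
  [set B | exists A : J -> set R,
     (forall j, measurable (A j)) /\ B = [set z | forall j, A j (z j)]].

(** Boxes are stable under intersection, so a law on this space is determined by its values on
    boxes; see [eq_law]. *)
Definition coord_space := g_sigma_algebraType boxes.

Lemma boxes_setI_closed : setI_closed boxes.
Proof.
move=> _ _ [A [mA ->]] [B [mB ->]]; exists (fun j => A j `&` B j); split.
  by move=> j; exact: measurableI.
apply/seteqP; split => z /=; first by move=> [h1 h2] j; split.
by move=> h; split => j; have [] := h j.
Qed.

Lemma boxes_setT : boxes setT.
Proof. by exists (fun=> setT); split => //; apply/seteqP; split. Qed.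

Lemma measurable_coord j : measurable_fun setT (fun z : coord_space => z j).
Proof.
move=> _ Y mY; rewrite setTI; apply: sub_sigma_algebra.
exists (fun i => if i == j then Y else setT); split.
  by move=> i; case: ifP.
apply/seteqP; split => z /=; first by move=> h i; case: eqP => [->|].
by move=> /(_ j); rewrite eqxx.
Qed.

Lemma measurable_box d (T : measurableType d) (Z : T -> J -> R) (A : J -> set R) :
  (forall j, measurable_fun setT (fun w => Z w j)) ->
  (forall j, measurable (A j)) ->
  measurable [set w | forall j, A j (Z w j)].
Proof.
move=> mZ mA.
rewrite (_ : [set _ | _] = \bigcap_(j in [set: J]) ((fun w => Z w j) @^-1` A j)).
  apply: fin_bigcap_measurable => //.
  by move=> j _; rewrite -[X in measurable X]setTI; exact: mZ.
by apply/seteqP; split => w /= h j; [move=> _|]; exact: h.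
Qed.

Lemma measurable_coordP d (T : measurableType d) (Z : T -> J -> R) :
  (forall j, measurable_fun setT (fun w => Z w j)) ->
  measurable_fun setT (Z : T -> coord_space).
Proof.
move=> mZ; apply: (@measurability _ _ T coord_space setT Z boxes erefl).
move=> _ [_ [A [mA ->]] <-]; rewrite setTI.
exact: measurable_box.
Qed.

Local Open Scope ereal_scope.

Lemma eq_law d1 d2 (T1 : measurableType d1) (T2 : measurableType d2)
    (P1 : probability T1 R) (P2 : probability T2 R)
    (Z1 : T1 -> coord_space) (Z2 : T2 -> coord_space) :
  measurable_fun setT Z1 -> measurable_fun setT Z2 ->
  (forall A : J -> set R, (forall j, measurable (A j)) ->
    P1 [set w | forall j, A j (Z1 w j)] = P2 [set w | forall j, A j (Z2 w j)]) ->
  forall phi : coord_space -> \bar R, measurable_fun setT phi ->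
  (forall z, 0 <= phi z) ->
  \int[P1]_w phi (Z1 w) = \int[P2]_w phi (Z2 w).
Proof.
move=> mZ1 mZ2 h phi mphi phi0.
rewrite -[LHS](@ge0_integral_pushforward _ _ _ _ R _ mZ1 P1 setT)//.
rewrite -[RHS](@ge0_integral_pushforward _ _ _ _ R _ mZ2 P2 setT)//.
apply: eq_measure_integral => A mA _.
apply: (@g_sigma_algebra_measure_unique _ R coord_space boxes _ (fun=> setT)).
- by move=> B hB; exact: sub_sigma_algebra.
- by move=> _; exact: boxes_setT.
- by rewrite bigcup_const//; exists 0%N.
- exact: boxes_setI_closed.
- by move=> _ [B [mB ->]]; exact: h.
- by move=> _; rewrite /= /pushforward preimage_setT probability_setT ltry.
- exact: mA.
Qed.

(** One product over all coordinates is enough: a subfamily is reached by taking [A j] to be [setT]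
    elsewhere. *)
Definition independent_coords d (T : measurableType d) (P : probability T R)
    (Z : T -> J -> R) :=
  forall A : J -> set R, (forall j, measurable (A j)) ->
    P [set w | forall j, A j (Z w j)] = \prod_j P [set w | A j (Z w j)].

Section Independent.
Context d (T : measurableType d) (P : probability T R) (Z : T -> coord_space).
Hypotheses (mZ : forall j, measurable_fun setT (fun w => Z w j))
  (iZ : independent_coords P Z).

Lemma law_perm (s : J -> J) : involutive s ->
  (forall j B, measurable B -> P [set w | B (Z w (s j))] = P [set w | B (Z w j)]) ->
  forall phi : coord_space -> \bar R, measurable_fun setT phi ->
  (forall z, 0 <= phi z) ->
  \int[P]_w phi (fun j => Z w (s j)) = \int[P]_w phi (Z w).
Proof.
move=> sK h; apply: eq_law; try exact: measurable_coordP.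
move=> A mA; rewrite (iZ mA).
transitivity (P [set w | forall j, A (s j) (Z w j)]).
  by congr (P _); apply/seteqP; split => w /= hw j;
    [rewrite -{2}(sK j) | have := hw (s j); rewrite sK].
rewrite (iZ (fun j => mA (s j))).
rewrite (reindex_inj (inv_inj sK))/=; apply: eq_bigr => j _.
by rewrite sK h.
Qed.

Lemma integral_mul_prod d1 (T1 : measurableType d1) (P1 : probability T1 R)
    (f g : T1 -> \bar R) :
  measurable_fun setT f -> measurable_fun setT g ->
  (forall w, 0 <= f w) -> (forall w, 0 <= g w) ->
  \int[P1 \x P1]_w (f w.1 * g w.2) = \int[P1]_w f w * \int[P1]_w g w.
Proof.
move=> mf mg f0 g0.
have mfg : measurable_fun setT (fun w : T1 * T1 => f w.1 * g w.2).
  by apply: emeasurable_funM; apply: measurableT_comp.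
rewrite fubini_tonelli1//=; last by move=> w; exact: mule_ge0.
rewrite -ge0_integralZr//; last exact: integral_ge0.
apply: eq_integral => x _; rewrite /fubini_F/=.
by rewrite ge0_integralZl.
Qed.

(** [Z] has the law of [W], which takes its coordinates in [D] from one copy of the space and the
    others from a second copy; Tonelli's theorem on the product then separates [U] from [V]. *)
Lemma independent_integralM (D : pred J) (U V : coord_space -> \bar R) :
  measurable_fun setT U -> measurable_fun setT V ->
  (forall z, 0 <= U z) -> (forall z, 0 <= V z) ->
  (forall z z', (forall j, D j -> z j = z' j) -> U z = U z') ->
  (forall z z', (forall j, ~~ D j -> z j = z' j) -> V z = V z') ->
  \int[P]_w (U (Z w) * V (Z w)) = \int[P]_w U (Z w) * \int[P]_w V (Z w).
Proof.
move=> mU mV U0 V0 UD VD.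
pose W (w : T * T) : coord_space := fun j => if D j then Z w.1 j else Z w.2 j.
have mZS : measurable_fun setT Z by exact: measurable_coordP.
have mW : measurable_fun setT W.
  apply: measurable_coordP => j; rewrite /W; case: (D j).
    exact: (measurableT_comp (mZ j) measurable_fst).
  exact: (measurableT_comp (mZ j) measurable_snd).
transitivity (\int[P \x P]_w (U (W w) * V (W w))).
  apply: (@eq_law _ _ _ _ P (P \x P)%E Z W _ _ _ (fun z => U z * V z)) => //.
  - move=> A mA.
    have -> : [set w | forall j, A j (W w j)] =
       [set w | forall j, (if D j then A j else setT) (Z w j)] `*`
       [set w | forall j, (if D j then setT else A j) (Z w j)].
      apply/seteqP; split => [w /= h|w /= [h1 h2] j].
        by split => j; have := h j; rewrite /W; case: (D j).
      by have := h1 j; have := h2 j; rewrite /W; case: (D j).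
    have mA1 j : measurable (if D j then A j else setT) by case: ifP.
    have mA2 j : measurable (if D j then setT else A j) by case: ifP.
    rewrite [RHS]product_measure1E; [|exact: (measurable_box mZ mA1)|
      exact: (measurable_box mZ mA2)].
    have /= e1 := iZ mA1; have /= e2 := iZ mA2.
    rewrite (iZ mA) e1 e2.
    rewrite -big_split/=; apply: eq_bigr => j _; case: (D j).
      by rewrite [X in _ * X]probability_setT mule1.
    by rewrite [X in X * _]probability_setT mul1e.
  - exact: emeasurable_funM.
  - by move=> z; exact: mule_ge0.
rewrite -[RHS](@integral_mul_prod _ _ P (U \o Z) (V \o Z))//=; try exact: measurableT_comp.
apply: eq_integral => w _; congr (_ * _).
  by apply: UD => j Dj; rewrite /W Dj.
by apply: VD => j /negbTE Dj; rewrite /W Dj.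
Qed.

End Independent.
End CoordinateSpace.

(** * Measurability of the minimal energy *)

Section MatrixMeasurability.
Context {R : realType} {d : measure_display} {X : measurableType d}.

Lemma measurable_fun_inv (f : X -> R) :
  measurable_fun setT f -> measurable_fun setT (fun x => (f x)^-1).
Proof.
move=> mf.
(* This form of the inverse, valid also at 0 where the inverse is 0, reduces the claim to
   measurability of real powers. *)
have -> : (fun x => (f x)^-1) = (fun x => f x * ((f x) ^+ 2) `^ (-1)).
  apply/funext => x; rewrite powR_inv1 ?sqr_ge0//.
  have [->|f0] := eqVneq (f x) 0; first by rewrite invr0 mul0r.
  by rewrite expr2 invfM mulrA divff// mul1r.
apply: measurable_funM => //.
apply: (measurableT_comp (measurable_powR (-1))).
exact: measurable_funX.
Qed.

Definition measurable_mx p q (A : X -> 'M[R]_(p, q)) :=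
  forall i j, measurable_fun setT (fun x => A x i j).

Lemma measurable_mx_cst p q (A : 'M[R]_(p, q)) : measurable_mx (fun=> A).
Proof. by move=> i j; exact: measurable_cst. Qed.

Lemma measurable_mxM p q n (A : X -> 'M[R]_(p, q)) (B : X -> 'M[R]_(q, n)) :
  measurable_mx A -> measurable_mx B -> measurable_mx (fun x => A x *m B x).
Proof.
move=> mA mB i j; under eq_fun do rewrite mxE.
by apply: measurable_sum => l; exact: measurable_funM.
Qed.

Lemma measurable_mxB p q (A B : X -> 'M[R]_(p, q)) :
  measurable_mx A -> measurable_mx B -> measurable_mx (fun x => A x - B x).
Proof.
move=> mA mB i j; under eq_fun do rewrite !mxE.
exact: measurable_funB.
Qed.

Lemma measurable_det n (A : X -> 'M[R]_n) :
  measurable_mx A -> measurable_fun setT (fun x => \det (A x)).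
Proof.
move=> mA; apply: measurable_sum => s; apply: measurable_funM => //.
by apply: measurable_prod => i _; exact: mA.
Qed.

Lemma measurable_invmx n (A : X -> 'M[R]_n) :
  measurable_mx A -> measurable_mx (fun x => invmx (A x)).
Proof.
move=> mA i j.
(* [invmx] returns a singular matrix unchanged, hence the two cases. *)
have -> : (fun x => invmx (A x) i j) = (fun x =>
    if \det (A x) == 0 then A x i j else (\det (A x))^-1 * cofactor (A x) j i).
  apply/funext => x; rewrite /invmx unitmxE unitfE.
  by case: eqP => //= _; rewrite !mxE.
apply: measurable_fun_ifT => //.
- by apply: measurable_fun_eqr => //; exact: measurable_det.
- apply: measurable_funM; first exact/measurable_fun_inv/measurable_det.
  apply: measurable_funM => //; apply: measurable_det => a b.
  by under eq_fun do rewrite !mxE; exact: mA.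
Qed.

Section Green.
Context {m k : nat} (C : 'M[R]_(m, k)) (th0 : 'rV[R]_m).
Variable rho : X -> 'I_m -> R.
Hypothesis mrho : forall i, measurable_fun setT (fun x => rho x i).

Lemma measurable_weights : measurable_mx (fun x => weights (rho x)).
Proof.
move=> i j; under eq_fun do rewrite !mxE.
by case: (i == j); [exact: mrho | exact: measurable_cst].
Qed.

Lemma measurable_green : measurable_mx (fun x => green C (rho x)).
Proof.
rewrite green.unlock; apply: measurable_mxM; last exact: measurable_mx_cst.
apply: measurable_mxM; first exact: measurable_mx_cst.
apply: measurable_invmx; apply: measurable_mxM; last exact: measurable_mx_cst.
by apply: measurable_mxM; [exact: measurable_mx_cst | exact: measurable_weights].
Qed.

Lemma measurable_min_flow i : measurable_fun setT (fun x => min_flow C th0 (rho x) 0 i).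
Proof.
rewrite min_flow.unlock; apply: measurable_mxB; first exact: measurable_mx_cst.
apply: measurable_mxM; last exact: measurable_green.
by apply: measurable_mxM; [exact: measurable_mx_cst | exact: measurable_weights].
Qed.

Lemma measurable_min_energy : measurable_fun setT (fun x => min_energy C th0 (rho x)).
Proof.
apply: measurable_sum => i; apply: measurable_funM; first exact: mrho.
exact/measurable_funX/measurable_min_flow.
Qed.

Lemma measurable_upd e s i : measurable_fun setT (fun x => upd (rho x) e s i).
Proof. by rewrite /upd; case: eqP => // _; exact: mrho. Qed.

End Green.
End MatrixMeasurability.

(** * Square-integrable random variables *)

Section InnerProduct.
Context {R : realType} {d : measure_display} {T : measurableType d}.
Variable P : probability T R.
Implicit Types X Y W : T -> R.
Local Notation L2 := (Lfun P 2%:E).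

Definition inner X Y : R := fine 'E_P[X * Y].

Lemma L2_mul X Y : X \in L2 -> Y \in L2 -> X * Y \in Lfun P 1%E.
Proof. exact: Lfun2_mul_Lfun1. Qed.

Lemma L2_Lfun1 X : X \in L2 -> X \in Lfun P 1%E.
Proof. by apply: Lfun_subset12; exact: fin_num_measure. Qed.

Lemma L2B X Y : X \in L2 -> Y \in L2 -> X - Y \in L2.
Proof. by move=> LX LY; rewrite rpredB ?lee1n. Qed.

Lemma L2D X Y : X \in L2 -> Y \in L2 -> X + Y \in L2.
Proof. by move=> LX LY; rewrite rpredD ?lee1n. Qed.

Lemma L2Z a X : X \in L2 -> a *: X \in L2.
Proof. by move=> LX; rewrite rpredZ ?lee1n. Qed.

Lemma L2_sum (I : Type) (s : seq I) (Q : pred I) (X : I -> T -> R) :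
  (forall i, Q i -> X i \in L2) -> \sum_(i <- s | Q i) X i \in L2.
Proof.
move=> LX; apply: (big_ind (fun Y : T -> R => Y \in L2)) => //; last exact: L2D.
by rewrite rpred0 ?lee1n.
Qed.

Lemma innerC X Y : inner X Y = inner Y X.
Proof. by rewrite /inner mulrC. Qed.

Lemma innerDl X Y W : X \in L2 -> Y \in L2 -> W \in L2 ->
  inner (X + Y) W = inner X W + inner Y W.
Proof.
move=> LX LY LW; rewrite /inner mulrDl expectationD ?L2_mul//.
by rewrite fineD// expectation_fin_num// L2_mul.
Qed.

Lemma innerZl a X Y : X \in L2 -> Y \in L2 -> inner (a *: X) Y = a * inner X Y.
Proof.
move=> LX LY; rewrite /inner.
have -> : (a *: X) * Y = a \o* (X * Y).
  by apply/funext => w; rewrite -[LHS]/(a * X w * Y w) -[RHS]/(X w * Y w * a); ring.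
by rewrite expectationZl ?L2_mul// fineM// expectation_fin_num// L2_mul.
Qed.

Lemma innerNl X Y : X \in L2 -> Y \in L2 -> inner (- X) Y = - inner X Y.
Proof. by move=> LX LY; rewrite -scaleN1r innerZl// mulN1r. Qed.

Lemma innerBl X Y W : X \in L2 -> Y \in L2 -> W \in L2 ->
  inner (X - Y) W = inner X W - inner Y W.
Proof. by move=> LX LY LW; rewrite innerDl ?rpredN// innerNl. Qed.

Lemma inner0l X : X \in L2 -> inner 0 X = 0.
Proof. by move=> LX; rewrite -[0](scale0r (X : T -> R)) innerZl// mul0r. Qed.

Lemma inner_suml (I : Type) (s : seq I) (Q : pred I) (X : I -> T -> R) W :
  (forall i, X i \in L2) -> W \in L2 ->
  inner (\sum_(i <- s | Q i) X i) W = \sum_(i <- s | Q i) inner (X i) W.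
Proof.
move=> LX LW; elim: s => [|i s IH]; first by rewrite !big_nil inner0l.
rewrite !big_cons; case: (Q i) => //.
rewrite innerDl// ?IH//.
exact: L2_sum.
Qed.

Lemma inner_ge0 X : 0 <= inner X X.
Proof. by rewrite fine_ge0// expectation_ge0// => w; rewrite -expr2 sqr_ge0. Qed.

Lemma innerBB X Y : X \in L2 -> Y \in L2 ->
  inner (X - Y) (X - Y) = inner X X - 2 * inner X Y + inner Y Y.
Proof.
move=> LX LY; have LB := L2B LX LY; rewrite innerBl// innerC innerBl//.
rewrite [inner Y (_ - _)]innerC innerBl// (innerC Y X); ring.
Qed.

Lemma innerE X Y : X \in L2 -> Y \in L2 ->
  (inner X Y)%:E = (\int[P]_w (X w * Y w)%:E)%E.
Proof.
move=> LX LY; rewrite /inner fineK ?expectation_fin_num ?L2_mul//.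
by rewrite unlock.
Qed.

Lemma L2_square X : measurable_fun setT X -> (\int[P]_w (X w ^+ 2)%:E < +oo)%E ->
  X \in L2.
Proof.
move=> mX X2; apply/andP; split; rewrite inE//=.
rewrite /finite_norm Lnorm.unlock/= poweR_lty//.
have -> : (fun x => (`|X x| `^ 2)%:E) = (fun x => (X x ^+ 2)%:E).
  by apply/funext => w; rewrite powR_mulrn// real_normK ?num_real.
exact: X2.
Qed.

End InnerProduct.

(** * Resampling *)

Section SymmetricDifference.
Context {m : nat}.
Implicit Types A B : {set 'I_m}.

Definition symdiff A B : {set 'I_m} := [set i | (i \in A) (+) (i \in B)]%SET.

Lemma symdiff0 A : symdiff finset.set0 A = A.
Proof. by apply/finset.setP => i; rewrite !inE. Qed.

Lemma symdiffxx A : symdiff A A = finset.set0.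
Proof. by apply/finset.setP => i; rewrite !inE addbb. Qed.

End SymmetricDifference.

Section Resampling.
Context {R : realType} {d : measure_display} {T : measurableType d}.
Variable P : probability T R.
Context {m : nat}.
Local Notation J := ('I_m + 'I_m + 'I_m)%type.
Local Notation S := (coord_space (R := R) (J := J)).
Local Notation L2 := (Lfun P 2%:E).
Variables (r r' : 'I_m -> T -> R) (b : 'I_m -> T -> bool).

(** Marks are recorded as the reals 0 and 1, so that all three families are coordinates of one space
    and one independence statement covers them. *)
Definition sources (w : T) : S := fun j =>
  match j with
  | inl (inl i) => r i w | inl (inr i) => r' i w | inr i => (b i w)%:R
  end.

Definition resample (A : {set 'I_m}) (z : S) (i : 'I_m) : R :=
  z (inl (if i \in A then inr i else inl i)).

Definition swap (A : {set 'I_m}) (j : J) : J :=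
  match j with
  | inl (inl i) => inl (if i \in A then inr i else inl i)
  | inl (inr i) => inl (if i \in A then inl i else inr i)
  | inr i => inr i
  end.

Lemma swapK A : involutive (swap A).
Proof. by move=> [[i|i]|i] //=; case: ifP => h /=; rewrite h. Qed.

Lemma resample_swap A B (z : S) :
  resample B (fun j => z (swap A j)) = resample (symdiff A B) z.
Proof.
apply/funext => i; rewrite /resample /swap /symdiff inE.
by case: (i \in B) => /=; case: (i \in A).
Qed.

Hypotheses (mr : forall i, measurable_fun setT (r i))
  (mr' : forall i, measurable_fun setT (r' i))
  (mb : forall i, measurable_fun setT (b i))
  (ind : independent_coords P sources)
  (same_law : forall i B, measurable B ->
    P [set w | B (r' i w)] = P [set w | B (r i w)]).

Lemma measurable_sources j : measurable_fun setT (fun w => sources w j).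
Proof.
move: j => [[i|i]|i] //=.
exact: (measurableT_comp (f := fun c : bool => c%:R : R)).
Qed.

Lemma measurable_sources_fun : measurable_fun setT sources.
Proof. exact: measurable_coordP measurable_sources. Qed.

Local Open Scope ereal_scope.

Lemma integral_swap A (phi : S -> \bar R) : measurable_fun setT phi ->
  (forall z, 0 <= phi z) ->
  \int[P]_w phi (fun j => sources w (swap A j)) = \int[P]_w phi (sources w).
Proof.
move=> mphi phi0.
apply: (law_perm measurable_sources ind (@swapK A)) => //.
by move=> [[i|i]|i] B mB //=; case: ifP => _ //=; rewrite same_law.
Qed.

Variable g : ('I_m -> R) -> R.
Hypotheses (g_ge0 : forall x, (0 <= g x)%R)
  (mg : forall A, measurable_fun setT (fun z : S => g (resample A z))).

Definition resampled A (w : T) : R := g (resample A (sources w)).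

Hypothesis g_L2 : \int[P]_w (resampled finset.set0 w ^+ 2)%:E < +oo.

Lemma integral_resampledM A B :
  \int[P]_w (resampled A w * resampled B w)%:E =
  \int[P]_w (resampled finset.set0 w * resampled (symdiff A B) w)%:E.
Proof.
pose phi (z : S) := (g (resample A z) * g (resample B z))%:E.
have mphi : measurable_fun setT phi.
  by apply/measurable_EFinP; apply: measurable_funM; exact: mg.
rewrite -[LHS]/(\int[P]_w phi (sources w)) -(integral_swap A mphi); last first.
  by move=> z; rewrite lee_fin mulr_ge0.
apply: eq_integral => w _; rewrite /phi !resample_swap symdiffxx.
by [].
Qed.

Lemma resampled_L2 A : resampled A \in L2.
Proof.
apply: L2_square; first exact: (measurableT_comp (mg A) measurable_sources_fun).
by under eq_integral do rewrite expr2; rewrite integral_resampledM symdiffxx.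
Qed.

Local Open Scope ring_scope.

(* Exchanging [r] and [r'] on [A] preserves the law of the sources, hence
   [E (f^A f^B)] only depends on the symmetric difference of [A] and [B] and
   every inner product below is a combination of values of [gamma]. *)
Definition gamma A : R := inner P (resampled finset.set0) (resampled A).

Lemma inner_resampled A B :
  inner P (resampled A) (resampled B) = gamma (symdiff A B).
Proof.
by apply: EFin_inj; rewrite /gamma !innerE ?resampled_L2//; exact: integral_resampledM.
Qed.

Local Notation f := resampled.
Local Notation g0 := (gamma finset.set0).
Local Notation s1 i := (finset.set1 i).

Lemma inner_diff A B : inner P (f A - f B) (f A - f B) = 2 * (g0 - gamma (symdiff A B)).
Proof.
rewrite innerBB ?resampled_L2// !inner_resampled !symdiffxx; ring.
Qed.

Definition influence i : R := inner P (f finset.set0 - f (s1 i)) (f finset.set0 - f (s1 i)).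

Lemma influenceE i : influence i = 2 * (g0 - gamma (s1 i)).
Proof. by rewrite /influence inner_diff symdiff0. Qed.

Definition second_difference i j : T -> R :=
  (f finset.set0 - f (s1 i)) - (f (s1 j) - f (i |: s1 j)%SET).

Lemma inner_second_difference i j : i != j ->
  inner P (second_difference i j) (second_difference i j) =
  4 * (g0 - gamma (s1 i) - gamma (s1 j) + gamma (i |: s1 j)%SET).
Proof.
move=> ij; have LB A B : f A - f B \in L2 by rewrite L2B ?resampled_L2.
rewrite innerBB// !inner_diff.
rewrite innerBl ?resampled_L2//.
rewrite ![inner P (f _) (_ - _)]innerC !innerBl ?resampled_L2// !inner_resampled.
have e1 : symdiff (s1 j) (i |: s1 j)%SET = s1 i.
  apply/finset.setP => l; rewrite !inE.
  by have [->|] := eqVneq l j; rewrite ?orbT ?(negbTE ij)//= ?orbF// eq_sym (negbTE ij).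
have e2 : symdiff (i |: s1 j)%SET (s1 i) = s1 j.
  apply/finset.setP => l; rewrite !inE.
  by have [->|] := eqVneq l i; rewrite ?(negbTE ij)//= addbF.
have e3 : symdiff (s1 j) (s1 i) = (i |: s1 j)%SET.
  apply/finset.setP => l; rewrite !inE.
  by have [->|] := eqVneq l i; rewrite ?(negbTE ij)//= addbF.
have e4 A : symdiff A finset.set0 = A.
  by apply/finset.setP => l; rewrite !inE addbF.
by rewrite e1 e2 e3 !symdiff0 !e4; ring.
Qed.

(** Adding one index i to B lowers [gamma] by at most g0 - gamma {i}: the squared norm of (f - f^i)
    - (f^B - f^(B+i)) is 4 times the gap between the two sides. *)
Lemma gamma_subadditive (A : {set 'I_m}) :
  g0 - gamma A <= \sum_(i in A) (g0 - gamma (s1 i)).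
Proof.
have step i (B : {set 'I_m}) : i \notin B -> gamma B - gamma (i |: B)%SET <= g0 - gamma (s1 i).
  move=> iB.
  have LB A' B' : f A' - f B' \in L2 by rewrite L2B ?resampled_L2.
  have := inner_ge0 P ((f finset.set0 - f (s1 i)) - (f B - f (i |: B)%SET)).
  rewrite innerBB// !inner_diff.
  rewrite innerBl ?resampled_L2//.
  rewrite ![inner P (f _) (_ - _)]innerC !innerBl ?resampled_L2// !inner_resampled.
  have e1 : symdiff B (i |: B)%SET = s1 i.
    apply/finset.setP => l; rewrite !inE.
    by have [->|] := eqVneq l i; rewrite ?(negbTE iB)//= addbb.
  have e2 : symdiff (i |: B)%SET (s1 i) = B.
    apply/finset.setP => l; rewrite !inE.
    by have [->|] := eqVneq l i; rewrite ?(negbTE iB)//= addbF.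
  have e3 : symdiff B (s1 i) = (i |: B)%SET.
    apply/finset.setP => l; rewrite !inE.
    by have [->|] := eqVneq l i; rewrite ?(negbTE iB)//= addbF.
  have e4 A' : symdiff A' finset.set0 = A'.
    by apply/finset.setP => l; rewrite !inE addbF.
  by rewrite e1 e2 e3 !symdiff0 !e4; lra.
elim: {A}#|A| {-2}A (erefl #|A|) => [A /finset.cards0_eq ->|n IH A An].
  by rewrite big_set0 subrr.
have /finset.set0Pn[i iA] : A != finset.set0 by rewrite -finset.card_gt0 An.
rewrite (big_setD1 i)//= -{1}(finset.setD1K iA).
have AiN : #|(A :\ i)%SET| = n by move: An; rewrite (finset.cardsD1 i) iA => -[].
have := IH _ AiN; have := step i (A :\ i)%SET; rewrite !inE eqxx/= => /(_ isT).
lra.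
Qed.

Let mean : R := fine 'E_P[f finset.set0].

Definition deviation : R :=
  inner P (f finset.set0 - cst mean) (f finset.set0 - cst mean).

(* With [N := \sum_i (f - f^i)], one has [<f, N> = s] where [2 s] is the total
   influence, and [<N, N>] is [2 s] plus a quarter of the sum of the squared
   second differences; now apply Cauchy-Schwarz to [f - E f] and [N]. *)
Lemma influence_sum_le c : 0 <= c ->
  \sum_i \sum_(j | j != i) inner P (second_difference i j) (second_difference i j)
    <= c * \sum_i influence i ->
  \sum_i influence i <= (4 + c) * deviation.
Proof.
move=> c0 hc.
set s := \sum_i (g0 - gamma (s1 i)).
have sE : \sum_i influence i = 2 * s.
  by rewrite mulr_sumr; apply: eq_bigr => i _; rewrite influenceE.
have LB A B : f A - f B \in L2 by rewrite L2B ?resampled_L2.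
pose N : T -> R := \sum_i (f finset.set0 - f (s1 i)).
have LN : N \in L2 by exact: L2_sum.
have Lc : cst mean \in L2 by exact: Lfun_cst.
have Lm : f finset.set0 - cst mean \in L2 by rewrite L2B ?resampled_L2.
(* Each f - f^i has mean zero, as exchanging [r] and [r'] at i turns f^i into f. *)
have cN : inner P (cst mean) N = 0.
  rewrite innerC inner_suml// big1// => i _.
  rewrite innerBl ?resampled_L2//.
  have const A : inner P (f A) (cst mean) = mean * fine 'E_P[f A].
    rewrite /inner -[in LHS](_ : mean \o* f A = f A * cst mean); last by apply/funext.
    rewrite expectationZl ?L2_Lfun1 ?resampled_L2//.
    by rewrite fineM// expectation_fin_num ?L2_Lfun1 ?resampled_L2.
  rewrite !const; apply/eqP; rewrite subr_eq0; apply/eqP; congr (_ * fine _).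
  rewrite unlock.
  pose phi (z : S) := (g (resample (s1 i) z))%:E.
  have mphi : measurable_fun setT phi by apply/measurable_EFinP; exact: mg.
  rewrite -[RHS]/(\int[P]_w phi (sources w))%E -(integral_swap (s1 i) mphi); last first.
    by move=> z; rewrite lee_fin.
  by apply: eq_integral => w _; rewrite /phi resample_swap symdiffxx.
have fN : inner P (f finset.set0) N = s.
  rewrite innerC inner_suml ?resampled_L2//; apply: eq_bigr => i _.
  by rewrite innerBl ?resampled_L2// !inner_resampled symdiffxx /symdiff
    (_ : [set _ | _]%SET = s1 i)//; apply/finset.setP => l; rewrite !inE addbF.
have NN : inner P N N = 2 * s + 4^-1 *
    \sum_i \sum_(j | j != i) inner P (second_difference i j) (second_difference i j).
  rewrite inner_suml// mulr_sumr mulr_sumr -big_split/=; apply: eq_bigr => i _.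
  rewrite innerC inner_suml// (bigD1 i)//= inner_diff symdiff0; congr (_ + _).
  rewrite mulr_sumr; apply: eq_bigr => j ji.
  rewrite inner_second_difference 1?eq_sym// mulrA mulVf// mul1r.
  rewrite innerBl ?resampled_L2// ![inner P (f _) (_ - _)]innerC !innerBl ?resampled_L2//.
  rewrite !inner_resampled symdiffxx symdiff0.
  have -> : symdiff (s1 i) finset.set0 = s1 i.
    by apply/finset.setP => l; rewrite !inE addbF.
  have -> : symdiff (s1 i) (s1 j) = (i |: s1 j)%SET.
    apply/finset.setP => l; rewrite !inE.
    by have [->|] := eqVneq l i; rewrite // eq_sym (negbTE ji).
  by ring.
(* By hypothesis <N, N> <= K s, so 0 <= |K (f - E f) - N|^2 <= K^2 [deviation] - 2 K s + K s, that
   is s <= K [deviation]. *)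
pose K := 2 + c / 2.
have K0 : 0 < K by rewrite /K; lra.
have := inner_ge0 P (K *: (f finset.set0 - cst mean) - N).
have LK := L2Z K Lm.
rewrite innerBB// [inner P (K *: _) N]innerZl// innerZl// innerC innerZl//.
rewrite [inner P (f finset.set0 - cst mean) N]innerBl ?resampled_L2// cN fN subr0.
rewrite -/deviation NN sE in hc * => h.
have h2 : K * (2 * s) - K * s <= K * (K * deviation).
  have : 4^-1 * (\sum_i \sum_(j | j != i)
     inner P (second_difference i j) (second_difference i j)) <= 4^-1 * (c * (2 * s)).
    by rewrite ler_pM2l.
  by rewrite /K in h *; lra.
have : s <= K * deviation by rewrite -(ler_pM2l K0); lra.
by rewrite /K; lra.
Qed.

Definition noisy_set (w : T) : {set 'I_m} := [set i | b i w]%SET.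

Let mark_box (A : {set 'I_m}) (j : J) : set R :=
  match j with inr i => [set (i \in A)%:R] | _ => setT end.

Let measurable_mark_box A j : measurable (mark_box A j).
Proof. by case: j => [j|i] //=; exact: measurable_set1. Qed.

Let mark_boxP A w : (forall j, mark_box A j (sources w j)) <-> noisy_set w = A.
Proof.
split=> [h|<- [j|i] //=]; last by rewrite inE.
apply/finset.setP => i; rewrite inE; have /= := h (inr i).
by case: (b i w); case: (i \in A) => //= /eqP; rewrite ?oner_eq0 // eq_sym oner_eq0.
Qed.

Lemma measurable_noisy_set A : measurable [set w | noisy_set w = A].
Proof.
have := measurable_box measurable_sources (measurable_mark_box A).
by congr (measurable _); apply/seteqP; split => w /= /mark_boxP.
Qed.

Local Open Scope ereal_scope.

(** Conditioning on the set of marked indices: the event that it equals A is a box in the mark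
    coordinates, independent of the other coordinates, on which alone [V A] depends. *)
Lemma integral_noisy (V : {set 'I_m} -> S -> \bar R) :
  (forall A, measurable_fun setT (V A)) -> (forall A z, 0 <= V A z) ->
  (forall A z z', (forall j, z (inl j) = z' (inl j)) -> V A z = V A z') ->
  \int[P]_w V (noisy_set w) (sources w) =
  \sum_(A : {set 'I_m}) P [set w | noisy_set w = A] * \int[P]_w V A (sources w).
Proof.
move=> mV V0 VD.
pose U A (z : S) : \bar R := (\1_[set z : S | forall j, mark_box A j (z j)] z)%:E.
have mU A : measurable_fun setT (U A).
  apply/measurable_EFinP/measurable_indic.
  exact: (measurable_box (@measurable_coord R J) (measurable_mark_box A)).
have U0 A z : 0 <= U A z by rewrite lee_fin.
have UE A w : U A (sources w) = ((noisy_set w == A)%:R)%:E.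
  rewrite /U indicE; congr (_%:R)%:E; congr nat_of_bool.
  by apply/idP/eqP => [/set_mem/mark_boxP|/mark_boxP h]; [|exact: mem_set].
transitivity (\int[P]_w \sum_(A : {set 'I_m}) (U A (sources w) * V A (sources w))).
  apply: eq_integral => w _; rewrite (bigD1 (noisy_set w))//= UE eqxx mul1e.
  by rewrite big1 ?adde0// => A /negbTE AN; rewrite UE eq_sym AN mul0e.
rewrite ge0_integral_sum//; last 2 first.
- move=> A; apply: emeasurable_funM.
    exact: (measurableT_comp (mU A) measurable_sources_fun).
  exact: (measurableT_comp (mV A) measurable_sources_fun).
- by move=> A w _; exact: mule_ge0.
apply: eq_bigr => A _.
rewrite (independent_integralM measurable_sources ind
  (D := fun j => if j is inr _ then true else false))//; last 2 first.
- move=> z z' h; rewrite /U !indicE; congr (_%:R)%:E; congr nat_of_bool.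
  by apply/idP/idP => /set_mem/= H; apply/mem_set => -[j|i] //=;
    have := H (inr i); rewrite /= h.
- by move=> z z' h; apply: VD => j; exact: h.
congr (_ * _).
transitivity (\int[P]_w (\1_[set w | noisy_set w = A] w)%:E).
  by apply: eq_integral => w _; rewrite UE indicE; congr (_%:R)%:E; congr nat_of_bool;
    apply/eqP/idP => [?|/set_mem]; [exact: mem_set|].
by rewrite integral_indic ?setIT//; exact: measurable_noisy_set.
Qed.

Definition noisy_resampled (w : T) : R := resampled (noisy_set w) w.

Let resample_ext A (z z' : S) : (forall j, z (inl j) = z' (inl j)) ->
  resample A z = resample A z'.
Proof. by move=> h; apply/funext => i; rewrite /resample h. Qed.

Let integral_prob_cst (c : \bar R) : \int[P]_w c = c.
Proof.
rewrite -[LHS]/(\int[P]_w (cst c) w) integral_cst//.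
by rewrite -[X in _ * X]/(P setT) probability_setT mule1.
Qed.

Lemma sum_noisy_set : \sum_(A : {set 'I_m}) P [set w | noisy_set w = A] = 1.
Proof.
rewrite -[RHS](integral_prob_cst 1) (@integral_noisy (fun _ _ => 1))//.
by apply: eq_bigr => A _; rewrite integral_prob_cst mule1.
Qed.

Lemma noisy_law (h : R -> R) : measurable_fun setT h -> (forall x, (0 <= h x)%R) ->
  \int[P]_w (h (noisy_resampled w))%:E = \int[P]_w (h (resampled finset.set0 w))%:E.
Proof.
move=> mh h0; rewrite (@integral_noisy (fun A z => (h (g (resample A z)))%:E)).
- rewrite -[RHS]mul1e -sum_noisy_set ge0_sume_distrl//.
  apply: eq_bigr => A _; congr (_ * _).
  pose phi (z : S) := (h (g (resample A z)))%:E.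
  have mphi : measurable_fun setT phi by apply/measurable_EFinP; exact: measurableT_comp.
  rewrite -[LHS]/(\int[P]_w phi (sources w)) -(integral_swap A mphi); last first.
    by move=> z; rewrite lee_fin.
  by apply: eq_integral => w _; rewrite /phi resample_swap symdiffxx.
- by move=> A; apply/measurable_EFinP; exact: measurableT_comp.
- by move=> A z; rewrite lee_fin.
- by move=> A z z' zz'; rewrite (resample_ext A zz').
Qed.

(** For a marked set A the conditional expectation is 2 (g0 - gamma A), at most the sum of the
    influences over A by subadditivity; an index belongs to A with probability [eps]. *)
Lemma noisy_diff_le (eps : R) : (forall i, P [set w | b i w] = eps%:E) ->
  \int[P]_w ((resampled finset.set0 w - noisy_resampled w) ^+ 2)%:E <=
  (eps * \sum_i influence i)%:E.
Proof.
move=> Pb.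
rewrite (@integral_noisy (fun A z =>
  ((g (resample finset.set0 z) - g (resample A z)) ^+ 2)%:E)); last 3 first.
- move=> A; apply/measurable_EFinP/measurable_funX.
  by apply: measurable_funB; exact: mg.
- by move=> A z; rewrite lee_fin sqr_ge0.
- by move=> A z z' zz'; rewrite !(resample_ext _ zz').
apply: (@le_trans _ _ (\sum_(A : {set 'I_m}) P [set w | noisy_set w = A] *
   (\sum_(i in A) influence i)%:E)).
  apply: lee_sum => A _; apply: lee_wpmul2l => //.
  under eq_integral do rewrite expr2.
  rewrite -(@innerE _ _ _ P (f finset.set0 - f A)%R (f finset.set0 - f A)%R);
    try by rewrite L2B ?resampled_L2.
  rewrite lee_fin inner_diff symdiff0.
  under eq_bigr do rewrite influenceE.
  by rewrite -mulr_sumr ler_pM2l// gamma_subadditive.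
have i0 i : (0 <= influence i)%R by exact: inner_ge0.
apply: (@le_trans _ _ (\int[P]_w (\sum_(i in noisy_set w) influence i)%:E)).
  rewrite (@integral_noisy (fun A _ => (\sum_(i in A) influence i)%:E))//.
    by apply: lee_sum => A _; rewrite integral_prob_cst.
  by move=> A z; rewrite lee_fin sumr_ge0.
under eq_integral => w _.
  rewrite big_mkcond/= -sumEFin.
  under eq_bigr => i _.
    rewrite (_ : (if _ then _ else _)%:E = (influence i)%:E * (\1_[set w | b i w] w)%:E); last first.
      rewrite indicE (_ : (w \in _) = b i w); last first.
        by apply/idP/idP => [/set_mem|?]; [|exact: mem_set].
      by rewrite inE; case: (b i w); rewrite ?mule1 ?mule0.
    over.
  over.
have mbi i : measurable [set w | b i w].
  by rewrite -[X in measurable X]setTI; apply: (mb i measurableT (_ : measurable [set true])).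
rewrite ge0_integral_sum//; last 2 first.
- by move=> i; apply: emeasurable_funM => //; apply/measurable_EFinP/measurable_indic.
- by move=> i w _; rewrite mule_ge0// lee_fin.
rewrite mulr_sumr -sumEFin; apply: lee_sum => i _.
rewrite ge0_integralZl//; last 2 first.
- by apply/measurable_EFinP/measurable_indic.
- by rewrite lee_fin.
by rewrite integral_indic// setIT [X in _ * X](Pb i) muleC -EFinM.
Qed.

End Resampling.

Lemma ge0_le_integralT {R : realType} d (T : measurableType d)
    (P : {measure set T -> \bar R}) (f g : T -> \bar R) :
  measurable_fun setT f -> measurable_fun setT g ->
  (forall w, 0 <= f w)%E -> (forall w, f w <= g w)%E ->
  (\int[P]_w f w <= \int[P]_w g w)%E.
Proof.
move=> mf mg f0 fg; exact: ge0_le_integral.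
Qed.

(** * Moment bounds for a single weight *)

Section Moments.
Context {R : realType}.
Implicit Types s z L : R.

(** A degree count, 2 + 6 = 8, with Y the largest of s, s^-1, z, z^-1: this is where the eighth
    moments come from. *)
Lemma weighted_square_le s z : 0 < s -> 0 < z ->
  (s - z) ^+ 2 * poly_weight s z <= 8 * (s ^+ 8 + s ^- 8 + (z ^+ 8 + z ^- 8)).
Proof.
move=> s0 z0.
pose Y := Num.max (Num.max s s^-1) (Num.max z z^-1).
have [sY sY' zY zY'] : [/\ s <= Y, s^-1 <= Y, z <= Y & z^-1 <= Y].
  by rewrite /Y !le_max !lexx ?orbT.
have Y0 : 0 <= Y by lra.
have pw n x : 0 < x -> x <= Y -> 0 <= x ^+ n <= Y ^+ n.
  move=> x0 xY; rewrite exprn_ge0 ?(ltW x0)//=.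
  by apply: lerXn2r; rewrite ?nnegrE// ?(ltW x0).
have si0 : 0 < s^-1 by rewrite invr_gt0.
have zi0 : 0 < z^-1 by rewrite invr_gt0.
apply: (@le_trans _ _ (2 * Y ^+ 2 * (4 * Y ^+ 6))).
  apply: ler_pM; rewrite ?sqr_ge0 ?poly_weight_ge0//.
    have := pw 2 s s0 sY; have := pw 2 z z0 zY.
    by have : 0 <= s * z by [rewrite mulr_ge0// ltW]; lra.
  have := pw 6 s s0 sY; have := pw 6 z z0 zY.
  have := pw 6 _ si0 sY'; have := pw 6 _ zi0 zY'.
  by rewrite /poly_weight !exprVn; lra.
rewrite (_ : 2 * Y ^+ 2 * (4 * Y ^+ 6) = 8 * Y ^+ 8); last by ring.
rewrite ler_pM2l//.
have p8 x : 0 <= x ^+ 8 :> R by rewrite exprn_even_ge0.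
have pi8 x : 0 <= x ^- 8 :> R by rewrite invr_ge0.
have h1 := p8 s; have h2 := p8 z; have h3 := pi8 s; have h4 := pi8 z.
have : [\/ Y = s, Y = s^-1, Y = z | Y = z^-1].
  rewrite /Y; case: (leP (Num.max _ _) (Num.max z _)) => _.
    by case: (leP z) => _; [apply: Or44|apply: Or43].
  by case: (leP s) => _; [apply: Or42|apply: Or41].
by case=> ->; rewrite ?exprVn; lra.
Qed.

Definition band L : set R := [set x | L^-1 <= x <= L].

Lemma measurable_band L : measurable (band L).
Proof.
rewrite (_ : band L = `[L^-1, L]%classic); first exact: measurable_itv.
by apply/seteqP; split => x /=; rewrite in_itv.
Qed.

(** Markov's inequality in pointwise form: outside the band, s^8 + s^-8 is at least L. *)
Lemma band_le L s : 0 < s -> 1 <= L ->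
  1 <= \1_(band L) s + (s ^+ 8 + s ^- 8) / L :> R.
Proof.
move=> s0 L1; have L0 : 0 < L by lra.
have p8 : 0 <= s ^+ 8 by rewrite exprn_even_ge0.
have pi8 : 0 <= s ^- 8 by rewrite invr_ge0.
have le8 x : L < x -> L <= x ^+ 8.
  by move=> Lx; rewrite (le_trans (ltW Lx))// -[leLHS]expr1 ler_weXn2l//; lra.
have big : s \notin band L -> L <= s ^+ 8 + s ^- 8.
  move=> /negP nb; case: (ltP L s) => Ls; first by have := le8 _ Ls; lra.
  case: (ltP s L^-1) => sL.
    have : L < s^-1 by rewrite -[L]invrK ltf_pV2// posrE// invr_gt0.
    by move=> /le8; rewrite exprVn; lra.
  by exfalso; apply: nb; rewrite inE /band/= sL.
rewrite indicE; case: (boolP (s \in band L)) => [_|/big h].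
  by rewrite lerDl divr_ge0 ?addr_ge0// ltW.
by rewrite add0r ler_pdivlMr// mul1r.
Qed.

End Moments.

(** * Second differences of the energy of a finite network *)

Section FiniteNetwork.
Context {R : realType} {d : measure_display} {T : measurableType d}.
Variable P : probability T R.
Context {m k : nat}.
Variables (C : 'M[R]_(m, k)) (th0 : 'rV[R]_m).
Local Notation J := ('I_m + 'I_m + 'I_m)%type.
Local Notation S := (coord_space (R := R) (J := J)).
Local Notation L2 := (Lfun P 2%:E).
Variables (r r' : 'I_m -> T -> R) (b : 'I_m -> T -> bool).
Local Notation src := (sources r r' b).
Hypotheses (mr : forall i, measurable_fun setT (r i))
  (mr' : forall i, measurable_fun setT (r' i))
  (mb : forall i, measurable_fun setT (b i))
  (ind : independent_coords P src)
  (same_law : forall i B, measurable B ->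
    P [set w | B (r' i w)] = P [set w | B (r i w)])
  (r_gt0 : forall i w, 0 < r i w) (r'_gt0 : forall i w, 0 < r' i w).

(* The absolute value only matters off the positive orthant, where the
   quadratic form need not be nonnegative. *)
Definition network_energy (x : 'I_m -> R) : R := `|min_energy C th0 x|.

Local Notation g := network_energy.
Local Notation f := (resampled r r' b g).
Local Notation s1 i := (finset.set1 i).

Lemma network_energyE x : (forall i, 0 < x i) -> g x = min_energy C th0 x.
Proof. by move=> x0; rewrite /g ger0_norm// energy_at_ge0. Qed.

Lemma measurable_resample A i : measurable_fun setT (fun z : S => resample A z i).
Proof. exact: measurable_coord. Qed.

Lemma measurable_network_energy A :
  measurable_fun setT (fun z : S => g (resample A z)).
Proof.
apply: (measurableT_comp (@normr_measurable R setT)).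
by apply: measurable_min_energy => i; exact: measurable_resample.
Qed.

Hypothesis f_L2 : (\int[P]_w (f finset.set0 w ^+ 2)%:E < +oo)%E.

Local Notation infl := (influence P r r' b g).
Local Notation DD i j := (second_difference r r' b g i j).

Let rho (z : S) : 'I_m -> R := resample finset.set0 z.
Let c1 (i : 'I_m) (z : S) : R := z (inl (inl i)).
Let c2 (i : 'I_m) (z : S) : R := z (inl (inr i)).

Let resample1 i z : resample (s1 i) z = upd (rho z) i (c2 i z).
Proof.
apply/funext => l; rewrite /resample /upd /rho /resample !inE.
by case: eqVneq => [->|].
Qed.

Let rhoE z i : rho z i = c1 i z.
Proof. by rewrite /rho /resample inE. Qed.

Let upd_id z i : upd (rho z) i (c1 i z) = rho z.
Proof. by apply/funext => l; rewrite /upd; case: eqVneq => [->|]//; rewrite rhoE. Qed.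

Let upd_id2 z i j s : i != j ->
  upd (upd (rho z) i s) j (c1 j z) = upd (rho z) i s.
Proof.
move=> ij; apply/funext => l; rewrite /upd; case: eqVneq => [->|]//.
by rewrite eq_sym (negbTE ij) rhoE.
Qed.

Let resample2 i j z : i != j ->
  resample (i |: s1 j)%SET z = upd (upd (rho z) i (c2 i z)) j (c2 j z).
Proof.
move=> ij; apply/funext => l; rewrite /resample /upd /rho /resample !inE.
by have [->|lj] := eqVneq l j; rewrite ?orbT ?orbF//; case: eqVneq => [->|].
Qed.

Let rho_gt0 w i : 0 < rho (src w) i.
Proof. by rewrite rhoE; exact: r_gt0. Qed.

Let pos1 w i : 0 < c1 i (src w). Proof. exact: r_gt0. Qed.
Let pos2 w i : 0 < c2 i (src w). Proof. exact: r'_gt0. Qed.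

Let fE A w : f A w = min_energy C th0 (resample A (src w)).
Proof.
rewrite /resampled network_energyE// => i; rewrite /resample /sources.
by case: (i \in A); [exact: r'_gt0|exact: r_gt0].
Qed.

Let mc1 i : measurable_fun setT (c1 i). Proof. exact: measurable_coord. Qed.
Let mc2 i : measurable_fun setT (c2 i). Proof. exact: measurable_coord. Qed.
Let msrc : measurable_fun setT src.
Proof. exact: (measurable_sources_fun mr mr' mb). Qed.

Let U i (z : S) : \bar R := ((c1 i z - c2 i z) ^+ 2 * poly_weight (c1 i z) (c2 i z))%:E.
Let upd11 i j z := upd (upd (rho z) i 1) j 1.
Let Phi i j (z : S) : \bar R := (green C (upd11 i j z) i j ^+ 2 *
  (min_flow C th0 (upd11 i j z) 0 i ^+ 4 + min_flow C th0 (upd11 i j z) 0 j ^+ 4))%:E.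

Let exprn4_ge0 (x : R) : 0 <= x ^+ 4. Proof. exact: exprn_even_ge0. Qed.

Let U_ge0 i z : (0 <= U i z)%E.
Proof. by rewrite lee_fin mulr_ge0 ?sqr_ge0 ?poly_weight_ge0. Qed.

Let Phi_ge0 i j z : (0 <= Phi i j z)%E.
Proof. by rewrite lee_fin mulr_ge0 ?sqr_ge0 ?addr_ge0. Qed.

Let mV (h : S -> R) : measurable_fun setT h -> measurable_fun setT (fun z => (h z)^-1).
Proof. exact: measurable_fun_inv. Qed.

Let mU i : measurable_fun setT (U i).
Proof.
apply/measurable_EFinP; apply: measurable_funM.
  by apply: measurable_funX; exact: measurable_funB.
have mX (h : S -> R) : measurable_fun setT h -> measurable_fun setT (fun z => h z ^+ 6).
  by move=> mh; exact: measurable_funX.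
by apply: measurable_funD; [apply: measurable_funD; [apply: measurable_funD|]|];
  [exact: mX|apply: mV; exact: mX|exact: mX|apply: mV; exact: mX].
Qed.

Let mupd11 i j l : measurable_fun setT (fun z => upd11 i j z l).
Proof.
rewrite /upd11; apply: measurable_upd => l'; apply: measurable_upd => l''.
exact: measurable_resample.
Qed.

Let mPhi i j : measurable_fun setT (Phi i j).
Proof.
apply/measurable_EFinP; apply: measurable_funM.
  by apply: measurable_funX; apply: measurable_green; exact: mupd11.
by apply: measurable_funD; apply: measurable_funX; apply: measurable_min_flow; exact: mupd11.
Qed.

Let Dpair (i : 'I_m) : pred J := fun j =>
  match j with inl (inl l) | inl (inr l) => l == i | inr _ => false end.

Let U_local i z z' : (forall j, Dpair i j -> z j = z' j) -> U i z = U i z'.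
Proof. by move=> h; rewrite /U /c1 /c2 !h//= eqxx. Qed.

Let upd11_local i j z z' : (forall l, l != i -> l != j -> c1 l z = c1 l z') ->
  upd11 i j z = upd11 i j z'.
Proof.
move=> h; apply/funext => l; rewrite /upd11 /upd.
by case: eqVneq => // lj; case: eqVneq => // li; rewrite !rhoE h.
Qed.

Let Phi_away1 i j z z' : (forall l, ~~ Dpair i l -> z l = z' l) -> Phi i j z = Phi i j z'.
Proof.
move=> h; rewrite /Phi (@upd11_local i j z z')// => l li lj.
by rewrite /c1 h.
Qed.

Let Phi_away2 i j z z' : (forall l, ~~ Dpair j l -> z l = z' l) -> Phi i j z = Phi i j z'.
Proof.
move=> h; rewrite /Phi (@upd11_local i j z z')// => l li lj.
by rewrite /c1 h.
Qed.

Local Open Scope ereal_scope.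

Let u i := \int[P]_w U i (src w).
Let phi i j := \int[P]_w Phi i j (src w).

(** Independence twice: the pair at [i] against everything else, then the pair at [j]. *)
Let factor (i j : 'I_m) (V1 V2 V : S -> \bar R) : i != j ->
  measurable_fun setT V1 -> measurable_fun setT V2 -> measurable_fun setT V ->
  (forall z, 0 <= V1 z) -> (forall z, 0 <= V2 z) -> (forall z, 0 <= V z) ->
  (forall z z', (forall l, Dpair i l -> z l = z' l) -> V1 z = V1 z') ->
  (forall z z', (forall l, Dpair j l -> z l = z' l) -> V2 z = V2 z') ->
  (forall z z', (forall l, ~~ Dpair i l -> z l = z' l) -> V z = V z') ->
  (forall z z', (forall l, ~~ Dpair j l -> z l = z' l) -> V z = V z') ->
  \int[P]_w (V1 (src w) * (V2 (src w) * V (src w))) =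
  \int[P]_w V1 (src w) * (\int[P]_w V2 (src w) * \int[P]_w V (src w)).
Proof.
move=> ij m1 m2 mv p1 p2 pv l1 l2 a1 a2.
have msrcj := measurable_sources mr mr' mb.
rewrite (independent_integralM msrcj ind (D := Dpair i) (V := fun z => V2 z * V z))//.
- congr (_ * _).
  by rewrite (independent_integralM msrcj ind (D := Dpair j)).
- exact: emeasurable_funM.
- by move=> z; exact: mule_ge0.
- move=> z z' h; rewrite (a1 z z' h) (l2 z z')// => l lj; apply: h.
  by move: lj; case: l => [[l|l]|l] //= /eqP ->; rewrite eq_sym.
Qed.

Lemma second_difference_integral_le i j : i != j ->
  (inner P (DD i j) (DD i j))%:E <= 32%:E * (u i * (u j * phi i j)).
Proof.
move=> ij.
have mnet := measurable_network_energy.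
have fL2 := resampled_L2 mr mr' mb ind same_law (fun x => normr_ge0 _) mnet f_L2.
have LD : DD i j \in L2 by rewrite L2B// L2B.
rewrite innerE// /u /phi -(factor ij (mU i) (mU j) (mPhi i j) (U_ge0 i) (U_ge0 j)
  (Phi_ge0 i j) (@U_local i) (@U_local j) (@Phi_away1 i j) (@Phi_away2 i j)).
have mI : measurable_fun setT (fun w => U i (src w) * (U j (src w) * Phi i j (src w))).
  apply: emeasurable_funM; first exact: (measurableT_comp (mU i) msrc).
  apply: emeasurable_funM; first exact: (measurableT_comp (mU j) msrc).
  exact: (measurableT_comp (mPhi i j) msrc).
have I0 w : 0 <= U i (src w) * (U j (src w) * Phi i j (src w)).
  by rewrite mule_ge0// mule_ge0.
rewrite -ge0_integralZl//.
apply: ge0_le_integralT.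
- have mD : measurable_fun setT (DD i j) by have := sub_Lfun_mfun LD; rewrite inE.
  exact/measurable_EFinP/measurable_funM.
- exact: measurable_funeM.
- by move=> w; rewrite lee_fin -expr2 sqr_ge0.
move=> w; rewrite -!EFinM lee_fin -expr2.
have -> : DD i j w =
    (f finset.set0 w - f (s1 i) w - f (s1 j) w + f (i |: s1 j)%SET w)%R.
  by rewrite /second_difference -[LHS]/(f finset.set0 w - f (s1 i) w -
   (f (s1 j) w - f (i |: s1 j)%SET w))%R; ring.
rewrite !fE !resample1 resample2//.
have := second_difference_le C th0 (rho_gt0 w) ij (pos1 w i) (pos1 w j) (pos2 w i) (pos2 w j).
by rewrite !upd_id upd_id2// -!mulrA.
Qed.

Variable L : R.
Hypothesis L1 : (1 <= L)%R.

Let L0 : (0 < L)%R. Proof. exact: lt_le_trans L1. Qed.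

Let B i (z : S) : \bar R := (\1_(band L) (c1 i z))%:E.
Let th (i : 'I_m) (z : S) : R := (min_flow C th0 (rho z) 0 i)%R.
Let G i j (z : S) : R := green C (rho z) i j.
(** Analogue of [Phi] at the actual weights, cut down to the band. The two fourth powers of [Phi]
    are distributed over [A i j] and [A j i], so that summing over the second index leaves the
    fourth power at the first. *)
Let A i j (w : T) : \bar R :=
  B i (src w) * B j (src w) * (G i j (src w) ^+ 2 * th i (src w) ^+ 4)%:E.
Let a i (w : T) : \bar R := B i (src w) * (th i (src w) ^+ 4)%:E.

Let B_ge0 (i : 'I_m) (z : S) : 0 <= B i z. Proof. by rewrite lee_fin. Qed.
Let mB i : measurable_fun setT (B i).
Proof.
apply/measurable_EFinP.
exact: (measurableT_comp (measurable_indic (measurable_band L)) (mc1 i)).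
Qed.
Let mth i : measurable_fun setT (th i).
Proof. by apply: measurable_min_flow => l; exact: measurable_resample. Qed.
Let mG i j : measurable_fun setT (G i j).
Proof. by apply: measurable_green => l; exact: measurable_resample. Qed.
Let A_ge0 (i j : 'I_m) (w : T) : 0 <= A i j w.
Proof. by rewrite mule_ge0 ?mule_ge0// lee_fin mulr_ge0 ?sqr_ge0. Qed.
Let a_ge0 (i : 'I_m) (w : T) : 0 <= a i w.
Proof. by rewrite mule_ge0// lee_fin. Qed.
Let mA i j : measurable_fun setT (A i j).
Proof.
apply: emeasurable_funM.
  apply: emeasurable_funM; first exact: (measurableT_comp (mB i) msrc).
  exact: (measurableT_comp (mB j) msrc).
apply/measurable_EFinP; apply: measurable_funM; apply: measurable_funX.
  exact: (measurableT_comp (mG i j) msrc).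
exact: (measurableT_comp (mth i) msrc).
Qed.
Let ma i : measurable_fun setT (a i).
Proof.
apply: emeasurable_funM; first exact: (measurableT_comp (mB i) msrc).
by apply/measurable_EFinP/measurable_funX; exact: (measurableT_comp (mth i) msrc).
Qed.

Let B_local (i : 'I_m) (z z' : S) : (forall j, Dpair i j -> z j = z' j) -> B i z = B i z'.
Proof. by move=> h; rewrite /B /c1 h//= eqxx. Qed.

Let BP (i : 'I_m) (w : T) : B i (src w) = (\1_(band L) (c1 i (src w)))%:E. Proof. by []. Qed.

Hypothesis band_prob : forall i : 'I_m, 1 <= 2%:E * \int[P]_w B i (src w).

(** [Phi i j] is independent of the weights at i and j, so the two band indicators may be inserted
    at the cost of a factor 2 each. On the band [base_block_le] applies, and 4 * 64 = 256. *)
Lemma phi_le i j : i != j ->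
  phi i j <= (256 * L ^+ 8)%:E * (\int[P]_w A i j w + \int[P]_w A j i w).
Proof.
move=> ij.
have phi0 : 0 <= phi i j by exact: integral_ge0.
have B0 l : 0 <= \int[P]_w B l (src w) by exact: integral_ge0.
apply: (@le_trans _ _ (4%:E * (\int[P]_w B i (src w) * (\int[P]_w B j (src w) * phi i j)))).
  have -> : 4%:E * (\int[P]_w B i (src w) * (\int[P]_w B j (src w) * phi i j)) =
     (2%:E * \int[P]_w B i (src w)) * ((2%:E * \int[P]_w B j (src w)) * phi i j).
    rewrite (_ : 4%:E = 2%:E * 2%:E); last by rewrite -EFinM -natrM.
    by rewrite muleACA; congr (_ * _); rewrite muleA.
  rewrite -[leLHS]mul1e lee_pmul//.
  by rewrite -[leLHS]mul1e lee_pmul.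
rewrite /phi -(factor ij (mB i) (mB j) (mPhi i j) (B_ge0 i) (B_ge0 j)
  (Phi_ge0 i j) (@B_local i) (@B_local j) (@Phi_away1 i j) (@Phi_away2 i j)).
pose F w := B i (src w) * (B j (src w) * Phi i j (src w)).
have mF : measurable_fun setT F.
  apply: emeasurable_funM; first exact: (measurableT_comp (mB i) msrc).
  apply: emeasurable_funM; first exact: (measurableT_comp (mB j) msrc).
  exact: (measurableT_comp (mPhi i j) msrc).
have F0 w : 0 <= F w by rewrite mule_ge0// mule_ge0.
have mAA : measurable_fun setT (fun w => A i j w + A j i w) by exact: emeasurable_funD.
have AA0 w : 0 <= A i j w + A j i w by exact: adde_ge0.
have L8 : (0 <= 256 * L ^+ 8)%R by rewrite mulr_ge0// exprn_ge0// ltW.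
rewrite -[X in _ * X]/(\int[P]_w F w) -ge0_integralD// -!ge0_integralZl//.
apply: ge0_le_integralT.
- exact: measurable_funeM.
- exact: measurable_funeM.
- by move=> w; rewrite mule_ge0.
rewrite /F {mF F0 F}.
move=> w; rewrite /A !BP /Phi !indicE.
case: (boolP (c1 i (src w) \in band L)) => [/set_mem bi|_]; last first.
  by rewrite !mul0e !mule0 ?mul0e adde0 mule0.
case: (boolP (c1 j (src w) \in band L)) => [/set_mem bj|_]; last first.
  by rewrite !mul0e !mule0 ?mul0e adde0 mule0.
rewrite !mul1e -EFinD -!EFinM lee_fin.
have := base_block_le C th0 (rho_gt0 w) ij L1 bi bj.
rewrite !upd_id -/(G i j _) -/(th i _) -/(th j _).
rewrite -/(upd11 i j _) (_ : G j i (src w) = G i j (src w)); last exact: green_sym.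
by move=> h; lra.
Qed.

(** On the band 1 <= L r_j, so the sum over j of G_ij^2 is at most L times the sum of r_j G_ij^2,
    which is L G_ii by [green_row]; and G_ii <= 1 / r_i <= L. *)
Lemma sum_A_le i : \sum_(j | j != i) \int[P]_w A i j w <= (L ^+ 2)%:E * \int[P]_w a i w.
Proof.
rewrite -big_filter -ge0_integral_sum//.
under eq_integral do rewrite big_filter.
have L2_0 : (0 <= L ^+ 2)%R by rewrite sqr_ge0.
rewrite -ge0_integralZl//.
apply: ge0_le_integralT.
- under eq_fun do rewrite -big_filter; apply: emeasurable_sum => j; exact: mA.
- exact: measurable_funeM.
- by move=> w; exact: sume_ge0.
move=> w; rewrite /a /A !BP indicE.
case: (boolP (c1 i (src w) \in band L)) => [/set_mem bi|_]; last first.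
  by rewrite big1 ?mul0e ?mule0// => j _; rewrite !mul0e.
under eq_bigr => j _ do rewrite mul1e BP -EFinM.
rewrite sumEFin mul1e -EFinM lee_fin.
have hG : (\sum_j rho (src w) j * G i j (src w) ^+ 2 = G i i (src w))%R.
  exact: green_row.
have Gii : (G i i (src w) <= L)%R.
  have := @green_diag_le _ _ _ C (rho (src w)) i (rho_gt0 w) _ (pos1 w i).
  rewrite upd_id -/(G i i _) => /andP[g0 g1]; case/andP: bi => bi1 bi2.
  have : (L * (c1 i (src w) * G i i (src w)) <= L)%R by rewrite -[leRHS]mulr1 ler_pM2l.
  apply: le_trans; rewrite mulrA ler_peMl//.
    by move: g0; rewrite pmulr_rge0// pos1.
  by rewrite -(mulfV (lt0r_neq0 L0)) ler_pM2l.
apply: (@le_trans _ _ (\sum_j (L * (rho (src w) j * G i j (src w) ^+ 2)) * th i (src w) ^+ 4)%R).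
  rewrite [leRHS](bigID (fun j => j != i))/= -[leLHS]addr0 lerD//; last first.
    apply: sumr_ge0 => j _; rewrite mulr_ge0// mulr_ge0 ?(ltW L0)// mulr_ge0 ?sqr_ge0//.
    exact/ltW/rho_gt0.
  apply: ler_sum => j _; rewrite [leLHS]mulrA ler_wpM2r// [leRHS]mulrA ler_wpM2r ?sqr_ge0//.
  rewrite indicE; case: (boolP (_ \in _)) => [/set_mem/andP[bj _]|_].
    by rewrite rhoE -(mulfV (lt0r_neq0 L0)) ler_pM2l.
  by rewrite mulr_ge0 ?(ltW L0)//; exact/ltW/rho_gt0.
rewrite -mulr_suml -mulr_sumr hG ler_wpM2r// expr2 ler_pM2l//.
Qed.

Let wsq i (z : S) : \bar R :=
  ((c1 i z - c2 i z) ^+ 2 * (c1 i z ^- 6 + c1 i z ^+ 6))%:E.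
Let pos_part i (z : S) : \bar R :=
  (Num.max (c1 i z - c2 i z) 0 ^+ 2 * Num.min 1 (c1 i z ^- 4))%:E.

Variables (M kappa : R).
Hypotheses (moment_le : forall i,
    \int[P]_w (r i w ^+ 8)%:E + \int[P]_w (r i w ^- 8)%:E <= M%:E)
  (kappa_ge0 : (0 <= kappa)%R)
  (ratio_le : forall i,
    \int[P]_w ((r i w - r' i w) ^+ 2 * (r i w ^- 6 + r i w ^+ 6))%:E <=
    kappa%:E *
    \int[P]_w (Num.max (r i w - r' i w) 0 ^+ 2 * Num.min 1 (r i w ^- 4))%:E).

Let mX (h : S -> R) n : measurable_fun setT h -> measurable_fun setT (fun z => h z ^+ n)%R.
Proof. exact: measurable_funX. Qed.

Let swap1 (phi0 : R -> R -> R) i :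
  measurable_fun setT (fun z : S => phi0 (c1 i z) (c2 i z)) ->
  (forall x y, (0 <= phi0 x y)%R) ->
  \int[P]_w (phi0 (r' i w) (r i w))%:E = \int[P]_w (phi0 (r i w) (r' i w))%:E.
Proof.
move=> mphi phi00.
pose h (z : S) := (phi0 (c1 i z) (c2 i z))%:E.
have mh : measurable_fun setT h by exact/measurable_EFinP.
rewrite -[RHS]/(\int[P]_w h (src w)).
rewrite -(integral_swap mr mr' mb ind same_law (s1 i) mh); last first.
  by move=> z; rewrite lee_fin.
by apply: eq_integral => w _; rewrite /h /c1 /c2 /= !finset.inE eqxx.
Qed.

Let mwsq i : measurable_fun setT
  (fun z : S => (c1 i z - c2 i z) ^+ 2 * (c1 i z ^- 6 + c1 i z ^+ 6))%R.
Proof.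
apply: measurable_funM; first by apply: mX; exact: measurable_funB.
by apply: measurable_funD; [apply: mV; exact: mX|exact: mX].
Qed.

Let wsq_ge0 (x y : R) : (0 <= (x - y) ^+ 2 * (x ^- 6 + x ^+ 6))%R.
Proof.
by rewrite mulr_ge0 ?sqr_ge0// addr_ge0 ?invr_ge0// exprn_even_ge0.
Qed.

(** [poly_weight] is the sum of a term in r and the same term in r'. Exchanging r and r' shows that
    both contribute equally, whence the factor 2. *)
Lemma u_le_pos_part i : u i <= (2 * kappa)%:E * \int[P]_w pos_part i (src w).
Proof.
have -> : u i = \int[P]_w (wsq i (src w) + ((r' i w - r i w) ^+ 2 *
    (r' i w ^- 6 + r' i w ^+ 6))%:E).
  apply: eq_integral => w _; rewrite /U /wsq -EFinD; congr (_%:E).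
  by rewrite /poly_weight /c1 /c2 /=; ring.
have mw : measurable_fun setT (fun w => wsq i (src w)).
  by apply: (measurableT_comp _ msrc); exact/measurable_EFinP.
rewrite ge0_integralD//; last 3 first.
- by move=> w _; rewrite lee_fin.
- by move=> w _; rewrite lee_fin.
- apply: (measurableT_comp (f := fun z : S => ((c2 i z - c1 i z) ^+ 2 *
    (c2 i z ^- 6 + c2 i z ^+ 6))%:E) _ msrc).
  apply/measurable_EFinP; apply: measurable_funM; first by apply: mX; exact: measurable_funB.
  by apply: measurable_funD; [apply: mV; exact: mX|exact: mX].
rewrite [X in _ + X](@swap1 (fun x y => ((x - y) ^+ 2 * (x ^- 6 + x ^+ 6))%R))//.
rewrite -[X in X + _]/(\int[P]_w ((r i w - r' i w) ^+ 2 * (r i w ^- 6 + r i w ^+ 6))%:E).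
by rewrite mulrDl !mul1r EFinD ge0_muleDl ?lee_fin// leeD.
Qed.

Lemma u_le_moment i : u i <= (16 * M)%:E.
Proof.
have m8 : measurable_fun setT (fun z : S => c1 i z ^+ 8)%R by exact: mX.
have m8' : measurable_fun setT (fun z : S => c1 i z ^- 8)%R by apply: mV; exact: mX.
have n8 : measurable_fun setT (fun z : S => c2 i z ^+ 8)%R by exact: mX.
have n8' : measurable_fun setT (fun z : S => c2 i z ^- 8)%R by apply: mV; exact: mX.
have src_m (h : S -> R) : measurable_fun setT h ->
    measurable_fun setT (fun w => (h (src w))%:E).
  by move=> mh; apply/measurable_EFinP; exact: (measurableT_comp mh msrc).
have p8 (x : R) : (0 <= x ^+ 8)%R by rewrite exprn_even_ge0.
have pi8 (x : R) : (0 <= x ^- 8)%R by rewrite invr_ge0.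
apply: (@le_trans _ _ (\int[P]_w (8%:E * ((r i w ^+ 8)%:E + (r i w ^- 8)%:E +
   ((r' i w ^+ 8)%:E + (r' i w ^- 8)%:E))))).
  apply: ge0_le_integralT.
  - exact: (measurableT_comp (mU i) msrc).
  - apply: measurable_funeM.
    apply: emeasurable_funD; apply: emeasurable_funD.
    + exact: (src_m _ m8).
    + exact: (src_m _ m8').
    + exact: (src_m _ n8).
    + exact: (src_m _ n8').
  - by [].
  - move=> w; rewrite -!EFinD -EFinM lee_fin.
    exact: weighted_square_le (pos1 w i) (pos2 w i).
rewrite ge0_integralZl//; last 2 first.
- apply: emeasurable_funD; apply: emeasurable_funD.
  + exact: (src_m _ m8).
  + exact: (src_m _ m8').
  + exact: (src_m _ n8).
  + exact: (src_m _ n8').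
- by move=> w _; rewrite -!EFinD lee_fin !addr_ge0.
rewrite ge0_integralD//; last 4 first.
- by move=> w _; rewrite -EFinD lee_fin addr_ge0.
- by apply: emeasurable_funD; [exact: (src_m _ m8)|exact: (src_m _ m8')].
- by move=> w _; rewrite -EFinD lee_fin addr_ge0.
- by apply: emeasurable_funD; [exact: (src_m _ n8)|exact: (src_m _ n8')].
rewrite ge0_integralD//; last 4 first.
- by move=> w _; rewrite lee_fin.
- exact: (src_m _ m8).
- by move=> w _; rewrite lee_fin.
- exact: (src_m _ m8').
rewrite [X in _ + X]ge0_integralD//; last 4 first.
- by move=> w _; rewrite lee_fin.
- exact: (src_m _ n8).
- by move=> w _; rewrite lee_fin.
- exact: (src_m _ n8').
rewrite (@swap1 (fun x _ => x ^+ 8)%R)// (@swap1 (fun x _ => x ^- 8)%R)//.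
rewrite (_ : 16 * M = 8 * (M + M))%R; last by ring.
by rewrite EFinM lee_pmul2l// EFinD leeD.
Qed.

Let upd1_local i z z' : (forall l, l != i -> c1 l z = c1 l z') ->
  upd (rho z) i (1 : R) = upd (rho z') i 1%R.
Proof.
by move=> h; apply/funext => l; rewrite /upd; case: eqVneq => // li; rewrite !rhoE h.
Qed.

(** [u i] is bounded by an expectation in the pair at i, and the flow term by one with the weight at
    i reset to 1. By independence their product is the expectation of a product, which
    [min_energy_diff_ge] bounds by the squared energy difference. *)
Lemma u_mul_a_le i :
  u i * \int[P]_w a i w <= (2 * kappa * L ^+ 4)%:E * (infl i)%:E.
Proof.
pose t (z : S) := (min_flow C th0 (upd (rho z) i 1) 0 i ^+ 4)%R.
have mt : measurable_fun setT t.
  apply: mX; apply: measurable_min_flow => l; apply: measurable_upd => l'.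
  exact: measurable_resample.
have mtE : measurable_fun setT (fun w => (t (src w))%:E).
  by apply/measurable_EFinP; exact: (measurableT_comp mt msrc).
have L4 : (0 <= L ^+ 4)%R by rewrite exprn_ge0// ltW.
have t0 z : 0 <= (t z)%:E by rewrite lee_fin exprn4_ge0.
have a_le : \int[P]_w a i w <= (L ^+ 4)%:E * \int[P]_w (t (src w))%:E.
  rewrite -ge0_integralZl//.
  apply: ge0_le_integralT => //.
    exact: measurable_funeM.
  move=> w; rewrite /a BP indicE.
  case: (boolP (_ \in _)) => [/set_mem/andP[bi _]|_]; last first.
    by rewrite mul0e -EFinM lee_fin mulr_ge0 ?exprn4_ge0.
  rewrite mul1e -EFinM lee_fin.
  by have := min_flow_base_ge C th0 i (rho_gt0 w) L1 bi; rewrite upd_id.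
have mpp : measurable_fun setT (pos_part i).
  apply/measurable_EFinP; apply: measurable_funM.
    apply: mX; apply: measurable_maxr => //; exact: measurable_funB.
  by apply: measurable_minr => //; apply: mV; exact: mX.
have pp0 z : 0 <= pos_part i z.
  by rewrite lee_fin mulr_ge0 ?sqr_ge0// le_min ler01 invr_ge0 exprn_even_ge0.
have IP0 : 0 <= \int[P]_w pos_part i (src w) by exact: integral_ge0.
have It0 : 0 <= \int[P]_w (t (src w))%:E by exact: integral_ge0.
have u0 : 0 <= u i by exact: integral_ge0.
have Ia0 : 0 <= \int[P]_w a i w by exact: integral_ge0.
apply: (@le_trans _ _ (((2 * kappa)%:E * \int[P]_w pos_part i (src w)) *
    ((L ^+ 4)%:E * \int[P]_w (t (src w))%:E))).
  by apply: lee_pmul => //; exact: u_le_pos_part.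
rewrite muleACA -EFinM; apply: lee_wpmul2l; first by rewrite lee_fin mulr_ge0// mulr_ge0.
have msrcj := measurable_sources mr mr' mb.
rewrite -(independent_integralM msrcj ind (D := Dpair i)
  (U := pos_part i) (V := fun z => (t z)%:E))//; last 3 first.
- exact/measurable_EFinP.
- by move=> z z' h; rewrite /pos_part /c1 /c2 !h//= eqxx.
- move=> z z' h; rewrite /t (@upd1_local i z z')// => l li.
  by rewrite /c1 h.
have mnet := measurable_network_energy.
have fL2 := resampled_L2 mr mr' mb ind same_law (fun x => normr_ge0 _) mnet f_L2.
have LD : (f finset.set0 - f (s1 i))%R \in L2 by rewrite L2B.
have mD : measurable_fun setT (f finset.set0 - f (s1 i))%R.
  by have := sub_Lfun_mfun LD; rewrite inE.
rewrite /influence innerE//.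
apply: ge0_le_integralT.
- apply: emeasurable_funM => //.
  exact: (measurableT_comp mpp msrc).
- exact/measurable_EFinP/measurable_funM.
- by move=> w; exact: mule_ge0.
move=> w; rewrite -EFinM lee_fin -expr2.
rewrite -[X in (_ <= X ^+ 2)%R]/(f finset.set0 w - f (s1 i) w)%R.
rewrite !fE !resample1.
have := min_energy_diff_ge C th0 i (rho_gt0 w) (pos1 w i) (pos2 w i).
by rewrite upd_id.
Qed.

(** Of the factors [u i] and [u j], one is bounded by the moments; the other is kept, since together
    with the fourth power of the flow it makes up the influence. *)
Lemma second_difference_sum_le :
  (\sum_i \sum_(j | j != i) inner P (DD i j) (DD i j) <=
  (2 ^+ 19 * M * kappa * L ^+ 14) * \sum_i infl i)%R.
Proof.
(* An index is needed below to read off 0 <= M from the moment bound. *)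
case: (posnP m) => [m0|m_gt0].
  by rewrite !big1 ?mulr0// => i _; have := leq_ltn_trans (leq0n i) (ltn_ord i); rewrite {1}m0.
rewrite -lee_fin EFinM -!sumEFin.
under eq_bigr do rewrite -sumEFin.
have u0 i : 0 <= u i by exact: integral_ge0.
have A0 i j : 0 <= \int[P]_w A i j w by exact: integral_ge0.
have a0 i : 0 <= \int[P]_w a i w by exact: integral_ge0.
have M0 : (0 <= M)%R.
  rewrite -lee_fin (le_trans _ (moment_le (Ordinal m_gt0)))//.
  by apply: adde_ge0; apply: integral_ge0 => w _; rewrite lee_fin ?invr_ge0 exprn_even_ge0.
have L8 : (0 <= 256 * L ^+ 8)%R by rewrite mulr_ge0// exprn_ge0// ltW.
pose X i j := u i * (u j * \int[P]_w A i j w).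
have X0 i j : 0 <= X i j by rewrite mule_ge0// mule_ge0.
have row i : \sum_(j | j != i) X i j <= (16 * M * L ^+ 2 * (2 * kappa * L ^+ 4))%:E * (infl i)%:E.
  apply: (@le_trans _ _ (u i * ((16 * M)%:E * ((L ^+ 2)%:E * \int[P]_w a i w)))).
    rewrite -ge0_sume_distrr; last by move=> j _; rewrite mule_ge0.
    apply: lee_wpmul2l => //.
    apply: (@le_trans _ _ (\sum_(j | j != i) ((16 * M)%:E * \int[P]_w A i j w))).
      by apply: lee_sum => j _; apply: lee_wpmul2r => //; exact: u_le_moment.
    rewrite -ge0_sume_distrr; last by [].
    by apply: lee_wpmul2l; [rewrite lee_fin mulr_ge0|exact: sum_A_le].
  rewrite [leLHS]muleCA [X in _ * X <= _]muleCA [leLHS]muleA -EFinM.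
  rewrite [in leRHS]EFinM -[leRHS]muleA.
  by apply: lee_wpmul2l; [rewrite lee_fin mulr_ge0 ?sqr_ge0// mulr_ge0|exact: u_mul_a_le].
apply: (@le_trans _ _ (\sum_i \sum_(j | j != i)
    (32 * (256 * L ^+ 8))%:E * (X i j + X j i))).
  apply: lee_sum => i _; apply: lee_sum => j ji.
  have ij : i != j by rewrite eq_sym.
  apply: (le_trans (second_difference_integral_le ij)).
  rewrite EFinM -muleA; apply: lee_wpmul2l => //.
  apply: (@le_trans _ _ (u i * (u j * ((256 * L ^+ 8)%:E *
      (\int[P]_w A i j w + \int[P]_w A j i w))))).
    apply: lee_wpmul2l => //; apply: lee_wpmul2l => //; exact: phi_le.
  rewrite [X in u i * X]muleCA [leLHS]muleCA; apply: lee_wpmul2l => //.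
  by rewrite ge0_muleDr// ge0_muleDr ?mule_ge0// /X leeD// muleCA.
rewrite (eq_bigr (fun i => (32 * (256 * L ^+ 8))%:E *
    \sum_(j | j != i) (X i j + X j i))); last first.
  by move=> i _; rewrite ge0_sume_distrr// => j _; exact: adde_ge0.
have XX i : 0 <= \sum_(j | j != i) (X i j + X j i).
  by apply: sume_ge0 => j _; exact: adde_ge0.
rewrite -ge0_sume_distrr; last by [].
have -> : \sum_i \sum_(j | j != i) (X i j + X j i) =
    2%:E * \sum_i \sum_(j | j != i) X i j.
  under eq_bigr do rewrite big_split/=.
  rewrite big_split/= [X in _ + X](_ : _ = \sum_i \sum_(j | j != i) X i j).
    by rewrite (_ : 2%R = 1 + 1)%R// EFinD ge0_muleDl// mul1e.
  rewrite (exchange_big_dep xpredT)//=; apply: eq_bigr => i _.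
  by apply: eq_bigl => j; rewrite eq_sym.
(* 32 comes from the second difference, 256 L^8 from the return to the actual weights, 2 from
   exchanging the indices, and the rest from the bound on a row. *)
have e : (2 ^+ 19 * M * kappa * L ^+ 14 = 32 * (256 * L ^+ 8) * (2 *
    (16 * M * L ^+ 2 * (2 * kappa * L ^+ 4))))%R by ring.
rewrite e [in leRHS]EFinM -[leRHS]muleA; apply: lee_wpmul2l; first by rewrite lee_fin mulr_ge0.
rewrite [in leRHS]EFinM -[leRHS]muleA; apply: lee_wpmul2l => //.
rewrite ge0_sume_distrr; last by move=> i _; rewrite lee_fin inner_ge0.
by apply: lee_sum => i _; exact: row.
Qed.

End FiniteNetwork.

(** * Noise stability of finite networks *)

Lemma deviation_variance {R : realType} d (T : measurableType d)
    (P : probability T R) m r r' b (g : ('I_m -> R) -> R) :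
  deviation P r r' b g = fine 'V_P[resampled r r' b g finset.set0].
Proof.
by rewrite /variance covariance.unlock.
Qed.

(* The constant of [influence_sum_le] when [c] is the constant of
   [second_difference_sum_le] with [L = 1 + 2 M]; by Markov's inequality this [L]
   gives the interval [1/L, L] probability at least one half. *)
Definition stability_constant {R : realType} (M kappa : R) : R :=
  4 + 2 ^+ 19 * M * kappa * (1 + 2 * M) ^+ 14.

Section FiniteStability.
Context {R : realType} {d : measure_display} {T : measurableType d}.
Variable P : probability T R.
Context {m k : nat}.
Variables (C : 'M[R]_(m, k)) (th0 : 'rV[R]_m).
Variables (r r' : 'I_m -> T -> R) (b : 'I_m -> T -> bool).
Hypotheses (mr : forall i, measurable_fun setT (r i))
  (mr' : forall i, measurable_fun setT (r' i))
  (mb : forall i, measurable_fun setT (b i))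
  (ind : independent_coords P (sources r r' b))
  (same_law : forall i B, measurable B ->
    P [set w | B (r' i w)] = P [set w | B (r i w)])
  (r_gt0 : forall i w, 0 < r i w) (r'_gt0 : forall i w, 0 < r' i w).

Definition energy_of (s : 'I_m -> T -> R) (w : T) : R :=
  min_energy C th0 (fun i => s i w).

Definition noisy_of (i : 'I_m) (w : T) : R := if b i w then r' i w else r i w.

Local Notation g := (network_energy C th0).
Local Notation f := (resampled r r' b g).

Lemma resampled0E : f finset.set0 = energy_of r.
Proof.
apply/funext => w; rewrite /resampled network_energyE => [|i].
  by congr min_energy; apply/funext => i; rewrite /resample finset.in_set0.
by rewrite /resample finset.in_set0; exact: r_gt0.
Qed.

Lemma noisy_resampledE : noisy_resampled r r' b g = energy_of noisy_of.
Proof.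
have e w i : resample (noisy_set b w) (sources r r' b w) i = noisy_of i w.
  by rewrite /resample /noisy_of finset.in_set; case: (b i w).
apply/funext => w; rewrite /noisy_resampled /resampled network_energyE => [|i].
  by congr min_energy; apply/funext => i; rewrite e.
by rewrite e /noisy_of; case: (b i w); [exact: r'_gt0|exact: r_gt0].
Qed.

Let gpos x : 0 <= g x. Proof. exact: normr_ge0. Qed.

Lemma energy_noisy_law (h : R -> R) : measurable_fun setT h ->
  (forall x, (0 <= h x)%R) ->
  (\int[P]_w (h (energy_of noisy_of w))%:E = \int[P]_w (h (energy_of r w))%:E)%E.
Proof.
move=> mh h0; rewrite -noisy_resampledE -resampled0E.
exact: (noisy_law mr mr' mb ind same_law (measurable_network_energy C th0)).
Qed.

Hypothesis r_L2 : (\int[P]_w (energy_of r w ^+ 2)%:E < +oo)%E.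

(** The weight r^-6 + r^6 is positive, so a zero integral forces r i = r' i almost surely, and every
    influence vanishes. *)
Lemma degenerate_noise_stability (eps : R) :
  (forall i, P [set w | b i w] = eps%:E) ->
  (forall i, \int[P]_w ((r i w - r' i w) ^+ 2 * (r i w ^- 6 + r i w ^+ 6))%:E = 0)%E ->
  (\int[P]_w ((energy_of r w - energy_of noisy_of w) ^+ 2)%:E <= 0)%E.
Proof.
move=> Pb num0.
have f_L2 : (\int[P]_w (f finset.set0 w ^+ 2)%:E < +oo)%E by rewrite resampled0E.
have mnet := measurable_network_energy C th0.
rewrite -noisy_resampledE -resampled0E.
apply: (le_trans (noisy_diff_le mr mr' mb ind same_law gpos mnet f_L2 Pb)).
rewrite big1 ?mulr0// => i _.
have fL2 := resampled_L2 mr mr' mb ind same_law gpos mnet f_L2.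
have LD : f finset.set0 - f (finset.set1 i) \in Lfun P 2%:E by rewrite L2B.
have mD : measurable_fun setT (f finset.set0 - f (finset.set1 i)).
  by have := sub_Lfun_mfun LD; rewrite inE.
apply/eqP; rewrite eq_le inner_ge0 andbT -lee_fin innerE//.
have mnum : measurable_fun setT
    (fun w => ((r i w - r' i w) ^+ 2 * (r i w ^- 6 + r i w ^+ 6))%:E).
  apply/measurable_EFinP; apply: measurable_funM.
    by apply: measurable_funX; exact: measurable_funB.
  apply: measurable_funD; last exact: measurable_funX.
  by apply: measurable_fun_inv; exact: measurable_funX.
have sum_gt0 w : 0 < r i w ^- 6 + r i w ^+ 6.
  by rewrite addr_gt0 ?invr_gt0 ?exprn_gt0.
have ae0 : {ae P, forall w, r i w = r' i w}.
  have : ae_eq P setT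
      (fun w => ((r i w - r' i w) ^+ 2 * (r i w ^- 6 + r i w ^+ 6))%:E) (cst 0%E).
    apply/ae_eq_integral_abs => //.
    rewrite -[RHS](num0 i); apply: eq_integral => w _.
    by rewrite gee0_abs// lee_fin mulr_ge0 ?sqr_ge0// ltW.
  apply: filterS => w /(_ I) /= [] /eqP.
  by rewrite mulf_eq0 (gt_eqF (sum_gt0 w)) orbF sqrf_eq0 subr_eq0 => /eqP.
rewrite -[leRHS](@integral0 _ _ _ P setT).
apply: ae_ge0_le_integral => //.
- by move=> w _; rewrite lee_fin -expr2 sqr_ge0.
- exact/measurable_EFinP/measurable_funM.
apply: filterS ae0 => w rr' _; rewrite lee_fin -expr2.
rewrite -[X in X ^+ 2 <= _]/(f finset.set0 w - f (finset.set1 i) w).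
rewrite /resampled (_ : resample (finset.set1 i) _ = resample finset.set0 (sources r r' b w)).
  by rewrite subrr expr0n.
apply/funext => l; rewrite /resample finset.in_set0 finset.in_set1.
by case: eqVneq => // ->.
Qed.

Variables (M kappa : R).
Hypotheses (moment_le : forall i,
    (\int[P]_w (r i w ^+ 8)%:E + \int[P]_w (r i w ^- 8)%:E <= M%:E)%E)
  (M_ge0 : 0 <= M) (kappa_ge0 : 0 <= kappa)
  (ratio_le : forall i,
    (\int[P]_w ((r i w - r' i w) ^+ 2 * (r i w ^- 6 + r i w ^+ 6))%:E <=
    kappa%:E *
    \int[P]_w (Num.max (r i w - r' i w) 0 ^+ 2 * Num.min 1 (r i w ^- 4))%:E)%E).

Let L : R := 1 + 2 * M.

Lemma band_prob_ge i :
  (1 <= 2%:E * \int[P]_w (\1_(band L) (r i w))%:E)%E.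
Proof.
have L1 : 1 <= L by rewrite /L lerDl mulr_ge0.
have L0 : 0 < L by rewrite (lt_le_trans ltr01).
have p8 (x : R) : 0 <= x ^+ 8 by rewrite exprn_even_ge0.
have pi8 (x : R) : 0 <= x ^- 8 by rewrite invr_ge0.
have m8 : measurable_fun setT (fun w => (r i w ^+ 8)%:E).
  by apply/measurable_EFinP; exact: measurable_funX.
have mi8 : measurable_fun setT (fun w => (r i w ^- 8)%:E).
  by apply/measurable_EFinP; apply: measurable_fun_inv; exact: measurable_funX.
have mB : measurable_fun setT (fun w => (\1_(band L) (r i w) : R)%:E).
  apply/measurable_EFinP.
  exact: (measurableT_comp (measurable_indic (measurable_band L)) (mr i)).
have h : (1 <= \int[P]_w (\1_(band L) (r i w))%:E + (L^-1 * M)%:E)%E.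
  apply: (@le_trans _ _ (\int[P]_w ((\1_(band L) (r i w))%:E +
      (L^-1)%:E * ((r i w ^+ 8)%:E + (r i w ^- 8)%:E)))%E).
    apply: (@le_trans _ _ (\int[P]_w cst 1%E w)%E).
      by rewrite integral_cst//= -[X in (_ <= _ * X)%E]/(P setT) probability_setT mul1e.
    apply: ge0_le_integralT => //.
    - by apply: emeasurable_funD => //; apply: measurable_funeM; exact: emeasurable_funD.
    - by move=> w; rewrite -[X in (_ * X)%E]EFinD -EFinM -EFinD lee_fin mulrC; exact: band_le.
  rewrite ge0_integralD//; last 2 first.
  - by move=> w _; rewrite -EFinD -EFinM lee_fin mulr_ge0 ?invr_ge0 ?(ltW L0)// addr_ge0.
  - by apply: measurable_funeM; exact: emeasurable_funD.
  rewrite ge0_integralZl//; last 3 first.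
  - exact: emeasurable_funD.
  - by move=> w _; rewrite -EFinD lee_fin addr_ge0.
  - by rewrite lee_fin invr_ge0 ltW.
  rewrite ge0_integralD//; last 2 first.
  - by move=> w _; rewrite lee_fin.
  - by move=> w _; rewrite lee_fin.
  rewrite leeD2l// EFinM; apply: lee_wpmul2l => //.
  by rewrite lee_fin invr_ge0 ltW.
have LM : L^-1 * M <= 2^-1.
  by rewrite ler_pdivrMl// /L; lra.
have fin : (\int[P]_w (\1_(band L) (r i w))%:E)%E \is a fin_num.
  rewrite ge0_fin_numE; last by apply: integral_ge0 => w _; rewrite lee_fin.
  apply: (@le_lt_trans _ _ (\int[P]_w cst 1%E w)%E); last first.
    by rewrite integral_cst//= -[X in (_ * X < _)%E]/(P setT) probability_setT mul1e ltry.
  by apply: ge0_le_integralT => // w; rewrite lee_fin// indicE; case: (_ \in _).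
move: h; rewrite -(fineK fin) -EFinD -EFinM !lee_fin; lra.
Qed.

Theorem energy_noise_stability (eps : R) : 0 <= eps ->
  (forall i, P [set w | b i w] = eps%:E) ->
  (\int[P]_w ((energy_of r w - energy_of noisy_of w) ^+ 2)%:E <=
   (eps * (stability_constant M kappa * fine 'V_P[energy_of r]))%:E)%E.
Proof.
move=> eps0 Pb.
have f_L2 : (\int[P]_w (f finset.set0 w ^+ 2)%:E < +oo)%E by rewrite resampled0E.
have mnet := measurable_network_energy C th0.
have L1 : 1 <= L by rewrite /L lerDl mulr_ge0.
have c0 : 0 <= 2 ^+ 19 * M * kappa * L ^+ 14.
  apply: mulr_ge0; last by rewrite exprn_ge0// (le_trans ler01).
  by apply: mulr_ge0 => //; apply: mulr_ge0 => //; exact: exprn_ge0.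
have S := second_difference_sum_le mr mr' mb ind same_law r_gt0 r'_gt0 f_L2 L1
  band_prob_ge moment_le kappa_ge0 ratio_le.
have I := influence_sum_le mr mr' mb ind same_law gpos mnet f_L2 c0 S.
rewrite -noisy_resampledE -resampled0E.
apply: (le_trans (noisy_diff_le mr mr' mb ind same_law gpos mnet f_L2 Pb)).
by rewrite lee_fin ler_wpM2l// -(deviation_variance P r r' b g).
Qed.

End FiniteStability.

(** * Flows on a graph *)

Section Flows.
Context {R : realType} {V : countType}.
Variables (E : rel V) (H : set (V * V)).
Hypotheses (E_symmetric : symmetric E) (E_locally_finite : locally_finite E)
  (H_half : half_edges E H).
Implicit Types (x y z : V) (e : V * V) (theta : V * V -> R).

Definition rev_edge e := (e.2, e.1).

Lemma dstarE theta x :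
  dstar E theta x = \sum_(y <- fset_set [set y | E x y]) theta (x, y).
Proof. by rewrite /dstar fsbig_finite. Qed.

Lemma mem_nbhd x y : (y \in fset_set [set y | E x y]) = E x y.
Proof. by rewrite in_fset_set//; apply/idP/idP => [/set_mem|/mem_set]. Qed.

Definition step_flow e : V * V -> R := fun q => (q == e)%:R - (q == rev_edge e)%:R.

Lemma step_flow_anti e x y : step_flow e (y, x) = - step_flow e (x, y).
Proof.
rewrite /step_flow opprB /rev_edge; case: e => a b /=; rewrite !xpair_eqE.
by rewrite [(y == a) && _]andbC [(y == b) && _]andbC.
Qed.

Lemma dstar_step e x : E e.1 e.2 ->
  dstar E (step_flow e) x = (x == e.1)%:R - (x == e.2)%:R.
Proof.
case: e => a c /= Eac; rewrite dstarE /step_flow sumrB /rev_edge/=.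
have one (i j : V) : E i j ->
    \sum_(y <- fset_set [set y | E x y]) ((x, y) == (i, j))%:R = (x == i)%:R :> R.
  move=> Eij; have [->|xi] := eqVneq x i; last first.
    by rewrite big1// => y _; rewrite xpair_eqE (negbTE xi).
  rewrite (bigD1_seq j) ?fset_uniq ?mem_nbhd//= eqxx big1 ?addr0// => y yc.
  by rewrite xpair_eqE (negbTE yc) andbF.
by rewrite one// (one c a)// E_symmetric.
Qed.

Fixpoint path_flow x (p : seq V) : V * V -> R := fun q =>
  if p is y :: p' then step_flow (x, y) q + path_flow y p' q else 0.

Lemma path_flow_anti x p a c : path_flow x p (c, a) = - path_flow x p (a, c).
Proof.
elim: p x => [|y p IH] x /=; first by rewrite oppr0.
by rewrite IH step_flow_anti [RHS]opprD.
Qed.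

Lemma dstar_path x p z : path E x p ->
  dstar E (path_flow x p) z = (z == x)%:R - (z == last x p)%:R.
Proof.
elim: p x => [|y p IH] x /=.
  by move=> _; rewrite subrr dstarE big1.
move=> /andP[Exy Ep]; rewrite dstarE big_split/= -!dstarE dstar_step//= IH//.
by rewrite addrA subrK.
Qed.

Fixpoint path_support x (p : seq V) : seq (V * V) :=
  if p is y :: p' then (x, y) :: (y, x) :: path_support y p' else [::].

Lemma path_flow_support x p q : q \notin path_support x p -> path_flow x p q = 0.
Proof.
elim: p x => [//|y p IH] x /=; rewrite !inE !negb_or => /and3P[h1 h2 h3].
by rewrite IH// /step_flow /rev_edge/= (negbTE h1) (negbTE h2) subrr addr0.
Qed.

(* The edges with an endpoint among the first [n] vertices. Imposing the
   divergence at those vertices only amounts to wiring all the others. Loops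
   carry no antisymmetric flow and are left out. *)
Definition near_edges n : set (V * V) :=
  [set e | H e /\ e.1 != e.2 /\ ((choice.pickle e.1 < n)%N \/ (choice.pickle e.2 < n)%N)].

Lemma near_edges_finite n : finite_set (near_edges n).
Proof.
have [HE _ _] := H_half.
have fin_ball : finite_set [set x : V | (choice.pickle x < n)%N].
  apply: (@sub_finite_set _ _ (choice.pickle @^-1` `I_n)).
    by move=> x.
  apply: finite_preimage; last exact: finite_II.
  by move=> x y _ _; exact: (pcan_inj choice.pickleK).
apply: (@sub_finite_set _ _
  (\bigcup_(x in [set x : V | (choice.pickle x < n)%N])
     ((fun y => (x, y)) @` [set y | E x y] `|` (fun y => (y, x)) @` [set y | E x y]))).
  move=> [x y] [/= Hxy [_ [h|h]]].
    by exists x => //; left; exists y => //; exact: HE.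
  by exists y => //; right; exists x => //; rewrite /= E_symmetric; exact: HE.
apply: bigcup_finite => // x _.
by rewrite finite_setU; split; apply: finite_image.
Qed.

Definition edge_list n : seq (V * V) := fset_set (near_edges n).

Lemma edge_list_uniq n : uniq (edge_list n).
Proof. exact: fset_uniq. Qed.

Lemma mem_edge_list n e : reflect (near_edges n e) (e \in edge_list n).
Proof.
rewrite /edge_list in_fset_set; last exact: near_edges_finite.
by apply: (iffP idP) => [/set_mem|/mem_set].
Qed.

Lemma edge_list_sub n p : (n <= p)%N -> {subset edge_list n <= edge_list p}.
Proof.
move=> np e /mem_edge_list [He [ee h]]; apply/mem_edge_list; split=> //; split=> //.
by case: h => h; [left|right]; exact: leq_trans np.
Qed.

Definition edge n (i : 'I_(size (edge_list n))) : V * V := tnth (in_tuple (edge_list n)) i.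

Arguments edge {n} i.

Lemma edge_mem n (i : 'I_(size (edge_list n))) : edge i \in edge_list n.
Proof. exact: mem_tnth. Qed.

Lemma sum_edges n (F : V * V -> R) :
  \sum_(i < size (edge_list n)) F (edge i) = \sum_(e <- edge_list n) F e.
Proof. by rewrite [RHS]big_tnth. Qed.

Definition restrict n theta : 'rV[R]_(size (edge_list n)) := \row_i theta (edge i).

Definition extend n (t : 'rV[R]_(size (edge_list n))) : V * V -> R :=
  fun q => \sum_i t 0 i * step_flow (edge i) q.

Lemma extend_anti n t x y : extend (n := n) t (y, x) = - extend t (x, y).
Proof.
by rewrite /extend -sumrN; apply: eq_bigr => i _; rewrite step_flow_anti mulrN.
Qed.

Lemma edge_E n (i : 'I_(size (edge_list n))) : E (edge i).1 (edge i).2.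
Proof.
have [HE _ _] := H_half.
by have /mem_edge_list[] := edge_mem i; case: (edge i) => a c /HE.
Qed.

Lemma dstar_extend n t x : dstar E (extend (n := n) t) x =
  \sum_i t 0 i * ((x == (edge i).1)%:R - (x == (edge i).2)%:R).
Proof.
rewrite dstarE /extend exchange_big/=; apply: eq_bigr => i _.
by rewrite -mulr_sumr -dstar_step ?edge_E// dstarE.
Qed.

Lemma rev_edge_notin n e : e \in edge_list n -> rev_edge e \notin edge_list n.
Proof.
have [_ _ H1] := H_half.
move=> /mem_edge_list [He [ee _]]; apply/negP => /mem_edge_list [He' _].
move: ee; case: e He He' => a c /= Hac Hca.
by rewrite (H1 _ _ Hac Hca) eqxx.
Qed.

Lemma extend_restrict_edge n theta e : e \in edge_list n ->
  extend (restrict n theta) e = theta e.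
Proof.
move=> eF; rewrite /extend; under eq_bigr do rewrite mxE.
rewrite (@sum_edges n (fun q => theta q * step_flow q e)).
rewrite (bigD1_seq e) ?edge_list_uniq//= /step_flow eqxx.
have eN : e != rev_edge e by apply: contraNneq (rev_edge_notin eF) => <-.
rewrite (negbTE eN) subr0 mulr1 big_seq_cond big1 ?addr0// => q /andP[qF qe].
rewrite eq_sym (negbTE qe) sub0r; case: eqVneq => [eq|]; last by rewrite oppr0 mulr0.
by move: (rev_edge_notin qF); rewrite -eq eF.
Qed.

Lemma restrict_extend n t : restrict n (extend t) = t.
Proof.
pose theta q := \sum_i t 0 i * (q == edge i :> V * V)%:R.
have tE : t = restrict n theta.
  apply/rowP => i; rewrite mxE /theta (bigD1 i)//= eqxx mulr1 big1 ?addr0// => l li.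
  rewrite (_ : (edge i == edge l) = false) ?mulr0//; apply/negbTE.
  apply: contraNneq li => /eqP; rewrite /edge !(tnth_nth (edge i)) /=.
  by rewrite nth_uniq ?edge_list_uniq// => /eqP/ord_inj ->.
apply/rowP => i; rewrite mxE {1}tE extend_restrict_edge ?edge_mem//.
by rewrite [in RHS]tE mxE.
Qed.

(** Every edge at x other than a loop is listed in one of its orientations; on a loop both sides
    vanish by antisymmetry. *)
Lemma extend_restrict n theta x y : antisymmetric_on E theta -> E x y ->
  (choice.pickle x < n)%N -> extend (restrict n theta) (x, y) = theta (x, y).
Proof.
have [_ EH _] := H_half.
move=> anti Exy xn; have [xy|xy] := eqVneq x y.
  have loop theta' : antisymmetric_on E theta' -> theta' (x, y) = 0.
    by move=> a; have := a x y Exy; rewrite xy; lra.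
  by rewrite !loop// => a c _; exact: extend_anti.
have [Hxy|Hyx] := EH x y Exy.
  by apply: extend_restrict_edge; apply/mem_edge_list; split => //; split => //=; left.
rewrite extend_anti extend_restrict_edge; last first.
  by apply/mem_edge_list; split => //; split; [rewrite /= eq_sym|right].
by rewrite -anti// E_symmetric.
Qed.

(** Columns are indexed by the codes below n; a code that belongs to no vertex gives a zero
    column. *)
Definition divergence n : 'M[R]_(size (edge_list n), n) :=
  \matrix_(i, j) ((choice.pickle (edge i).1 == j)%:R - (choice.pickle (edge i).2 == j)%:R).

Lemma divergenceE n theta x (xn : (choice.pickle x < n)%N) : antisymmetric_on E theta ->
  dstar E theta x = (restrict n theta *m divergence n) 0 (Ordinal xn).
Proof.
move=> anti.
transitivity (dstar E (extend (restrict n theta)) x).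
  rewrite !dstarE big_seq [RHS]big_seq; apply: eq_bigr => y.
  by rewrite mem_nbhd => Exy; rewrite extend_restrict.
rewrite dstar_extend mxE; apply: eq_bigr => i _; rewrite [divergence n _ _]mxE/=.
rewrite !(inj_eq (pcan_inj choice.pickleK)).
by rewrite [x == (edge i).1]eq_sym [x == (edge i).2]eq_sym.
Qed.

Lemma eq_divergence n theta theta' :
  antisymmetric_on E theta -> antisymmetric_on E theta' ->
  (forall x, (choice.pickle x < n)%N -> dstar E theta x = dstar E theta' x) ->
  restrict n theta *m divergence n = restrict n theta' *m divergence n.
Proof.
move=> a1 a2 h; apply/rowP => j.
have [[x xj]|nx] := pselect (exists x : V, choice.pickle x = j).
  have xn : (choice.pickle x < n)%N by rewrite xj ltn_ord.
  by rewrite (_ : j = Ordinal xn) -?divergenceE ?h//; exact: ord_inj.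
have none (t : 'rV[R]_(size (edge_list n))) : (t *m divergence n) 0 j = 0.
  rewrite mxE big1// => i _; rewrite mxE.
  have pj z : (choice.pickle z == j :> nat) = false by apply/eqP => zj; apply: nx; exists z.
  by rewrite !pj subrr mulr0.
by rewrite !none.
Qed.

End Flows.

(** * Wired exhaustion *)

Lemma ler_sum_subseq (R : numDomainType) (I : eqType) (s1 s2 : seq I) (F : I -> R) :
  uniq s1 -> uniq s2 -> {subset s1 <= s2} -> (forall i, i \in s2 -> 0 <= F i) ->
  \sum_(i <- s1) F i <= \sum_(i <- s2) F i.
Proof.
move=> u1 u2 s12 F0.
have ps : perm_eq s1 [seq i <- s2 | i \in s1].
  apply: uniq_perm => //; first exact: filter_uniq.
  by move=> i; rewrite mem_filter; case: (boolP (i \in s1)) => // /s12 ->.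
rewrite (perm_big _ ps)/= big_filter [leRHS](bigID (mem s1))/= lerDl.
by rewrite big_seq_cond; apply: sumr_ge0 => i /andP[/F0].
Qed.

Section Exhaustion.
Context {R : realType} {V : countType}.
Variables (E : rel V) (H : set (V * V)).
Hypotheses (E_symmetric : symmetric E) (E_locally_finite : locally_finite E)
  (H_half : half_edges E H).
Variables (u v : V) (p : seq V).
Hypotheses (path_p : path E u p) (last_p : last u p = v).
Local Notation F := (edge_list H).
Local Notation theta0 := (path_flow (R := R) u p).

Definition local_weights n (rho : V * V -> R) : 'I_(size (F n)) -> R :=
  fun i => rho (edge i).

Definition wired_energy n (rho : V * V -> R) : R :=
  min_energy (divergence H n) (restrict H n theta0) (local_weights (n := n) rho).

Definition wired_flow n (rho : V * V -> R) : V * V -> R :=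
  extend (min_flow (divergence H n) (restrict H n theta0) (local_weights (n := n) rho)).

Definition path_edges : seq (V * V) := undup [seq e <- path_support u p | `[< H e >]].

Variable rho : V * V -> R.
Hypothesis rho_gt0 : forall e, H e -> 0 < rho e.

Let w_gt0 n i : 0 < local_weights (n := n) rho i.
Proof.
apply: rho_gt0; have /(mem_edge_list E_symmetric E_locally_finite H_half)[] // := edge_mem i.
Qed.

Let rho_F n e : e \in F n -> 0 < rho e.
Proof. by move=> /(mem_edge_list E_symmetric E_locally_finite H_half)[/rho_gt0]. Qed.

Local Notation Rn n := (wired_energy n rho).
Local Notation th n := (wired_flow n rho).

Lemma theta0_anti : antisymmetric_on E theta0.
Proof. by move=> x y _; exact: path_flow_anti. Qed.

Lemma theta0_dstar x : dstar E theta0 x = (x == u)%:R - (x == v)%:R.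
Proof. by rewrite dstar_path// last_p. Qed.

Lemma wired_flow_anti n : antisymmetric_on E (th n).
Proof. by move=> x y _; exact: extend_anti. Qed.

Lemma wired_flow_dstar n x : (choice.pickle x < n)%N ->
  dstar E (th n) x = dstar E theta0 x.
Proof.
move=> xn; rewrite !(divergenceE E_symmetric E_locally_finite H_half xn);
  [|exact: theta0_anti|exact: wired_flow_anti].
by rewrite (restrict_extend E_symmetric E_locally_finite H_half) min_flowC.
Qed.

Lemma energy_restrict n theta :
  energy_at (local_weights (n := n) rho) (restrict H n theta) =
  \sum_(e <- F n) rho e * theta e ^+ 2.
Proof.
rewrite -(sum_edges H n (fun e => rho e * theta e ^+ 2)).
by apply: eq_bigr => i _; rewrite mxE.
Qed.

Lemma energy_decomposition n theta : antisymmetric_on E theta ->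
  (forall x, (choice.pickle x < n)%N -> dstar E theta x = dstar E theta0 x) ->
  \sum_(e <- F n) rho e * theta e ^+ 2 =
  Rn n + \sum_(e <- F n) rho e * (theta e - th n e) ^+ 2.
Proof.
move=> anti ds; rewrite -energy_restrict.
rewrite (energy_min_flow (C := divergence H n) (th0 := restrict H n theta0) (w_gt0 (n := n))).
  congr (_ + _); rewrite -(sum_edges H n (fun e => rho e * (theta e - th n e) ^+ 2)).
  apply: eq_bigr => i _; congr (_ * (_ - _) ^+ 2); first by rewrite mxE.
  by rewrite -[in LHS](restrict_extend E_symmetric E_locally_finite H_half (min_flow _ _ _)) mxE.
exact: (eq_divergence E_symmetric E_locally_finite H_half anti theta0_anti ds).
Qed.

Lemma wired_energyE n : Rn n = \sum_(e <- F n) rho e * th n e ^+ 2.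
Proof.
rewrite (energy_decomposition (wired_flow_anti n) (@wired_flow_dstar n)).
by rewrite big1 ?addr0// => e _; rewrite subrr expr0n mulr0.
Qed.

Lemma wired_energy_le n theta : antisymmetric_on E theta ->
  (forall x, (choice.pickle x < n)%N -> dstar E theta x = dstar E theta0 x) ->
  Rn n <= \sum_(e <- F n) rho e * theta e ^+ 2.
Proof.
move=> anti ds; rewrite (energy_decomposition anti ds) lerDl.
rewrite big_seq; apply: sumr_ge0 => e eF; rewrite mulr_ge0 ?sqr_ge0//.
exact/ltW/(rho_F eF).
Qed.

(** The optimal flow of level q is admissible at level n, so Pythagoras at level n applies to it. As
    the energies converge, this makes the flows Cauchy on each edge. *)
Lemma wired_flow_dist n q : (n <= q)%N ->
  \sum_(e <- F n) rho e * (th q e - th n e) ^+ 2 <= Rn q - Rn n.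
Proof.
move=> nq; rewrite lerBrDl -energy_decomposition.
- rewrite (wired_energyE q); apply: ler_sum_subseq.
  + exact: edge_list_uniq.
  + exact: edge_list_uniq.
  + exact: (edge_list_sub E_symmetric E_locally_finite H_half nq).
  + by move=> e eF; rewrite mulr_ge0 ?sqr_ge0// (ltW (rho_F eF)).
- exact: wired_flow_anti.
- by move=> x xn; apply: wired_flow_dstar; exact: leq_trans nq.
Qed.

Lemma wired_energy_nondecreasing : nondecreasing_seq (fun n => Rn n).
Proof.
move=> n q nq; rewrite -subr_ge0; apply: le_trans (wired_flow_dist nq).
rewrite big_seq; apply: sumr_ge0 => e eF; rewrite mulr_ge0 ?sqr_ge0//.
exact/ltW/(rho_F eF).
Qed.

Lemma wired_energy_ge0 n : 0 <= Rn n.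
Proof. by apply: energy_at_ge0; exact: w_gt0. Qed.

(** Independent of the level and linear in [rho]: for random resistances it becomes a
    square-integrable bound on all wired energies. *)
Definition path_bound : R := \sum_(e <- path_edges) rho e * theta0 e ^+ 2.

Lemma wired_energy_le_path n : Rn n <= path_bound.
Proof.
apply: (le_trans (@wired_energy_le n theta0 theta0_anti _)) => //.
rewrite (bigID (fun e => e \in path_support u p))/= [X in _ + X]big1; last first.
  by move=> e /path_flow_support ->; rewrite expr0n mulr0.
rewrite addr0 -big_filter; apply: ler_sum_subseq.
- by apply: filter_uniq; exact: edge_list_uniq.
- exact: undup_uniq.
- move=> e; rewrite mem_filter => /andP[ep eF]; rewrite mem_undup mem_filter ep andbT.
  by apply/asboolP; have /(mem_edge_list E_symmetric E_locally_finite H_half)[] := eF.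
- move=> e; rewrite mem_undup mem_filter => /andP[/asboolP He _].
  by rewrite mulr_ge0 ?sqr_ge0// ltW// rho_gt0.
Qed.

Lemma wired_energy_cvg : cvgn (fun n => Rn n).
Proof.
apply: nondecreasing_is_cvgn; first exact: wired_energy_nondecreasing.
by exists path_bound => _ [n _ <-]; exact: wired_energy_le_path.
Qed.

Let ell : R := limn (fun n => Rn n).

Let Rn_le n : Rn n <= ell.
Proof. exact: (nondecreasing_cvgn_le wired_energy_nondecreasing wired_energy_cvg). Qed.

Lemma wired_flow_support n e : e \notin F n -> rev_edge e \notin F n -> th n e = 0.
Proof.
move=> eF reF; rewrite /wired_flow /extend big1// => i _.
rewrite /step_flow; have iF := edge_mem i.
have -> : (e == edge i) = false by apply: contraNF eF => /eqP ->.
have -> : (e == rev_edge (edge i)) = false.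
  by apply: contraNF reF => /eqP ->; rewrite /rev_edge/= -surjective_pairing.
by rewrite subrr mulr0.
Qed.

Lemma wired_flow_edge_cvg N e : e \in F N -> cvgn (fun n => th n e).
Proof.
move=> eN; have re := rho_F eN.
apply: cauchy_cvg; apply: cauchy_exP => eps eps0.
have := wired_energy_cvg; move/cvgrPdist_lt => /(_ (rho e * eps ^+ 2)) [].
  by rewrite mulr_gt0// exprn_gt0.
move=> N1 _ hN1; pose n := maxn N N1.
exists (th n e); exists n => // q /= nq.
have eF : e \in F n.
  exact: (edge_list_sub E_symmetric E_locally_finite H_half (leq_maxl N N1)).
have h1 : rho e * (th q e - th n e) ^+ 2 < rho e * eps ^+ 2.
  apply: (@le_lt_trans _ _ (ell - Rn n)).
    apply: le_trans (_ : _ <= Rn q - Rn n) _; last by rewrite lerB.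
    apply: le_trans (wired_flow_dist nq).
    rewrite (bigD1_seq e) ?edge_list_uniq//= lerDl big_seq_cond.
    apply: sumr_ge0 => e' /andP[e'F _]; rewrite mulr_ge0 ?sqr_ge0//.
    exact/ltW/(rho_F e'F).
  have := hN1 n (leq_maxr N N1); rewrite /= ger0_norm// subr_ge0; exact: Rn_le.
rewrite ltr_pM2l// in h1.
rewrite /ball/= distrC -(ltr_pXn2r (n := 2)) ?nnegrE// ?(ltW eps0)//.
by rewrite real_normK ?num_real.
Qed.

Lemma wired_flow_cvg e : cvgn (fun n => th n e).
Proof.
have [[N eN]|noe] := pselect (exists N, e \in F N).
  exact: wired_flow_edge_cvg eN.
have [[N reN]|nore] := pselect (exists N, rev_edge e \in F N).
  have -> : (fun n => th n e) = - (fun n => th n (rev_edge e)).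
    by apply/funext => n; rewrite /wired_flow; case: (e) => x y; rewrite extend_anti.
  by apply: is_cvgN; exact: wired_flow_edge_cvg reN.
have -> : (fun n => th n e) = cst 0.
  apply/funext => n; apply: wired_flow_support; apply/negP => h.
    by apply: noe; exists n.
  by apply: nore; exists n.
exact: is_cvg_cst.
Qed.

Definition limit_flow (e : V * V) : R := limn (fun n => th n e).

Lemma limit_flow_anti : antisymmetric_on E limit_flow.
Proof.
move=> x y Exy; rewrite /limit_flow.
have -> : (fun n => th n (y, x)) = - (fun n => th n (x, y)).
  by apply/funext => n; rewrite wired_flow_anti.
by rewrite limN//; exact: wired_flow_cvg.
Qed.

(** By local finiteness the divergence is a finite sum and passes to the limit; at x it is constant
    once x is among the first n vertices. *)
Lemma limit_flow_dstar x : dstar E limit_flow x = (x == u)%:R - (x == v)%:R.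
Proof.
rewrite dstarE//.
have h : (fun n => dstar E (th n) x) @ \oo -->
    \sum_(y <- fset_set [set y | E x y]) limit_flow (x, y).
  under eq_fun do rewrite dstarE//.
  apply: cvg_big => [|y _]; first exact: add_continuous.
   exact: wired_flow_cvg.
rewrite -(cvg_lim _ h)//; apply: lim_near_cst => //.
exists (choice.pickle x).+1 => // n /= xn.
by rewrite wired_flow_dstar// theta0_dstar.
Qed.

(** A Fatou argument: the energy is a supremum of finite sums, and each of them is a limit of sums
    bounded by the wired energies. *)
Lemma limit_flow_energy : (energy H rho limit_flow <= ell%:E)%E.
Proof.
have [_ _ H1] := H_half.
apply: ge_ereal_sup => _ [A [finA AH] <-].
rewrite fsbig_finite//= sumEFin lee_fin.
have memA e : e \in fset_set A -> H e.
  by rewrite in_fset_set// => /set_mem; exact: AH.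
have h : (fun n => \sum_(e <- fset_set A) rho e * th n e ^+ 2) @ \oo -->
    \sum_(e <- fset_set A) rho e * limit_flow e ^+ 2.
  apply: cvg_big => [|e _]; first exact: add_continuous.
   apply: cvgM; first exact: cvg_cst.
  have c := @wired_flow_cvg e.
  exact: (cvgM c c).
rewrite -(cvg_lim _ h)//; apply: limr_le; first by apply/cvg_ex; eexists; exact: h.
apply: nearW => n; apply: le_trans (Rn_le n).
rewrite wired_energyE (bigID (fun e => e \in F n))/= [X in _ + X]big_seq_cond.
rewrite [X in _ + X]big1 => [|e /andP[eA eF]]; last first.
  rewrite wired_flow_support ?expr0n ?mulr0//.
  apply/negP => /(mem_edge_list E_symmetric E_locally_finite H_half)[Hre [ee _]].
  move: (memA _ eA) Hre ee; rewrite /rev_edge; case: (e) => x y /= Hxy Hyx.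
  by rewrite (H1 _ _ Hxy Hyx) eqxx.
rewrite addr0 -big_filter; apply: ler_sum_subseq.
- by apply: filter_uniq; exact: fset_uniq.
- exact: edge_list_uniq.
- by move=> e; rewrite mem_filter => /andP[].
- by move=> e eF; rewrite mulr_ge0 ?sqr_ge0// (ltW (rho_F eF)).
Qed.

(** The limit flow is a unit flow of energy at most the limit of the wired energies. Conversely,
    every unit flow has the prescribed divergence at the first n vertices, so its energy is at least
    each wired energy. *)
Theorem wired_energy_cvg_resistance :
  (fun n => Rn n) @ \oo --> effective_resistance E H rho u v.
Proof.
suff -> : effective_resistance E H rho u v = ell by exact: wired_energy_cvg.
rewrite /effective_resistance; set I := ereal_inf _.
suff -> : I = ell%:E by [].
apply/eqP; rewrite eq_le; apply/andP; split.
  apply: le_trans limit_flow_energy; apply: ereal_inf_lbound.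
  exists limit_flow => //; split; last exact: limit_flow_dstar.
  split; first exact: limit_flow_anti.
  by apply: (le_lt_trans limit_flow_energy); rewrite ltry.
apply: le_ereal_inf_tmp => _ [theta [[anti fin] ds] <-].
suff bound n : ((Rn n)%:E <= energy H rho theta)%E.
  move: fin bound; case: (energy H rho theta) => [x| |] //.
  - move=> _ bound; rewrite lee_fin; apply: limr_le; first exact: wired_energy_cvg.
    by apply: nearW => n; rewrite -lee_fin.
  - by move=> _ /(_ 0%N); rewrite leeNy_eq.
apply: le_trans (_ : _ <= (\sum_(e <- F n) rho e * theta e ^+ 2)%:E)%E _.
  rewrite lee_fin; apply: wired_energy_le => // x _.
  by rewrite theta0_dstar ds.
apply: ereal_sup_ubound; exists (near_edges H n).
  split; first exact: (near_edges_finite E_symmetric E_locally_finite H_half).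
  by move=> e [].
rewrite fsbig_finite ?sumEFin//.
exact: (near_edges_finite E_symmetric E_locally_finite H_half).
Qed.

End Exhaustion.

(** * The sources of randomness *)

Section SourcesIndependence.
Context {R : realType} {V : countType} (H : set (V * V)).
Context d (T : measurableType d) (P : probability T R).
Variables (r r' : V * V -> {RV P >-> measurableTypeR R}) (b : V * V -> {RV P >-> bool}).
Hypothesis indep : mutually_independent P (source_index H) (source_events r r' b).

Section FiniteFamily.
Context {m : nat} (edge : 'I_m -> V * V).
Hypotheses (edge_inj : injective edge) (edge_H : forall i, H (edge i)).
Local Notation J := ('I_m + 'I_m + 'I_m)%type.

Let index (j : J) : (V * V) + (V * V) + (V * V) :=
  match j with
  | inl (inl i) => inl (inl (edge i)) | inl (inr i) => inl (inr (edge i))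
  | inr i => inr (edge i)
  end.

Let index_inj : injective index.
Proof. by move=> [[i|i]|i] [[j|j]|j] //= [] /edge_inj ->. Qed.

Lemma finite_independent :
  independent_coords P (sources (fun i => r (edge i) : T -> R)
    (fun i => r' (edge i) : T -> R) (fun i => b (edge i) : T -> bool)).
Proof.
set Z := sources _ _ _; move=> A mA.
(* Defines an event for every tag; injectivity of [index] makes it the event of coordinate j at the
   tag of j. *)
pose B k : set T := [set w | forall j, index j = k -> A j (Z w j)].
have BE j : B (index j) = [set w | A j (Z w j)].
  by apply/seteqP; split => w /= h; [exact: h | move=> l /index_inj ->].
pose K : {fset (V * V) + (V * V) + (V * V)} := [fset k in [seq index j | j <- enum {: J}]]%fset.
have memK k : (k \in K) = (k \in [seq index j | j <- enum {: J}]) by rewrite !inE.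
have := @indep K B _ _.
have -> : \bigcap_(k in [set` K]) B k = [set w | forall j, A j (Z w j)].
  apply/seteqP; split => w /= h.
    by move=> j; have := h (index j); rewrite BE; apply => /=; rewrite memK map_f ?mem_enum.
  by move=> k _ j _; exact: h.
have -> : (\prod_(k <- K) P (B k) = \prod_j P [set w | A j (Z w j)])%E.
  transitivity (\prod_(k <- [seq index j | j <- enum {: J}]) P (B k))%E.
    apply: perm_big; apply: uniq_perm => //.
    by rewrite map_inj_uniq ?enum_uniq//; exact: index_inj.
  by rewrite big_map big_enum/=; apply: eq_bigr => j _; rewrite BE.
apply.
  by move=> k /=; rewrite memK => /mapP[[[i|i]|i] _ ->] /=.
move=> k; rewrite memK => /mapP[j _ ->]; rewrite BE.
case: j => [[i|i]|i] /=.
- by exists (A (inl (inl i))) => //; rewrite setTI.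
- by exists (A (inl (inr i))) => //; rewrite setTI.
(* The event on the real mark 0 or 1 is pulled back to the boolean mark. *)
- by exists [set c : bool | A (inr i) (c%:R)] => //; rewrite setTI.
Qed.

End FiniteFamily.

Local Open Scope ereal_scope.

Variable mu : V * V -> probability (measurableTypeR R) R.
Hypotheses (r_law : forall e A, H e -> measurable A -> distribution P (r e) A = mu e A)
  (r'_law : forall e A, H e -> measurable A -> distribution P (r' e) A = mu e A).

Lemma same_law_of e (B : set R) : H e -> measurable B ->
  P [set w | B (r' e w)] = P [set w | B (r e w)].
Proof.
by move=> He mB; have := r'_law He mB; have := r_law He mB; rewrite /distribution/=
  /pushforward => -> ->.
Qed.

Lemma integral_law e (phi : R -> \bar R) : H e -> measurable_fun setT phi ->
  (forall x, 0 <= phi x) ->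
  \int[mu e]_x phi x = \int[P]_w phi (r e w).
Proof.
move=> He mphi phi0.
rewrite -[RHS](@ge0_integral_distribution _ _ _ _ _ P (r e) phi)//.
by apply: eq_measure_integral => A mA _; exact/esym/r_law.
Qed.

Lemma pair_independent e (A B : set R) : H e -> measurable A -> measurable B ->
  P [set w | A (r e w) /\ B (r' e w)] = mu e A * mu e B.
Proof.
move=> He mA mB.
pose S (j : 'I_1 + 'I_1 + 'I_1) : set R :=
  match j with inl (inl _) => A | inl (inr _) => B | inr _ => setT end.
have inj1 : injective (fun _ : 'I_1 => e) by move=> i j _; rewrite [i]ord1 [j]ord1.
have mS j : measurable (S j) by case: j => [[i|i]|i] /=.
have := @finite_independent 1 (fun=> e) inj1 (fun=> He) S mS.
have -> : [set w | forall j, S j (sources (fun=> r e : T -> R) (fun=> r' e : T -> R)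
    (fun=> b e : T -> bool) w j)] = [set w | A (r e w) /\ B (r' e w)].
  apply/seteqP; split => w /= hw.
    by split; [exact: (hw (inl (inl ord0)))|exact: (hw (inl (inr ord0)))].
  by case: hw => h1 h2 [[i|i]|i].
move=> ->; rewrite !big_sumType/= !big_ord1/=.
rewrite [X in _ * X](_ : _ = 1) ?mule1; last first.
  by rewrite -[RHS](@probability_setT _ _ _ P); congr (P _).
by have <- := r_law He mA; have <- := r'_law He mB.
Qed.

Local Notation RR := (measurableTypeR R * measurableTypeR R)%type.

Lemma integral_pair_law e (phi : RR -> \bar R) : H e ->
  measurable_fun setT phi -> (forall x, 0 <= phi x) ->
  \int[mu e \x mu e]_z phi z = \int[P]_w phi (r e w, r' e w).
Proof.
move=> He mphi phi0.
have mpair : measurable_fun setT (fun w => (r e w, r' e w) : RR).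
  have m1 : measurable_fun setT (r e : T -> measurableTypeR R) by have := @measurable_funPT _ _ _ _ (r e).
  have m2 : measurable_fun setT (r' e : T -> measurableTypeR R) by have := @measurable_funPT _ _ _ _ (r' e).
  exact: measurable_fun_pair.
rewrite -[RHS](@ge0_integral_pushforward _ _ _ _ R _ mpair P setT)//.
apply: eq_measure_integral => X mX _.
apply: product_measure_unique => // A B mA mB.
by rewrite -pair_independent.
Qed.

End SourcesIndependence.

(** * Ellipticity *)

Section Noise.
Context {R : realType} {V : countType} (H : set (V * V)).
Context d (T : measurableType d) (P : probability T R).
Variables (r r' : V * V -> {RV P >-> measurableTypeR R}) (b : V * V -> {RV P >-> bool}).
Hypothesis indep : mutually_independent P (source_index H) (source_events r r' b).
Variable mu : V * V -> probability (measurableTypeR R) R.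
Hypotheses (r_law : forall e A, H e -> measurable A -> distribution P (r e) A = mu e A)
  (r'_law : forall e A, H e -> measurable A -> distribution P (r' e) A = mu e A)
  (r_pos : forall e w, H e -> 0 < r e w :> R)
  (r'_pos : forall e w, H e -> 0 < r' e w :> R).

Local Notation RR := (measurableTypeR R * measurableTypeR R)%type.

Definition eighth_moments e : \bar R :=
  (\int[P]_w (r e w ^+ 8)%:E + \int[P]_w (r e w ^- 8)%:E)%E.
Definition noise_numerator e : \bar R :=
  (\int[P]_w ((r e w - r' e w) ^+ 2 * (r e w ^- 6 + r e w ^+ 6))%:E)%E.
Definition noise_denominator e : \bar R :=
  (\int[P]_w (Num.max (r e w - r' e w) 0 ^+ 2 * Num.min 1 (r e w ^- 4))%:E)%E.

Let even_ge0 (x : R) n : ~~ odd n -> 0 <= x ^+ n. Proof. exact: exprn_even_ge0. Qed.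
Let evenV_ge0 (x : R) n : ~~ odd n -> 0 <= x ^- n.
Proof. by move=> ?; rewrite invr_ge0 even_ge0. Qed.

Let num_ge0 (x y : R) : 0 <= (x - y) ^+ 2 * (x ^- 6 + x ^+ 6).
Proof. by rewrite mulr_ge0 ?sqr_ge0// addr_ge0 ?evenV_ge0 ?even_ge0. Qed.
Let den_ge0 (x y : R) : 0 <= Num.max (x - y) 0 ^+ 2 * Num.min 1 (x ^- 4).
Proof. by rewrite mulr_ge0 ?sqr_ge0// le_min ler01 evenV_ge0. Qed.

Section Measurability.
Context {d' : measure_display} {X : measurableType d'} (f g : X -> R).
Hypotheses (mf : measurable_fun setT f) (mg : measurable_fun setT g).

Lemma measurable_numerator :
  measurable_fun setT (fun x => ((f x - g x) ^+ 2 * (f x ^- 6 + f x ^+ 6))%:E).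
Proof.
apply/measurable_EFinP; apply: measurable_funM.
  by apply: measurable_funX; exact: measurable_funB.
apply: measurable_funD; last exact: measurable_funX.
by apply: measurable_fun_inv; exact: measurable_funX.
Qed.

Lemma measurable_denominator :
  measurable_fun setT (fun x => (Num.max (f x - g x) 0 ^+ 2 * Num.min 1 (f x ^- 4))%:E).
Proof.
apply/measurable_EFinP; apply: measurable_funM.
  by apply: measurable_funX; apply: measurable_maxr => //; exact: measurable_funB.
apply: measurable_minr => //.
by apply: measurable_fun_inv; exact: measurable_funX.
Qed.

End Measurability.

Let mr e : measurable_fun setT (r e : T -> R).
Proof. by have := @measurable_funPT _ _ _ _ (r e). Qed.
Let mr' e : measurable_fun setT (r' e : T -> R).
Proof. by have := @measurable_funPT _ _ _ _ (r' e). Qed.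

Local Open Scope ereal_scope.

Lemma moment_law e : H e ->
  \int[mu e]_x (x ^+ 8)%:E + \int[mu e]_x (x ^- 8)%:E = eighth_moments e.
Proof.
move=> He; rewrite (integral_law r_law (phi := fun x => (x ^+ 8)%:E))//; last 2 first.
- by apply/measurable_EFinP; exact: measurable_funX.
- by move=> x; rewrite lee_fin even_ge0.
rewrite (integral_law r_law (phi := fun x => (x ^- 8)%:E))//.
  by apply/measurable_EFinP; apply: measurable_fun_inv; exact: measurable_funX.
by move=> x; rewrite lee_fin evenV_ge0.
Qed.

Let mfst : measurable_fun setT (fst : RR -> R). Proof. exact: measurable_fst. Qed.
Let msnd : measurable_fun setT (snd : RR -> R). Proof. exact: measurable_snd. Qed.

Lemma numerator_law e : H e ->
  \int[mu e \x mu e]_z ((z.1 - z.2) ^+ 2 * (z.1 ^- 6 + z.1 ^+ 6))%:E = noise_numerator e.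
Proof.
move=> He; rewrite (integral_pair_law indep r_law r'_law (phi := fun z : RR =>
  ((z.1 - z.2) ^+ 2 * (z.1 ^- 6 + z.1 ^+ 6))%:E))//.
- exact: (measurable_numerator mfst msnd).
- by move=> z; rewrite lee_fin.
Qed.

Lemma denominator_law e : H e ->
  \int[mu e \x mu e]_z (Num.max (z.1 - z.2) 0 ^+ 2 * Num.min 1 (z.1 ^- 4))%:E =
  noise_denominator e.
Proof.
move=> He; rewrite (integral_pair_law indep r_law r'_law (phi := fun z : RR =>
  (Num.max (z.1 - z.2) 0 ^+ 2 * Num.min 1 (z.1 ^- 4))%:E))//.
- exact: (measurable_denominator mfst msnd).
- by move=> z; rewrite lee_fin.
Qed.

(** One of x^8 and x^-8 is at least 1. This keeps [moment_sup] positive, so that a finite K forces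
    [ratio_sup] to be finite. *)
Lemma eighth_moments_ge1 e : H e -> 1 <= eighth_moments e.
Proof.
move=> He.
have m8 : measurable_fun setT (fun w => (r e w ^+ 8)%:E).
  by apply/measurable_EFinP; exact: measurable_funX.
have m8' : measurable_fun setT (fun w => (r e w ^- 8)%:E).
  by apply/measurable_EFinP; apply: measurable_fun_inv; exact: measurable_funX.
rewrite /eighth_moments -ge0_integralD//; last 2 first.
- by move=> w _; rewrite lee_fin even_ge0.
- by move=> w _; rewrite lee_fin evenV_ge0.
apply: (@le_trans _ _ (\int[P]_w cst 1 w)).
  by rewrite integral_cst//= -[X in (_ <= _ * X)]/(P setT) probability_setT mul1e.
apply: ge0_le_integralT => //.
  exact: emeasurable_funD.
move=> w; rewrite -EFinD lee_fin.
have := r_pos w He; move: (r e w) => x x0.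
have x8 : (0 < x ^+ 8)%R by rewrite exprn_gt0.
have x8' : (0 < x ^- 8)%R by rewrite invr_gt0.
case: (leP 1%R x) => x1.
  have : (1 <= x ^+ 8)%R by rewrite exprn_ege1.
  by move: (x ^- 8)%R x8' => y; lra.
have : (1 <= x ^- 8)%R by rewrite invf_ge1// exprn_ile1// ltW.
by lra.
Qed.

(** By positivity of the copy, the positive part of r - r' is at most r, and r^2 min 1 (r^-4) <= 1.
    The denominator being finite, the quotient can be cleared. *)
Lemma noise_denominator_le1 e : H e -> noise_denominator e <= 1.
Proof.
move=> He; apply: (@le_trans _ _ (\int[P]_w cst 1 w)); last first.
  by rewrite integral_cst//= -[X in (_ * X <= _)]/(P setT) probability_setT mul1e.
apply: ge0_le_integralT => //.
- exact: measurable_denominator.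
- by move=> w; rewrite lee_fin.
move=> w; rewrite lee_fin.
have := r_pos w He; have := r'_pos w He.
move: (r e w : R) (r' e w : R) => x y y0 x0.
have m0 : (0 <= Num.max (x - y) 0)%R by rewrite le_max lexx orbT.
have mx : (Num.max (x - y) 0 <= x)%R by rewrite ge_max (ltW x0) andbT; lra.
have d2 : (Num.max (x - y) 0 ^+ 2 <= x ^+ 2)%R by rewrite ler_pXn2r// nnegrE ltW.
have q0 : (0 <= Num.min 1 (x ^- 4))%R by rewrite le_min ler01 evenV_ge0.
apply: (@le_trans _ _ (x ^+ 2 * Num.min 1 (x ^- 4))%R); first by rewrite ler_wpM2r.
case: (leP 1%R x) => x1.
  apply: (@le_trans _ _ (x ^+ 2 * x ^- 4)%R).
    by rewrite ler_wpM2l ?sqr_ge0// ge_min lexx orbT.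
  by rewrite ler_pdivrMr ?exprn_gt0// mul1r ler_weXn2l.
apply: (@le_trans _ _ (x ^+ 2 * 1)%R); first by rewrite ler_wpM2l ?sqr_ge0// ge_min lexx.
by rewrite mulr1 exprn_ile1// ltW.
Qed.

(** The ratio is multiplied out, so that a zero denominator simply forces a zero numerator. *)
Definition nondegenerate_noise (M kappa : R) := forall e, H e ->
  eighth_moments e <= M%:E /\ noise_numerator e <= kappa%:E * noise_denominator e.

Let noise_numerator_ge0 e : 0 <= noise_numerator e.
Proof. by apply: integral_ge0 => w _; rewrite lee_fin. Qed.
Let noise_denominator_ge0 e : 0 <= noise_denominator e.
Proof. by apply: integral_ge0 => w _; rewrite lee_fin. Qed.

(* The second alternative occurs when [ratio_sup] vanishes: [K] is then 0 even
   if the moments are infinite, since [0 * +oo = 0]. *)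
Lemma finite_K_noise (C : R) : (0 < C)%R -> (exists e, H e) -> Kmu H mu C < +oo ->
  (exists M kappa : R, [/\ (0 <= M)%R, (0 <= kappa)%R & nondegenerate_noise M kappa]) \/
  (forall e, H e -> noise_numerator e = 0).
Proof.
move=> C0 [e0 He0].
have ratioE e : H e ->
    (\int[mu e \x mu e]_z ((z.1 - z.2) ^+ 2 * (z.1 ^- 6 + z.1 ^+ 6))%:E /
    \int[mu e \x mu e]_z (Num.max (z.1 - z.2) 0 ^+ 2 * Num.min 1 (z.1 ^- 4))%:E) =
    noise_numerator e / noise_denominator e.
  by move=> He; rewrite numerator_law// denominator_law.
have ratio_ub e : H e -> noise_numerator e / noise_denominator e <= ratio_sup H mu.
  by move=> He; apply: ereal_sup_ubound; exists e => //; exact: ratioE.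
have moment_ub e : H e -> eighth_moments e <= moment_sup H mu.
  by move=> He; apply: ereal_sup_ubound; exists e => //; exact: moment_law.
have den_fin e : H e -> exists2 x : R, noise_denominator e = x%:E & (0 <= x)%R.
  move=> He; have := noise_denominator_le1 He; have := noise_denominator_ge0 e.
  by case: (noise_denominator e) => [x| |]//; rewrite lee_fin => x0 _; exists x.
have ratio_ge0 e : H e -> 0 <= noise_numerator e / noise_denominator e.
  move=> He; rewrite mule_ge0//; have [x -> x0] := den_fin _ He.
  by rewrite inver; case: ifP => // _; rewrite lee_fin invr_ge0.
have rs0 : 0 <= ratio_sup H mu by exact: le_trans (ratio_ge0 _ He0) (ratio_ub _ He0).
have ms1 : 1 <= moment_sup H mu.
  exact: le_trans (eighth_moments_ge1 He0) (moment_ub _ He0).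
rewrite /Kmu.
have [rs|rs] := eqVneq (ratio_sup H mu) 0.
  move=> _; right => e He.
  have : noise_numerator e / noise_denominator e = 0.
    by apply/eqP; rewrite eq_le ratio_ge0// andbT -rs ratio_ub.
  have [x -> x0] := den_fin _ He.
  move/eqP; rewrite mule_eq0 inver => /orP[/eqP //|].
  case: ifP => // /negbT xn0; rewrite eqe invr_eq0 => /eqP xe.
  by rewrite xe eqxx in xn0.
have rsp : 0 < ratio_sup H mu by rewrite lt_def rs.
case: (moment_sup H mu) ms1 moment_ub => [M| |]//; last first.
  move=> _ _; rewrite [+oo ^+ 6](_ : _ = +oo); last by rewrite /= !mulyy.
  by rewrite gt0_muley ?lte_fin// gt0_mulye.
move=> M1 moment_ub.
case: (ratio_sup H mu) rsp rs0 ratio_ub => [kappa| |]//; last first.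
  move=> _ _ _; rewrite gt0_muley//; rewrite -EFin_expe -EFinM lte_fin mulr_gt0// exprn_gt0//.
  by rewrite lee_fin in M1; lra.
move=> _ k0 ratio_ub _; left; exists M, kappa; split.
- by rewrite lee_fin in M1; lra.
- by rewrite lee_fin in k0.
move=> e He; split; first exact: moment_ub.
have := ratio_ub _ He; have [x -> x0] := den_fin _ He.
rewrite inver; case: eqVneq => [->|xn0].
  (* With a zero denominator, a nonzero numerator would make the quotient +oo. *)
  have := noise_numerator_ge0 e; case: (noise_numerator e) => [y| |]//.
    rewrite lee_fin => y0; have [->|yn0] := eqVneq y 0%R; first by rewrite mule0.
    by rewrite gt0_muley ?lte_fin ?lt_def ?yn0.
by rewrite lee_pdivrMr// lt_def xn0.
Qed.

(** On [1, L], r^-6 + r^6 <= 1 + L^6 and min 1 (r^-4) >= L^-4. The square (r - r')^2 is the sum of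
    the squared positive parts of r - r' and r' - r, of equal expectation by exchange: this gives
    the 2 in kappa. *)
Lemma elliptic_noise : uniformly_elliptic H mu ->
  exists M kappa : R, [/\ (0 <= M)%R, (0 <= kappa)%R & nondegenerate_noise M kappa].
Proof.
move=> [L [L1 hL]]; have L0 : (0 < L)%R by lra.
have p6 : (0 <= L ^+ 6)%R by rewrite even_ge0.
have p4 : (0 <= L ^+ 4)%R by rewrite even_ge0.
have p8 : (0 <= L ^+ 8)%R by rewrite even_ge0.
exists (L ^+ 8 + 1)%R, ((1 + L ^+ 6) * (2 * L ^+ 4))%R; split.
- by rewrite addr_ge0.
- by rewrite mulr_ge0 ?addr_ge0// mulr_ge0.
move=> e He.
have ae_range : {ae P, forall w, (1 <= r e w <= L)%R}.
  have mI : measurable (r e @^-1` `[1%R, L]).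
    rewrite -[X in measurable X]setTI.
    by apply: (mr e measurableT (measurable_itv `[1%R, L])).
  exists (~` (r e @^-1` `[1%R, L])); split.
  - exact: measurableC.
  - rewrite probability_setC//.
    have := r_law He (measurable_itv `[1%R, L]); rewrite /distribution/= /pushforward => ->.
    by rewrite (hL _ He) subee.
  - by apply: subsetC => w /=; rewrite in_itv.
split.
  have m8 : measurable_fun setT (fun w => (r e w ^+ 8)%:E).
    by apply/measurable_EFinP; exact: measurable_funX.
  have m8' : measurable_fun setT (fun w => (r e w ^- 8)%:E).
    by apply/measurable_EFinP; apply: measurable_fun_inv; exact: measurable_funX.
  rewrite /eighth_moments -ge0_integralD//; last 2 first.
  - by move=> w _; rewrite lee_fin even_ge0.
  - by move=> w _; rewrite lee_fin evenV_ge0.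
  apply: (@le_trans _ _ (\int[P]_w cst (L ^+ 8 + 1)%:E w)); last first.
    by rewrite integral_cst//= -[X in (_ * X <= _)]/(P setT) probability_setT mule1.
  apply: ae_ge0_le_integral => //.
  - by move=> w _; rewrite -EFinD lee_fin addr_ge0 ?even_ge0 ?evenV_ge0.
  - exact: emeasurable_funD.
  - by move=> w _; rewrite lee_fin addr_ge0.
  apply: filterS ae_range => w /andP[w1 wL] _.
  rewrite -EFinD lee_fin lerD//.
    by apply: lerXn2r; rewrite ?nnegrE; lra.
  by rewrite invf_le1 ?exprn_gt0 ?exprn_ege1//; lra.
pose sq w : \bar R := (Num.max (r e w - r' e w) 0 ^+ 2)%:E.
pose sq' w : \bar R := (Num.max (r' e w - r e w) 0 ^+ 2)%:E.
have msq : measurable_fun setT sq.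
  apply/measurable_EFinP/measurable_funX; apply: measurable_maxr => //.
  exact: measurable_funB.
have msq' : measurable_fun setT sq'.
  apply/measurable_EFinP/measurable_funX; apply: measurable_maxr => //.
  exact: measurable_funB.
have sq0 w : 0 <= sq w by rewrite lee_fin sqr_ge0.
have sq'0 w : 0 <= sq' w by rewrite lee_fin sqr_ge0.
have swap : \int[P]_w sq' w = \int[P]_w sq w.
  pose phi (z : RR) : \bar R := (Num.max (z.1 - z.2) 0 ^+ 2)%:E.
  have mphi : measurable_fun setT phi.
    apply/measurable_EFinP/measurable_funX; apply: measurable_maxr => //.
    exact: measurable_funB.
  have phi0 z : 0 <= phi z by rewrite lee_fin sqr_ge0.
  rewrite -[RHS]/(\int[P]_w phi (r e w, r' e w)).
  rewrite -(integral_pair_law indep r_law r'_law He mphi phi0).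
  rewrite -[LHS]/(\int[P]_w phi (r' e w, r e w)).
  have mpair : measurable_fun setT (fun w => (r' e w, r e w) : RR).
    have m1 : measurable_fun setT (r e : T -> measurableTypeR R) by exact: mr.
    have m2 : measurable_fun setT (r' e : T -> measurableTypeR R) by exact: mr'.
    exact: measurable_fun_pair.
  rewrite -[LHS](@ge0_integral_pushforward _ _ _ _ R _ mpair P setT phi)//.
  apply: eq_measure_integral => X mX _; apply/esym.
  apply: product_measure_unique => // A B mA mB.
  rewrite muleC -(pair_independent indep r_law r'_law He mB mA).
  by congr (P _); apply/seteqP; split => w /= [].
apply: (@le_trans _ _ ((1 + L ^+ 6)%:E * (\int[P]_w sq w + \int[P]_w sq' w))).
  have L6 : (0 <= 1 + L ^+ 6)%R by rewrite addr_ge0.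
  rewrite -ge0_integralD// -ge0_integralZl//; last 2 first.
  - exact: emeasurable_funD.
  - by move=> w _; exact: adde_ge0.
  apply: ae_ge0_le_integral => //.
  - by move=> w _; rewrite lee_fin.
  - exact: measurable_numerator.
  - by move=> w _; rewrite mule_ge0// adde_ge0.
  - by apply: measurable_funeM; exact: emeasurable_funD.
  apply: filterS ae_range => w /andP[w1 wL] _.
  rewrite /sq /sq' -EFinD -EFinM lee_fin mulrC.
  have h6 : (r e w ^- 6 + r e w ^+ 6 <= 1 + L ^+ 6)%R.
    apply: lerD; first by rewrite invf_le1 ?exprn_gt0 ?exprn_ege1//; lra.
    by apply: lerXn2r; rewrite ?nnegrE; lra.
  have -> : (Num.max (r e w - r' e w) 0 ^+ 2 + Num.max (r' e w - r e w) 0 ^+ 2 =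
      (r e w - r' e w) ^+ 2)%R.
    rewrite -(opprB (r e w) (r' e w)); move: (r e w - r' e w)%R => x.
    case: (leP x 0%R) => x0; case: (leP (- x)%R 0%R) => x1; rewrite ?sqrrN ?expr0n/= ?addr0 ?add0r//.
      by rewrite (_ : x = 0%R) ?expr0n//; lra.
    by exfalso; lra.
  by rewrite ler_wpM2r ?sqr_ge0.
have c0 : (0 <= (1 + L ^+ 6) * 2)%R by rewrite mulr_ge0// addr_ge0.
have sqd : \int[P]_w sq w <= (L ^+ 4)%:E * noise_denominator e.
  rewrite /noise_denominator -ge0_integralZl//; last 2 first.
  - exact: measurable_denominator.
  - by move=> w _; rewrite lee_fin.
  apply: ae_ge0_le_integral => //.
  - by move=> w _; rewrite mule_ge0// lee_fin.
  - by apply: measurable_funeM; exact: measurable_denominator.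
  apply: filterS ae_range => w /andP[w1 wL] _.
  rewrite /sq -EFinM lee_fin mulrCA -[leLHS]mulr1 ler_wpM2l ?sqr_ge0//.
  have x4 : (1 <= r e w ^+ 4 <= L ^+ 4)%R.
    rewrite exprn_ege1//=; apply: lerXn2r; rewrite ?nnegrE; lra.
  have -> : Num.min 1%R (r e w ^- 4)%R = (r e w ^- 4)%R.
    by apply/min_idPr; rewrite invf_le1; lra.
  by rewrite ler_pdivlMr; lra.
have Isq0 : 0 <= \int[P]_w sq w by exact: integral_ge0.
have dbl : \int[P]_w sq w + \int[P]_w sq w = 2%:E * \int[P]_w sq w.
  by rewrite (_ : 2%R = 1 + 1)%R// EFinD ge0_muleDl// mul1e.
rewrite swap dbl [leLHS]muleA -EFinM mulrA [in leRHS]EFinM -[leRHS]muleA.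
by apply: lee_wpmul2l; [rewrite lee_fin|].
Qed.

End Noise.

(** * Passage to the limit *)

Section Correlation.
Context {R : realType} d (T : measurableType d) (P : probability T R).
Local Notation L2 := (Lfun P 2%:E).

Lemma dominated_expectation (Z_ : nat -> T -> R) (Z W : T -> R) :
  (forall n, measurable_fun setT (Z_ n)) -> W \in Lfun P 1%E ->
  (forall n w, `|Z_ n w| <= W w) -> (forall w, Z_ n w @[n --> \oo] --> Z w) ->
  (fun n => fine 'E_P[Z_ n]) @ \oo --> fine 'E_P[Z].
Proof.
move=> mZ_ LW ZW cZ.
have mZ : measurable_fun setT Z by apply: (measurable_fun_cvg mZ_) => w _; exact: cZ.
have iW : P.-integrable setT (EFin \o W) by exact/Lfun1_integrable.
have [|||||iZ _ c] := @dominated_convergence _ T R P setT measurableT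
  (fun n => EFin \o Z_ n) (EFin \o Z) (EFin \o W).
- by move=> n; exact/measurable_EFinP.
- exact/measurable_EFinP.
- apply: aeW => w _; apply: cvg_EFin; last exact: cZ.
  by apply: nearW.
- exact: iW.
- by apply: aeW => w n _; rewrite /= lee_fin.
rewrite unlock; apply: fine_cvg; rewrite fineK; last exact: integrable_fin_num.
exact: c.
Qed.

Lemma dominated_L2 (Z W : T -> R) : measurable_fun setT Z -> W \in L2 ->
  (forall w, `|Z w| <= W w) -> Z \in L2.
Proof.
move=> mZ LW ZW; apply: L2_square => //.
have := integrableP _ _ _ (Lfun2_integrable_sqr LW) => -[mW2 iW2].
apply: le_lt_trans iW2; apply: ge0_le_integralT.
- by apply/measurable_EFinP; exact: measurable_funX.
- exact: measurableT_comp.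
- by move=> w; rewrite lee_fin sqr_ge0.
- move=> w; rewrite /= lee_fin normrX -real_normK ?num_real// ler_pXn2r// ?nnegrE//.
  by rewrite (le_trans (ZW w))// ler_norm.
Qed.

Lemma variance_inner (X : T -> R) : X \in L2 ->
  fine 'V_P[X] = inner P X X - fine 'E_P[X] ^+ 2.
Proof.
move=> LX; rewrite varianceE// (_ : X ^+ 2 = X * X); last by rewrite expr2.
have fX := expectation_fin_num (L2_Lfun1 LX).
have fXX := expectation_fin_num (L2_mul LX LX).
by rewrite /inner -[in LHS](fineK fX) -[in LHS](fineK fXX) -EFin_expe -EFinB.
Qed.

Lemma covariance_inner (X Y : T -> R) : X \in L2 -> Y \in L2 ->
  fine (covariance P X Y) = inner P X Y - fine 'E_P[X] * fine 'E_P[Y].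
Proof.
move=> LX LY; rewrite covarianceE ?(L2_mul LX LY) ?L2_Lfun1//.
have fX := expectation_fin_num (L2_Lfun1 LX).
have fY := expectation_fin_num (L2_Lfun1 LY).
have fXY := expectation_fin_num (L2_mul LX LY).
by rewrite /inner -[in LHS](fineK fX) -[in LHS](fineK fY) -[in LHS](fineK fXY) -EFinM -EFinB.
Qed.

Lemma correlation_bounds (X Y : T -> R) (c : R) : X \in L2 -> Y \in L2 ->
  fine 'E_P[X] = fine 'E_P[Y] -> inner P X X = inner P Y Y -> 0 <= c ->
  inner P (X - Y) (X - Y) <= c * fine 'V_P[X] ->
  1 - c / 2 <= correlation P X Y <= 1.
Proof.
move=> LX LY EXY IXY c0 h.
have VXY : fine 'V_P[X] = fine 'V_P[Y] by rewrite !variance_inner// EXY IXY.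
rewrite /correlation; case: ifPn => [_|].
  by rewrite lexx andbT lerBlDr lerDl divr_ge0.
rewrite negb_or => /andP[VX _].
have fV : 'V_P[X] \is a fin_num by exact: variance_fin_num.
set v := fine 'V_P[X].
have v0 : 0 < v.
  rewrite lt_def fine_ge0 ?variance_ge0// andbT.
  by apply: contraNneq VX => v0; rewrite -(fineK fV) -/v v0.
rewrite -VXY -/v -expr2 sqr_sqrtr ?(ltW v0)// covariance_inner// -EXY.
have vE : v = inner P X X - fine 'E_P[X] ^+ 2 by rewrite /v variance_inner.
have := inner_ge0 P (X - Y).
rewrite innerBB// -IXY in h * => D0.
rewrite -expr2 ler_pdivrMr// ler_pdivlMr// mul1r -/v in h *.
by apply/andP; split; lra.
Qed.

End Correlation.

(** * Correlation for a fixed noise level and a fixed pair of vertices *)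

Section FixedNoise.
Context {R : realType} {V : countType}.
Variables (E : rel V) (H : set (V * V)).
Hypotheses (E_symmetric : symmetric E) (E_locally_finite : locally_finite E)
  (H_half : half_edges E H).
Context d (T : measurableType d) (P : probability T R).
Variables (r r' : V * V -> {RV P >-> measurableTypeR R}) (b : V * V -> {RV P >-> bool}).
Hypothesis indep : mutually_independent P (source_index H) (source_events r r' b).
Variable mu : V * V -> probability (measurableTypeR R) R.
Hypotheses (r_law : forall e A, H e -> measurable A -> distribution P (r e) A = mu e A)
  (r'_law : forall e A, H e -> measurable A -> distribution P (r' e) A = mu e A)
  (r_pos : forall e w, H e -> 0 < r e w :> R)
  (r'_pos : forall e w, H e -> 0 < r' e w :> R)
  (mu_L2 : forall e, H e -> (\int[mu e]_x (x ^+ 2)%:E < +oo)%E).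
Variable eps : R.
Hypotheses (eps_ge0 : 0 <= eps)
  (b_law : forall e, H e -> P [set w | b e w] = eps%:E).
Variables (u v : V) (p : seq V).
Hypotheses (path_p : path E u p) (last_p : last u p = v).
Local Notation L2 := (Lfun P 2%:E).
Local Notation theta0 := (path_flow (R := R) u p).

Let mr e : measurable_fun setT (r e : T -> R).
Proof. by have := @measurable_funPT _ _ _ _ (r e). Qed.
Let mr' e : measurable_fun setT (r' e : T -> R).
Proof. by have := @measurable_funPT _ _ _ _ (r' e). Qed.
Let mb e : measurable_fun setT (b e : T -> bool).
Proof. by have := @measurable_funPT _ _ _ _ (b e). Qed.

Let re (e : V * V) : T -> R := r e.
Let re' (e : V * V) : T -> R := r' e.
Let ne (e : V * V) : T -> R := noisy r r' b e.

Let ne_pos e w : H e -> 0 < ne e w.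
Proof. by move=> He; rewrite /ne /noisy; case: (b e w); [exact: r'_pos|exact: r_pos]. Qed.

Let mne e : measurable_fun setT (ne e).
Proof. by apply: measurable_fun_ifT. Qed.

Let Xn n (w : T) : R := wired_energy H u p n (fun e => re e w).
Let Yn n (w : T) : R := wired_energy H u p n (fun e => ne e w).

Let edge_H n (i : 'I_(size (edge_list H n))) : H (edge i).
Proof. by have /(mem_edge_list E_symmetric E_locally_finite H_half)[] := edge_mem i. Qed.

Let edge_inj n : injective (@edge V H n).
Proof.
move=> i j; rewrite /edge !(tnth_nth (edge i)) => /eqP.
by rewrite nth_uniq ?edge_list_uniq// => /eqP/ord_inj.
Qed.

Let mXn n : measurable_fun setT (Xn n).
Proof. by apply: measurable_min_energy => i; exact: mr. Qed.
Let mYn n : measurable_fun setT (Yn n).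
Proof. by apply: measurable_min_energy => i; exact: mne. Qed.

(** Energy of the path flow with resistances r + r'. These dominate both r and its noisy version, so
    one square-integrable variable bounds both sequences of wired energies. *)
Let dominating (w : T) : R :=
  \sum_(e <- path_edges H u p) (re e w + re' e w) * theta0 e ^+ 2.

Let path_edges_H e : e \in path_edges H u p -> H e.
Proof. by rewrite mem_undup mem_filter => /andP[/asboolP]. Qed.

Let re_L2 e : H e -> re e \in L2.
Proof.
move=> He; apply: L2_square; first exact: mr.
rewrite -(integral_law r_law (phi := fun x => (x ^+ 2)%:E))//.
- exact: mu_L2.
- by apply/measurable_EFinP; exact: measurable_funX.
- by move=> x; rewrite lee_fin sqr_ge0.
Qed.

Let re'_L2 e : H e -> re' e \in L2.
Proof.
move=> He; apply: L2_square; first exact: mr'.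
rewrite -(integral_law r'_law (phi := fun x => (x ^+ 2)%:E))//.
- exact: mu_L2.
- by apply/measurable_EFinP; exact: measurable_funX.
- by move=> x; rewrite lee_fin sqr_ge0.
Qed.

Let dominating_L2 : dominating \in L2.
Proof.
have -> : dominating = \sum_(e <- path_edges H u p) (theta0 e ^+ 2 *: (re e + re' e)).
  apply/funext => w; rewrite /dominating fct_sumE; apply: eq_bigr => e _.
  by rewrite mulrC.
rewrite big_seq; apply: L2_sum => e /path_edges_H He.
by rewrite L2Z// L2D ?re_L2 ?re'_L2.
Qed.

Let bound_dominated (s : V * V -> T -> R) n w :
  (forall e, H e -> 0 < s e w) -> (forall e, H e -> s e w <= re e w + re' e w) ->
  0 <= wired_energy H u p n (fun e => s e w) <= dominating w.
Proof.
move=> s0 sle; rewrite (wired_energy_ge0 E_symmetric E_locally_finite H_half)//=.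
have := wired_energy_le_path E_symmetric E_locally_finite H_half u p s0 n.
move/le_trans; apply.
rewrite /path_bound /dominating big_seq [leRHS]big_seq.
by apply: ler_sum => e /path_edges_H He; rewrite ler_wpM2r ?sqr_ge0// sle.
Qed.

Let Xn_bound n w : 0 <= Xn n w <= dominating w.
Proof.
apply: bound_dominated => e He; first exact: r_pos.
by rewrite lerDl ltW// r'_pos.
Qed.

Let Yn_bound n w : 0 <= Yn n w <= dominating w.
Proof.
apply: (@bound_dominated ne) => e He; first exact: ne_pos.
rewrite /ne /noisy; case: (b e w); first by rewrite lerDr ltW// r_pos.
by rewrite lerDl ltW// r'_pos.
Qed.

Local Notation X := (random_resistance H E r u v).
Local Notation Y := (random_resistance H E (noisy r r' b) u v).

Let Xn_cvg w : Xn n w @[n --> \oo] --> X w.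
Proof.
apply: (wired_energy_cvg_resistance E_symmetric E_locally_finite H_half path_p last_p).
by move=> e He; exact: r_pos.
Qed.

Let Yn_cvg w : Yn n w @[n --> \oo] --> Y w.
Proof.
apply: (wired_energy_cvg_resistance E_symmetric E_locally_finite H_half path_p last_p).
by move=> e He; exact: ne_pos.
Qed.

Let abs_bound (x g : R) : 0 <= x <= g -> `|x| <= g.
Proof. by move=> /andP[x0 xg]; rewrite ger0_norm. Qed.

Let bound_lim (Z_ : nat -> T -> R) Z : (forall n w, 0 <= Z_ n w <= dominating w) ->
  (forall w, Z_ n w @[n --> \oo] --> Z w) -> forall w, `|Z w| <= dominating w.
Proof.
move=> hZ cZ w; have cw : cvgn (fun n => Z_ n w) by apply/cvg_ex; exists (Z w); exact: cZ.
rewrite -(cvg_lim _ (cZ w))//; apply: abs_bound; apply/andP; split.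
  by apply: limr_ge => //; apply: nearW => n; have /andP[] := hZ n w.
by apply: limr_le => //; apply: nearW => n; have /andP[] := hZ n w.
Qed.

Let X_L2 : X \in L2.
Proof.
apply: (dominated_L2 _ dominating_L2); last exact: (bound_lim Xn_bound Xn_cvg).
by apply: (measurable_fun_cvg mXn) => w _; exact: Xn_cvg.
Qed.

Let Y_L2 : Y \in L2.
Proof.
apply: (dominated_L2 _ dominating_L2); last exact: (bound_lim Yn_bound Yn_cvg).
by apply: (measurable_fun_cvg mYn) => w _; exact: Yn_cvg.
Qed.

Let Xn_L2 n : Xn n \in L2.
Proof. by apply: (dominated_L2 _ dominating_L2) => // w; exact: abs_bound. Qed.
Let Yn_L2 n : Yn n \in L2.
Proof. by apply: (dominated_L2 _ dominating_L2) => // w; exact: abs_bound. Qed.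

Let sq_dom : dominating * dominating \in Lfun P 1%E.
Proof. exact: L2_mul. Qed.

Let inner_cvg (A_ B_ : nat -> T -> R) A B :
  (forall n, measurable_fun setT (A_ n)) -> (forall n, measurable_fun setT (B_ n)) ->
  (forall n w, `|A_ n w| <= dominating w) -> (forall n w, `|B_ n w| <= dominating w) ->
  (forall w, A_ n w @[n --> \oo] --> A w) -> (forall w, B_ n w @[n --> \oo] --> B w) ->
  inner P (A_ n) (B_ n) @[n --> \oo] --> inner P A B.
Proof.
move=> mA mB hA hB cA cB.
apply: (dominated_expectation (Z_ := fun n => A_ n * B_ n) _ sq_dom).
- by move=> n; exact: measurable_funM.
- by move=> n w; rewrite normrM ler_pM.
- by move=> w; exact: cvgM.
Qed.

Let mean_cvg (A_ : nat -> T -> R) A : (forall n, measurable_fun setT (A_ n)) ->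
  (forall n w, `|A_ n w| <= dominating w) -> (forall w, A_ n w @[n --> \oo] --> A w) ->
  fine 'E_P[A_ n] @[n --> \oo] --> fine 'E_P[A].
Proof.
by move=> mA hA cA; apply: (dominated_expectation _ (L2_Lfun1 dominating_L2)).
Qed.

Section FiniteLevel.
Variable n : nat.
Local Notation m := (size (edge_list H n)).
Let rn (i : 'I_m) : T -> R := r (edge i).
Let rn' (i : 'I_m) : T -> R := r' (edge i).
Let bn (i : 'I_m) : T -> bool := b (edge i).

Let ind : independent_coords P (sources rn rn' bn).
Proof. exact: (finite_independent indep (@edge_inj n) (@edge_H n)). Qed.

Let same_law i B : measurable B -> P [set w | B (rn' i w)] = P [set w | B (rn i w)].
Proof. by move=> mB; apply: (same_law_of r_law r'_law). Qed.

Let rn_gt0 i w : 0 < rn i w. Proof. exact: r_pos. Qed.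
Let rn'_gt0 i w : 0 < rn' i w. Proof. exact: r'_pos. Qed.

Let XnE : Xn n = energy_of (divergence H n) (restrict H n theta0) rn.
Proof. by []. Qed.
Let YnE : Yn n = energy_of (divergence H n) (restrict H n theta0) (noisy_of rn rn' bn).
Proof. by []. Qed.

Lemma finite_noisy_law (h : R -> R) : measurable_fun setT h -> (forall x, 0 <= h x) ->
  (\int[P]_w (h (Yn n w))%:E = \int[P]_w (h (Xn n w))%:E)%E.
Proof.
rewrite XnE YnE; by apply: energy_noisy_law => // i; [exact: mr|exact: mr'].
Qed.

Let X2_fin : (\int[P]_w (energy_of (divergence H n) (restrict H n theta0) rn w ^+ 2)%:E < +oo)%E.
Proof.
have /integrableP[_] := Lfun2_integrable_sqr (Xn_L2 n).
by under eq_integral do rewrite /= ger0_norm ?sqr_ge0//.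
Qed.

Lemma finite_nondegenerate M kappa : 0 <= M -> 0 <= kappa ->
  nondegenerate_noise H r r' M kappa ->
  inner P (Xn n - Yn n) (Xn n - Yn n) <=
    eps * (stability_constant M kappa * fine 'V_P[Xn n]).
Proof.
move=> M0 k0 nd; rewrite -lee_fin innerE ?L2B//.
have := @energy_noise_stability R d T P m n (divergence H n) (restrict H n theta0)
  rn rn' bn (fun i => mr (edge i)) (fun i => mr' (edge i)) (fun i => mb (edge i))
  ind same_law rn_gt0 rn'_gt0 X2_fin M kappa (fun i => (nd _ (edge_H i)).1) M0 k0
  (fun i => (nd _ (edge_H i)).2) eps eps_ge0 (fun i => b_law (edge_H i)).
by apply: le_trans; rewrite le_eqVlt; apply/orP; left; apply/eqP; apply: eq_integral.
Qed.

Lemma finite_degenerate : (forall e, H e -> noise_numerator r r' e = 0%E) ->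
  inner P (Xn n - Yn n) (Xn n - Yn n) <= eps * (0 * fine 'V_P[Xn n]).
Proof.
move=> num0; rewrite mul0r mulr0 -lee_fin innerE ?L2B//.
have := @degenerate_noise_stability R d T P m n (divergence H n) (restrict H n theta0)
  rn rn' bn (fun i => mr (edge i)) (fun i => mr' (edge i)) (fun i => mb (edge i))
  ind same_law rn_gt0 rn'_gt0 X2_fin eps (fun i => b_law (edge_H i))
  (fun i => num0 _ (edge_H i)).
by apply: le_trans; rewrite le_eqVlt; apply/orP; left; apply/eqP; apply: eq_integral.
Qed.

End FiniteLevel.

Let mean_eq : fine 'E_P[X] = fine 'E_P[Y].
Proof.
have cX := mean_cvg mXn (fun n w => abs_bound (Xn_bound n w)) Xn_cvg.
have cY := mean_cvg mYn (fun n w => abs_bound (Yn_bound n w)) Yn_cvg.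
rewrite -(cvg_lim _ cX)// -(cvg_lim _ cY)//; congr (limn _); apply/funext => n.
congr fine; rewrite unlock.
(* Equality of laws is available for nonnegative test functions, whence the absolute value; the
   energies are nonnegative. *)
have h := @finite_noisy_law n (fun x => `|x|) (@normr_measurable R setT) (fun x => normr_ge0 x).
rewrite (eq_integral (fun w => `|Xn n w|%:E)); last first.
  by move=> w _; rewrite ger0_norm//; have /andP[] := Xn_bound n w.
rewrite -h; apply: eq_integral => w _.
by rewrite ger0_norm//; have /andP[] := Yn_bound n w.
Qed.

Let square_eq : inner P X X = inner P Y Y.
Proof.
have cX := inner_cvg mXn mXn (fun n w => abs_bound (Xn_bound n w))
  (fun n w => abs_bound (Xn_bound n w)) Xn_cvg Xn_cvg.
have cY := inner_cvg mYn mYn (fun n w => abs_bound (Yn_bound n w))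
  (fun n w => abs_bound (Yn_bound n w)) Yn_cvg Yn_cvg.
rewrite -(cvg_lim _ cX)// -(cvg_lim _ cY)//; congr (limn _); apply/funext => n.
apply: EFin_inj; rewrite !innerE//.
have h := @finite_noisy_law n (fun x => x * x) _ (fun x => sqr_ge0 x).
rewrite h//; exact: measurable_funM.
Qed.

(** The constant is the same at every level, and by domination both sides of the bound converge to
    their counterparts for the effective resistances. *)
Lemma noisy_correlation (K : R) : 0 <= K ->
  (forall n, inner P (Xn n - Yn n) (Xn n - Yn n) <= eps * (K * fine 'V_P[Xn n])) ->
  1 - eps * K / 2 <= correlation P X Y <= 1.
Proof.
move=> K0 hK; apply: correlation_bounds => //; first exact: mulr_ge0.
have aX n w := abs_bound (Xn_bound n w); have aY n w := abs_bound (Yn_bound n w).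
have c1 : inner P (Xn n - Yn n) (Xn n - Yn n) @[n --> \oo] --> inner P (X - Y) (X - Y).
  apply: inner_cvg.
  - by move=> n; exact: measurable_funB.
  - by move=> n; exact: measurable_funB.
  - move=> n w; rewrite -[X in `|X|]/(Xn n w - Yn n w) ler_norml.
    by have /andP[x0 x1] := Xn_bound n w; have /andP[y0 y1] := Yn_bound n w; lra.
  - move=> n w; rewrite -[X in `|X|]/(Xn n w - Yn n w) ler_norml.
    by have /andP[x0 x1] := Xn_bound n w; have /andP[y0 y1] := Yn_bound n w; lra.
  - by move=> w; exact: cvgB.
  - by move=> w; exact: cvgB.
have c2 : eps * (K * fine 'V_P[Xn n]) @[n --> \oo] --> eps * (K * fine 'V_P[X]).
  apply: cvgM; first exact: cvg_cst.
  apply: cvgM; first exact: cvg_cst.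
  rewrite variance_inner//; under eq_fun do rewrite variance_inner//.
  apply: cvgB; first exact: inner_cvg.
  rewrite expr2; under eq_fun do rewrite expr2.
  by apply: cvgM; exact: mean_cvg.
rewrite -mulrA -(cvg_lim _ c1)// -(cvg_lim _ c2)//; apply: ler_lim.
- by apply/cvg_ex; eexists; exact: c1.
- by apply/cvg_ex; eexists; exact: c2.
- exact: nearW.
Qed.

Lemma nondegenerate_correlation M kappa : 0 <= M -> 0 <= kappa ->
  nondegenerate_noise H r r' M kappa ->
  1 - eps * stability_constant M kappa / 2 <= correlation P X Y <= 1.
Proof.
move=> M0 k0 nd; apply: noisy_correlation => [|n]; last exact: finite_nondegenerate.
rewrite /stability_constant; apply: addr_ge0 => //; apply: mulr_ge0; last first.
  by rewrite exprn_ge0// addr_ge0// mulr_ge0.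
by apply: mulr_ge0 => //; apply: mulr_ge0 => //; exact: exprn_ge0.
Qed.

Lemma degenerate_correlation : (forall e, H e -> noise_numerator r r' e = 0%E) ->
  1 - eps * 0 / 2 <= correlation P X Y <= 1.
Proof.
by move=> num0; apply: noisy_correlation => // n; exact: finite_degenerate.
Qed.

End FixedNoise.

Lemma half_edges_nonempty (V : countType) (E : rel V) (H : set (V * V)) :
  connected_graph E -> half_edges E H -> (exists u v : V, u != v) -> exists e, H e.
Proof.
move=> conn [_ EH _] [u [v uv]]; have [[|y p] [/= path_p last_p]] := conn u v.
  by rewrite last_p eqxx in uv.
by case/andP: path_p => /EH[] ? _; [exists (u, y)|exists (y, u)].
Qed.

(** Squeezes the infimum, since [c] is the same for all indices; a point of [D] is needed for the
    upper bound, an empty infimum being +oo. *)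
Lemma cvg_ereal_inf_at_right (R : realType) (I : Type) (D : set I)
    (f : R -> I -> R) (c : R) : D !=set0 ->
  (forall eps i, 0 < eps < 1 -> D i -> 1 - eps * c <= f eps i <= 1) ->
  ereal_inf [set (f eps i)%:E | i in D] @[eps --> 0^'+] --> 1%E.
Proof.
move=> [i0 Di0] hf.
apply: (@squeeze_cvge _ _ _ _ (fun eps => (1 - eps * c)%:E) _ (cst 1%E)).
- near=> eps; have eps01 : 0 < eps < 1.
    by apply/andP; split; near: eps; [exact: nbhs_right_gt|exact: nbhs_right_lt].
  apply/andP; split.
    apply: le_ereal_inf_tmp => _ [i Di <-]; rewrite lee_fin.
    by have /andP[] := hf _ _ eps01 Di.
  apply: (@le_trans _ _ (f eps i0)%:E); first by apply: ereal_inf_lbound; exists i0.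
  by rewrite lee_fin; have /andP[] := hf _ _ eps01 Di0.
- apply: cvg_EFin; first exact: nearW.
  rewrite -[X in _ --> X]subr0 -[X in _ - X](mul0r c).
  apply: cvgB; first exact: cvg_cst.
  apply: cvgM; last exact: cvg_cst.
  exact: cvg_at_right_filter.
- exact: cvg_cst.
Unshelve. all: by end_near. Qed.

Theorem corollary3p6 (R : realType) (V : countType) (E : rel V)
    (H : set (V * V))
    (E_symmetric : symmetric E) (E_locally_finite : locally_finite E)
    (E_connected : connected_graph E) (H_half : half_edges E H)
    (two_vertices : exists u v : V, u != v)
    (mu : V * V -> probability (measurableTypeR R) R)
    (mu_pos : forall e, H e -> mu e `]0, +oo[%classic = 1%E)
    (mu_L2 : forall e, H e -> (\int[mu e]_x (x ^+ 2)%:E < +oo)%E)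
    (d : measure_display) (T : measurableType d) (P : probability T R)
    (r r' : V * V -> {RV P >-> measurableTypeR R})
    (b : R -> V * V -> {RV P >-> bool})
    (r_pos : forall e w, H e -> 0 < r e w :> R)
    (r'_pos : forall e w, H e -> 0 < r' e w :> R)
    (r_law : forall e A, H e -> measurable A -> distribution P (r e) A = mu e A)
    (r'_law : forall e A, H e -> measurable A ->
      distribution P (r' e) A = mu e A)
    (b_law : forall eps e, 0 < eps < 1 -> H e ->
      P [set w | b eps e w] = eps%:E)
    (indep : forall eps, 0 < eps < 1 ->
      mutually_independent P (source_index H) (source_events r r' (b eps)))
    (C : R) (C_pos : 0 < C)
    (elliptic : uniformly_elliptic H mu \/ (Kmu H mu C < +oo)%E) :
  ereal_inf [set (correlation P
      (random_resistance H E r uv.1 uv.2)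
      (random_resistance H E (noisy r r' (b eps)) uv.1 uv.2))%:E
    | uv in [set uv : V * V | uv.1 != uv.2]] @[eps --> 0^'+] --> 1%E.
Proof.
(* Independence is given level by level; what concerns [r] and [r'] alone is read off at level
   1/2. *)
have half01 : 0 < (2^-1 : R) < 1 by lra.
have noise : (exists M kappa : R,
      [/\ 0 <= M, 0 <= kappa & nondegenerate_noise H r r' M kappa]) \/
    (forall e, H e -> noise_numerator r r' e = 0%E).
  case: elliptic => [ell|Kfin].
    by left; apply: (elliptic_noise (indep _ half01) r_law r'_law).
  apply: (finite_K_noise (indep _ half01) r_law r'_law r_pos r'_pos C_pos _ Kfin).
  exact: half_edges_nonempty E_connected H_half two_vertices.
have [K bound] : exists K : R, forall eps (uv : V * V), 0 < eps < 1 -> uv.1 != uv.2 ->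
    1 - eps * K <= correlation P (random_resistance H E r uv.1 uv.2)
      (random_resistance H E (noisy r r' (b eps)) uv.1 uv.2) <= 1.
  case: noise => [[M [kappa [M0 k0 nd]]]|num0].
    exists (stability_constant M kappa / 2) => eps [u v] eps01 _ /=.
    have [p [path_p last_p]] := E_connected u v.
    rewrite mulrA; have /andP[/ltW eps0 _] := eps01.
    apply: (nondegenerate_correlation E_symmetric E_locally_finite H_half (indep _ eps01)
      r_law r'_law r_pos r'_pos mu_L2 eps0 _ path_p last_p M0 k0 nd).
    by move=> e; exact: b_law.
  exists 0 => eps [u v] eps01 _ /=.
  have [p [path_p last_p]] := E_connected u v.
  have /andP[/ltW eps0 _] := eps01.
  have -> : eps * 0 = eps * 0 / 2 :> R by rewrite mulr0 mul0r.
  apply: (degenerate_correlation E_symmetric E_locally_finite H_half (indep _ eps01)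
    r_law r'_law r_pos r'_pos mu_L2 eps0 _ path_p last_p num0).
  by move=> e; exact: b_law.
apply: (@cvg_ereal_inf_at_right R (V * V)%type _ _ K); last exact: bound.
by have [u [v uv]] := two_vertices; exists (u, v).
Qed.
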